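(* Suppose the Permanent Anti-Concentration Conjecture holds, i.e. there exists a polynomial $p$ such that for all $n$ and all $\delta>0$, $$\Pr_{X\sim\mathcal{N}(0,1)_{\mathbb{C}}^{n\times n}}\left[|\mathrm{Per}(X)|<\frac{\sqrt{n!}}{p(n,1/\delta)}\right]<\delta.$$ Then the problems $|\mathrm{GPE}|^2_{\pm}$ and $\mathrm{GPE}_{\times}$ are polynomial-time equivalent (each is polynomial-time reducible to the other).
   Context: $\mathcal{N}(0,1)_{\mathbb{C}}$ is the complex Gaussian distribution with mean $0$ and $\mathrm{E}|z|^2=1$; $\mathcal{N}(0,1)_{\mathbb{C}}^{n\times n}$ is the distribution of $n\times n$ matrices with i.i.d. such entries. $\mathrm{Per}$ is the permanent. The problem $|\mathrm{GPE}|^2_{\pm}$: given $X\sim\mathcal{N}(0,1)_{\mathbb{C}}^{n\times n}$ and error bounds $\varepsilon,\delta>0$, estimate $|\mathrm{Per}(X)|^2$ to within additive error $\pm\varepsilon\cdot n!$, with probability at least $1-\delta$ over $X$, in $\mathrm{poly}(n,1/\varepsilon,1/\delta)$ time. The problem $\mathrm{GPE}_{\times}$: given $X\sim\mathcal{N}(0,1)_{\mathbb{C}}^{n\times n}$ and error bounds $\varepsilon,\delta>0$, estimate $\mathrm{Per}(X)$ to within error $\pm\varepsilon\cdot|\mathrm{Per}(X)|$ (output $z\in\mathbb{C}$ with $|z-\mathrm{Per}(X)|\le\varepsilon|\mathrm{Per}(X)|$), with probability at least $1-\delta$ over $X$, in $\mathrm{poly}(n,1/\varepsilon,1/\delta)$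 time. Inputs are $\langle X,0^{1/\varepsilon},0^{1/\delta}\rangle$ (errors in unary). An oracle solves one of these problems if for all $n,\varepsilon,\delta$ its output meets the stated accuracy with probability at least $1-\delta$ over $X$. One problem is polynomial-time reducible to another if, given any oracle solving the latter, the former is solved by an algorithm making oracle calls and running in time $\mathrm{poly}(n,1/\varepsilon,1/\delta)$. Matrix entries are understood as rounded to polynomially many bits; precision issues are ignored. *)

(* Defs.v *)
From HB Require Import structures.
From mathcomp Require Import all_boot all_order all_algebra all_fingroup.
From mathcomp Require Import all_classical all_reals all_analysis.
From mathcomp Require Import complex polyXY.

Set Implicit Arguments.
Unset Strict Implicit.
Unset Printing Implicit Defensive.
Import Order.TTheory GRing.Theory Num.Theory.
Import numFieldNormedType.Exports.

Local Open Scope classical_set_scope.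
Local Open Scope ring_scope.
Local Open Scope complex_scope.

Definition per (K : comNzRingType) (n : nat) (A : 'M[K]_n) : K :=
  \sum_(s : 'S_n) \prod_(i < n) A i (s i).

Definition tcons (T : Type) (n : nat) (xt : T * n.-tuple T) : n.+1.-tuple T :=
  [tuple of xt.1 :: xt.2].

Lemma measurable_tcons d (T : measurableType d) n :
  measurable_fun [set: T * n.-tuple T] (@tcons T n).
Proof. exact: measurable_cons. Qed.

HB.instance Definition _ d (T : measurableType d) n :=
  isMeasurableFun.Build _ _ _ _ (@tcons T n) (@measurable_tcons d T n).

(* The n-fold product of the probability measure P with itself. *)
Fixpoint iid (R : realType) d (T : measurableType d) (P : probability T R)
    (n : nat) : probability (n.-tuple T) R :=
  match n with
  | 0 => dirac [tuple] : probability _ R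
  | k.+1 => distribution (P \x iid P k)%E (@tcons T k) : probability _ R
  end.

(* The pair (Re z, Im z) for z ~ N(0,1)_C: the second argument of normal_prob is
   a standard deviation, so each part has variance 1/2 and E|z|^2 = 1. *)
Definition cgauss (R : realType) :
    probability (measurableTypeR R * measurableTypeR R)%type R :=
  (normal_prob (0 : R) (Num.sqrt 2)^-1 \x normal_prob (0 : R) (Num.sqrt 2)^-1)%E.

Definition mx_of_tuples (R : realType) (n : nat)
    (t : n.-tuple (n.-tuple (R * R))) : 'M[R[i]]_n :=
  \matrix_(i, j) let z := tnth (tnth t i) j in z.1 +i* z.2.

(* Pr_{X ~ N(0,1)_C^{n x n}} [E] *)
Definition PrG (R : realType) (n : nat) (E : set 'M[R[i]]_n) : \bar R :=
  iid (iid (cgauss R) n) n (@mx_of_tuples R n @^-1` E).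

(* The positivity clause is implicit in dividing by p(n, 1/delta); without it
   the bound could be made vacuous, for instance by p = 0. *)
Definition PACC (R : realType) : Prop :=
  exists p : {poly {poly R}},
    (forall (n : nat) (delta : R), 0 < delta -> 0 < p.[n%:R, delta^-1]) /\
    (forall (n : nat) (delta : R), 0 < delta ->
      (PrG [set X : 'M[R[i]]_n |
         (`|per X| < (Num.sqrt (n`!)%:R / p.[n%:R, delta^-1])%:C)%R]
       < delta%:E)%E).

(* Polynomial time is time on a random access machine with signed integer
   registers, indexed by integers, under the logarithmic cost criterion: every
   operation is charged the binary lengths of the addresses and values involved.
   Programs are structured, and a word is a finite sequence of integers. *)

Definition zsize (z : int) : nat := (trunc_log 2 `|z|%N).+1.

Definition wsize (w : seq int) : nat := (\sum_(z <- w) zsize z)%N.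

Definition memory := int -> int.

Inductive aexpr : Type :=
  | Const of int
  | Reg of aexpr
  | Add of aexpr & aexpr
  | Sub of aexpr & aexpr
  | Mul of aexpr & aexpr.

Fixpoint aeval (m : memory) (e : aexpr) : int :=
  match e with
  | Const z => z
  | Reg a => m (aeval m a)
  | Add e1 e2 => aeval m e1 + aeval m e2
  | Sub e1 e2 => aeval m e1 - aeval m e2
  | Mul e1 e2 => aeval m e1 * aeval m e2
  end.

Fixpoint acost (m : memory) (e : aexpr) : nat :=
  (zsize (aeval m e) +
   match e with
   | Const _ => 0
   | Reg a => acost m a
   | Add e1 e2 | Sub e1 e2 | Mul e1 e2 => acost m e1 + acost m e2
   end)%N.

(* A word w is stored at address a as its length followed by its letters. *)
Definition write_word (m : memory) (a : int) (w : seq int) : memory :=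
  fun x => if a <= x <= a + (size w)%:Z
           then ((size w)%:Z :: w)`_(`|x - a|%N) else m x.

Definition read_word (m : memory) (a : int) : seq int :=
  [seq m (a + i.+1%:Z) | i <- iota 0 `|m a|%N].

Inductive cmd : Type :=
  | Store of aexpr & aexpr
  | Seq of cmd & cmd
  | If of aexpr & cmd & cmd
  | While of aexpr & cmd
  | Query of aexpr & aexpr.

(* exec O c m m' k: with oracle O, the program c started in memory m halts in
   memory m' at cost k. [Query ea ed] writes at address [ed] the oracle's answer
   to the word stored at address [ea]; question and answer are both charged their
   full binary length. *)
Inductive exec (O : seq int -> seq int) :
    cmd -> memory -> memory -> nat -> Prop :=
  | ExecStore m ea e :
      exec O (Store ea e) m [eta m with aeval m ea |-> aeval m e]
        (acost m ea + acost m e)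
  | ExecSeq c1 c2 m1 m2 m3 k1 k2 :
      exec O c1 m1 m2 k1 -> exec O c2 m2 m3 k2 ->
      exec O (Seq c1 c2) m1 m3 (k1 + k2)
  | ExecIfPos e c1 c2 m m' k :
      0 < aeval m e -> exec O c1 m m' k ->
      exec O (If e c1 c2) m m' (acost m e + k)
  | ExecIfNeg e c1 c2 m m' k :
      aeval m e <= 0 -> exec O c2 m m' k ->
      exec O (If e c1 c2) m m' (acost m e + k)
  | ExecWhileStop e c m :
      aeval m e <= 0 -> exec O (While e c) m m (acost m e)
  | ExecWhileLoop e c m1 m2 m3 k1 k2 :
      0 < aeval m1 e -> exec O c m1 m2 k1 -> exec O (While e c) m2 m3 k2 ->
      exec O (While e c) m1 m3 (acost m1 e + k1 + k2)
  | ExecQuery ea ed m :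
      exec O (Query ea ed) m
        (write_word m (aeval m ed) (O (read_word m (aeval m ea))))
        (acost m ea + acost m ed + wsize (read_word m (aeval m ea)) +
         wsize (O (read_word m (aeval m ea)))).

(* Input and output words are at address 0; all other registers start at 0. *)
Definition computes (O : seq int -> seq int) (c : cmd) (w v : seq int) (k : nat)
    : Prop :=
  exists m k0, [/\ exec O c (write_word (fun=> 0) 0 w) m k0,
                   read_word m 0 = v & k = (k0 + wsize v)%N].

(* The input <X, 0^s, 0^t> with s = 1/epsilon and t = 1/delta, where the real
   and imaginary parts of the entries of X are rounded down to b binary places:
   an entry x is transmitted as the integers floor(2^b Re x), floor(2^b Im x).
   The block of zeros writes s, t and b in unary. *)
Definition encode (R : realType) (n s t b : nat) (X : 'M[R[i]]_n) : seq int :=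
  [:: n%:Z; s%:Z; t%:Z; b%:Z] ++ nseq (s + t + b) (0 : int) ++
  flatten [seq [:: Num.floor (2 ^+ b * complex.Re (X i j));
                   Num.floor (2 ^+ b * complex.Im (X i j))]
          | i <- enum 'I_n, j <- enum 'I_n].

(* An estimation problem: [pb n X s w] says that the output word w is an
   acceptable answer on X for the error bound epsilon = 1/s. Outputs are
   rational (or Gaussian rational) numbers, given as a numerator and a
   denominator. *)
Definition problem (R : realType) : Type :=
  forall n : nat, 'M[R[i]]_n -> nat -> seq int -> Prop.

(* |GPE|^2_{+-} *)
Definition GPE2_add (R : realType) : problem R := fun n X s w =>
  `| (w`_0)%:~R / (w`_1)%:~R - `|per X| ^+ 2 | <= s%:R^-1 * (n`!)%:R :> R[i].

(* GPE_x *)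
Definition GPE_mul (R : realType) : problem R := fun n X s w =>
  `| ((w`_0)%:~R +i* (w`_1)%:~R) / (w`_2)%:~R - per X |
    <= s%:R^-1 * `|per X| :> R[i].

(* F, seen as a black box, solves pb: its answers have polynomial length and,
   for every polynomially large enough number b of bits of precision, it is
   accurate with probability at least 1 - 1/t over the exact Gaussian matrix X,
   of which F only sees the rounding. *)
Definition solves (R : realType) (pb : problem R) (F : seq int -> seq int)
    : Prop :=
  (exists q : {poly nat}, forall (n s t b : nat) (X : 'M[R[i]]_n),
     (0 < s)%N -> (0 < t)%N ->
     (wsize (F (encode s t b X)) <= q.[wsize (encode s t b X)])%N) /\
  (exists beta : {poly nat}, forall n s t b : nat,
     (0 < s)%N -> (0 < t)%N -> (beta.[(n + s + t)%N] <= b)%N ->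
     ((1 - t%:R^-1)%:E <=
        PrG [set X : 'M[R[i]]_n | pb n X s (F (encode s t b X))])%E).

(* One program works for all oracles solving pb2; since question and answer
   lengths are charged, the polynomial bounding the running time may depend on
   the length bound of the oracle. The time bound is worst-case in the length of
   the input, which is poly(n, 1/epsilon, 1/delta) when the entries of X are
   written with that many bits. *)
Definition poly_reducible (R : realType) (pb1 pb2 : problem R) : Prop :=
  exists c : cmd, forall O : seq int -> seq int, solves pb2 O ->
    exists F : seq int -> seq int, solves pb1 F /\
      exists T : {poly nat}, forall (n s t b : nat) (X : 'M[R[i]]_n),
        (0 < s)%N -> (0 < t)%N ->
        exists k : nat,
          computes O c (encode s t b X) (F (encode s t b X)) k /\
          (k <= T.[wsize (encode s t b X)])%N.

Definition poly_equivalent (R : realType) (pb1 pb2 : problem R) : Prop :=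
  poly_reducible pb1 pb2 /\ poly_reducible pb2 pb1.

(* Main.v *)
(* Reducing |GPE|^2 to GPE is a squaring: the relative error on [Per X] becomes an
   additive error on [|Per X|^2], which is at most a multiple of [n!] with high
   probability by Markov's inequality, as [E |Per X|^2 <= n!].

   Conversely, let [X_k] be the bottom right [k x k] block of [X]. Expanding along
   the first row, [Per X_(k+1) = x Y + Z] with [x = a + i b] the corner entry,
   [Y = Per X_k] and [Z] independent of [x]. Changing the sign of [a] or of [b]
   preserves the Gaussian law and commutes with rounding, as
   [floor (- y) = -1 - floor y] almost surely, so the oracle can be queried on
   the three matrices, and
     [|x Y + Z|^2 - |(- a + i b) Y + Z|^2 = 4 a Re (Z / Y) |Y|^2],
   and similarly for [b] and [Im (Z / Y)]. As [|Y|^2] was estimated at the previous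
   level, this gives [Per X_(k+1) / Per X_k = x + Z / Y]. Anti-concentration makes
   the additive errors relative ones, up to a polynomial factor, and the product
   of the [n] ratios, computed exactly on integers, estimates [Per X]. *)

Require Import Defs.
From HB Require Import structures.
From mathcomp Require Import all_boot all_order all_algebra all_fingroup.
From mathcomp Require Import all_classical all_reals all_analysis.
From mathcomp Require Import measurable_realfun complex polyXY zify ring lra.

Set Implicit Arguments.
Unset Strict Implicit.
Unset Printing Implicit Defensive.
Import Order.TTheory GRing.Theory Num.Theory.
Import numFieldNormedType.Exports.

Local Open Scope classical_set_scope.
Local Open Scope ring_scope.
Local Open Scope complex_scope.

(** * Measure-preserving maps *)

(** The oracle is reliable only on average. Queries are therefore kept exactly Gaussian, by
    symmetries of the law, instead of being small perturbations whose statistical distance would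
    have to be controlled. The queries derived from one input are highly dependent, so probabilities
    are combined by union bounds only, and accuracy is then proved deterministically on a good
    matrix. The oracle is an arbitrary function; events about its answers are measurable because it
    sees only roundings, which take countably many values. Upper bounds on moments suffice, so no
    Gaussian moment is computed exactly: symmetry removes cross terms and a comparison of densities
    bounds the variance. The ratios divide by the parts of the corner entry and by the estimate of
    [|Y|^2]; both are bounded below through a polynomial quantity [L], which also converts absolute
    errors into relative ones. The programs must halt in time on every input, good or not, so their
    cost is analysed for any oracle of bounded answer length, apart from accuracy. *)

Definition mpres (R : realType) d d' (T : measurableType d)
    (T' : measurableType d') (P : probability T R) (Q : probability T' R)
    (f : T -> T') : Prop :=
  measurable_fun setT f /\
  forall A, measurable A -> P (f @^-1` A) = Q A.

Section MeasurePreserving.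
Context (R : realType).

Lemma mpres_id d (T : measurableType d) (P : probability T R) : mpres P P id.
Proof. by split. Qed.

Lemma mpres_comp d1 d2 d3 (T1 : measurableType d1) (T2 : measurableType d2)
    (T3 : measurableType d3) (P1 : probability T1 R) (P2 : probability T2 R)
    (P3 : probability T3 R) (g : T2 -> T3) (f : T1 -> T2) :
  mpres P2 P3 g -> mpres P1 P2 f -> mpres P1 P3 (g \o f).
Proof.
move=> [mg Pg] [mf Pf]; split; first exact: measurableT_comp.
by move=> A mA; rewrite comp_preimage Pf ?Pg// -[_ @^-1` _]setTI; exact: mg.
Qed.

Lemma mpres_fst d1 d2 (T1 : measurableType d1) (T2 : measurableType d2)
    (P1 : probability T1 R) (P2 : probability T2 R) :
  mpres (P1 \x P2)%E P1 fst.
Proof.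
split => // A mA.
have -> : fst @^-1` A = A `*` [set: T2] by apply/seteqP; split => x //= [].
apply: etrans (product_measure1E _ _ mA measurableT) _.
by rewrite [X in (_ * X)%E](probability_setT P2) mule1.
Qed.

Lemma mpres_snd d1 d2 (T1 : measurableType d1) (T2 : measurableType d2)
    (P1 : probability T1 R) (P2 : probability T2 R) :
  mpres (P1 \x P2)%E P2 snd.
Proof.
split => // A mA.
have -> : snd @^-1` A = [set: T1] `*` A by apply/seteqP; split => x //= [].
apply: etrans (product_measure1E _ _ measurableT mA) _.
by rewrite [X in (X * _)%E](probability_setT P1) mul1e.
Qed.

(** The product measure integrates the measures of sections: the second map is handled section by
    section inside the integral, the first by a change of variables outside. *)
Lemma mpres_prod d1 d2 d3 d4 (T1 : measurableType d1) (T2 : measurableType d2)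
    (U1 : measurableType d3) (U2 : measurableType d4)
    (P1 : probability T1 R) (P2 : probability T2 R)
    (Q1 : probability U1 R) (Q2 : probability U2 R) f1 f2 :
  mpres P1 Q1 f1 -> mpres P2 Q2 f2 ->
  mpres (P1 \x P2)%E (Q1 \x Q2)%E (fun x => (f1 x.1, f2 x.2)).
Proof.
move=> [mf1 Pf1] [mf2 Pf2]; split.
  by apply: measurable_fun_pair; exact: measurableT_comp.
move=> A mA; rewrite /= /product_measure1 /=.
transitivity (\int[P1]_x (Q2 \o xsection A) (f1 x))%E.
  apply: eq_integral => x _ /=; rewrite -Pf2//; exact: measurable_xsection.
transitivity (\int[pushforward P1 f1]_x (Q2 \o xsection A) x)%E.
  rewrite ge0_integral_pushforward//; first exact: measurable_fun_xsection.
by apply: eq_measure_integral => B mB _; exact: Pf1.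
Qed.

Lemma mpres_tcons d (T : measurableType d) (P : probability T R) n :
  mpres (P \x iid P n)%E (iid P n.+1) (@tcons T n).
Proof. by split => //; exact: measurable_tcons. Qed.

Definition tuncons T n (t : n.+1.-tuple T) : T * n.-tuple T :=
  (thead t, [tuple of behead t]).

Lemma tconsK T n : cancel (@tcons T n) (@tuncons T n).
Proof.
by move=> [x t]; congr pair; rewrite ?theadE//; exact/val_inj.
Qed.

Lemma measurable_tuncons d (T : measurableType d) n :
  measurable_fun setT (@tuncons T n).
Proof.
apply: measurable_fun_pair; first exact: measurable_tnth.
exact: measurable_behead.
Qed.

Lemma mpres_tuncons d (T : measurableType d) (P : probability T R) n :
  mpres (iid P n.+1) (P \x iid P n)%E (@tuncons T n).
Proof.
split; first exact: measurable_tuncons.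
move=> A mA /=; rewrite /distribution /pushforward /= -comp_preimage.
by congr (_ _); apply/seteqP; split => x /=; rewrite tconsK.
Qed.

Lemma mpres_behead d (T : measurableType d) (P : probability T R) n :
  mpres (iid P n.+1) (iid P n) (fun t => [tuple of behead t]).
Proof. exact: mpres_comp (mpres_snd P (iid P n)) (mpres_tuncons P n). Qed.

Lemma mpres_thead d (T : measurableType d) (P : probability T R) n :
  mpres (iid P n.+1) P (fun t => thead t).
Proof. exact: mpres_comp (mpres_fst P (iid P n)) (mpres_tuncons P n). Qed.

Lemma mpres_map d d' (T : measurableType d) (U : measurableType d')
    (P : probability T R) (Q : probability U R) f n :
  mpres P Q f -> mpres (iid P n) (iid Q n) (fun t : n.-tuple T => [tuple of map f t]).
Proof.
move=> Pf; elim: n => [|n IHn].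
  have -> : (fun t : 0.-tuple T => [tuple of map f t]) = fun _ => [tuple] :> 0.-tuple U.
    by apply/funext => t; apply/val_inj; rewrite (tuple0 t).
  split; first exact: measurable_cst.
  by move=> A mA; rewrite /= /dirac !indicE; congr (_%:R%:E).
have -> : (fun t : n.+1.-tuple T => [tuple of map f t]) =
    @tcons U n \o ((fun x : T * n.-tuple T => (f x.1, [tuple of map f x.2])) \o @tuncons T n).
  by apply/funext => t; case/tupleP: t => x t; apply/val_inj.
apply: mpres_comp (mpres_tcons _ _) _.
exact: mpres_comp (mpres_prod Pf IHn) (mpres_tuncons _ _).
Qed.

(** Nested twice, on the first row and on its first entry, this alters the corner entry of a matrix
    alone. *)
Lemma mpres_map_head d (T : measurableType d) (P : probability T R) f n :
  mpres P P f ->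
  mpres (iid P n.+1) (iid P n.+1)
    (fun t => tcons (f (thead t), [tuple of behead t])).
Proof.
move=> Pf.
apply: (mpres_comp (mpres_tcons _ _)
  (f := (fun x => (f x.1, x.2)) \o @tuncons T n)).
exact: mpres_comp (mpres_prod Pf (mpres_id _)) (mpres_tuncons _ _).
Qed.

End MeasurePreserving.

(** * Gaussian moments and the second moment of the permanent *)

Section NormalDistribution.
Context (R : realType).
Notation mu := (@lebesgue_measure R).

(** Lebesgue measure is determined by half-open intervals; reflection exchanges their open and
    closed ends but keeps their length. *)
Lemma lebesgue_measure_oppr (A : set (measurableTypeR R)) :
  measurable A -> mu ((-%R : measurableTypeR R -> measurableTypeR R) @^-1` A) = mu A.
Proof.
move=> mA; symmetry.
have mN : measurable_fun setT (-%R : measurableTypeR R -> measurableTypeR R).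
  exact: oppr_measurable.
pose nu := pushforward (mu : {measure set (measurableTypeR R) -> \bar R})
  (-%R : measurableTypeR R -> measurableTypeR R).
pose mNm := isMeasurableFun.Build _ _ _ _ _ mN.
pose N : {mfun measurableTypeR R >-> measurableTypeR R} :=
  HB.pack (-%R : measurableTypeR R -> measurableTypeR R) mNm.
apply: (@lebesgue_measure_unique R (pushforward mu N)) => // X [[a b] _ <-] /=.
rewrite /pushforward /=.
have -> : (-%R : measurableTypeR R -> measurableTypeR R) @^-1` `]a, b]%classic = `[- b, - a[%classic.
  apply/seteqP; split => x /=; rewrite !in_itv/=.
    by rewrite lerNl ltrNr => /andP[-> ->].
  by rewrite lerNl ltrNr => /andP[-> ->].
rewrite !lebesgue_measure_itv/= !lte_fin ltrN2; case: ifP => // _.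
by rewrite opprK addrC.
Qed.

Lemma normal_pdf_oppr (s x : R) : s != 0 -> normal_pdf 0 s (- x) = normal_pdf 0 s x.
Proof.
by move=> s0; rewrite !normal_pdfE// /normal_fun !subr0 sqrrN.
Qed.

Lemma mpres_normal_oppr (s : R) : s != 0 ->
  mpres (normal_prob 0 s) (normal_prob 0 s)
    (-%R : measurableTypeR R -> measurableTypeR R).
Proof.
move=> s0; have mN : measurable_fun setT (-%R : measurableTypeR R -> measurableTypeR R).
  exact: oppr_measurable.
split=> // A mA; rewrite /= /normal_prob.
transitivity (\int[mu]_(x in -%R @^-1` A) ((fun y => (normal_pdf 0 s y)%:E) \o -%R) x)%E.
  by apply: eq_integral => x _ /=; rewrite normal_pdf_oppr.
rewrite -(@ge0_integral_pushforward _ _ (measurableTypeR R) (measurableTypeR R) R _ mN mu A)//; first last.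
- by move=> x _; rewrite lee_fin normal_pdf_ge0.
- by apply/measurable_funTS/measurable_EFinP; exact: measurable_normal_pdf.
by apply: eq_measure_integral => B mB _; exact: lebesgue_measure_oppr.
Qed.

(** The change of variables is made with the Radon-Nikodym derivative, which agrees with
    [normal_pdf] almost everywhere because both have the same integral over every measurable set. *)
Lemma integral_normal_prob (m s : R) (f : R -> \bar R) : 
  measurable_fun setT f -> (forall x, 0 <= f x)%E ->
  (\int[normal_prob m s]_x f x = \int[mu]_x (f x * (normal_pdf m s x)%:E))%E.
Proof.
move=> mf f0; have dom := normal_prob_dominates m s.
rewrite -(Radon_Nikodym_SigmaFinite.change_of_variables dom)//.
apply: ge0_ae_eq_integral => //.
- apply: emeasurable_funM => //.
  exact: measurable_int (Radon_Nikodym_SigmaFinite.f_integrable dom).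
- apply: emeasurable_funM => //.
  by apply/measurable_EFinP; exact: measurable_normal_pdf.
- by move=> x _; rewrite mule_ge0 ?Radon_Nikodym_SigmaFinite.f_ge0.
- by move=> x _; rewrite mule_ge0// lee_fin normal_pdf_ge0.
apply: ae_eqe_mul2l.
apply: integral_ae_eq => //.
- exact: (Radon_Nikodym_SigmaFinite.f_integrable dom).
- by apply/measurable_EFinP; exact: measurable_normal_pdf.
- by move=> E _ mE; rewrite -Radon_Nikodym_SigmaFinite.f_integral.
Qed.

(* From [u <= e^u - 1] with [u = l x^2]: the integral of [e^(l x^2)] against
   N(0, s^2) is a multiple [c] of the total mass of N(0, (c s)^2). *)
Lemma normal_second_moment_aux (s c : R) : 0 < s -> 1 < c ->
  (\int[normal_prob 0%R s]_x (x ^+ 2)%:E <=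
     (2 * s ^+ 2 * (c ^+ 2 / (c + 1)))%:E)%E.
Proof.
move=> s0 c1; have sn0 : s != 0 by rewrite gt_eqF.
have c0 : 0 < c by lra.
have cs0 : c * s != 0 by rewrite mulf_neq0// gt_eqF.
have mpdf t : measurable_fun setT (fun x : R => (normal_pdf 0 t x)%:E).
  by apply/measurable_EFinP; exact: measurable_normal_pdf.
have mx2 : measurable_fun setT (fun x : R => (x ^+ 2)%:E).
  by apply/measurable_EFinP; exact: measurable_funX.
have mxp : measurable_fun setT (fun x : R => ((x ^+ 2)%:E * (normal_pdf 0 s x)%:E)%E).
  by apply: emeasurable_funM; [exact: mx2|exact: mpdf].
have mlxp l : measurable_fun setT (fun x : R => (l%:E * ((x ^+ 2)%:E * (normal_pdf 0 s x)%:E))%E).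
  exact: measurable_funeM.
have mcp l : measurable_fun setT (fun x : R => (l%:E * (normal_pdf 0 (c * s) x)%:E)%E).
  by apply: measurable_funeM; exact: mpdf.
rewrite integral_normal_prob//; last by move=> x; rewrite lee_fin sqr_ge0.
(* Chosen so that [1 / (2 s^2) - l = 1 / (2 (c s)^2)]: multiplying by [e^(l x^2)] widens the density
   exactly to standard deviation [c s]. *)
pose l := (1 - c ^- 2) / (2 * s ^+ 2).
have l0 : 0 < l.
  rewrite /l divr_gt0 ?mulr_gt0 ?exprn_gt0// subr_gt0 invf_lt1 ?exprn_gt0//.
  by rewrite exprn_egt1.
have key x : l * x ^+ 2 * normal_pdf 0 s x + normal_pdf 0 s x <= c * normal_pdf 0 (c * s) x.
  have -> : c * normal_pdf 0 (c * s) x = normal_pdf 0 s x * expR (l * x ^+ 2).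
    rewrite !normal_pdfE// /normal_fun !subr0 -mulrA -expRD mulrA; congr (_ * expR _).
      rewrite /normal_peak exprMn -mulrA -mulrnAr sqrtrM ?sqr_ge0//.
      by rewrite sqrtr_sqr gtr0_norm// invfM mulrA divff ?gt_eqF// mul1r.
    by rewrite /l; field; rewrite gt_eqF//=; rewrite gt_eqF.
  rewrite [leLHS](_ : _ = normal_pdf 0 s x * (1 + l * x ^+ 2)); last by ring.
  by rewrite ler_wpM2l ?normal_pdf_ge0// expR_ge1Dx.
have : (l%:E * \int[mu]_x ((x ^+ 2)%:E * (normal_pdf 0 s x)%:E) + 1 <= c%:E)%E.
  have -> : (l%:E * \int[mu]_x ((x ^+ 2)%:E * (normal_pdf 0 s x)%:E) =
      \int[mu]_x (l%:E * ((x ^+ 2)%:E * (normal_pdf 0 s x)%:E)))%E.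
    rewrite ge0_integralZl// ?lee_fin ?ltW//.
    by move=> x _; rewrite mule_ge0 ?lee_fin ?sqr_ge0 ?normal_pdf_ge0.
  have -> : (\int[mu]_x (l%:E * ((x ^+ 2)%:E * (normal_pdf 0 s x)%:E)) + 1 =
      \int[mu]_x (l%:E * ((x ^+ 2)%:E * (normal_pdf 0 s x)%:E) + (normal_pdf 0 s x)%:E))%E.
    rewrite ge0_integralD ?integral_normal_pdf//.
    - by move=> x _; rewrite !mule_ge0 ?lee_fin ?sqr_ge0 ?normal_pdf_ge0// ltW.
    - exact: mlxp.
    - by move=> x _; rewrite lee_fin normal_pdf_ge0.
    - exact: mpdf.
  apply: (@le_trans _ _ (\int[mu]_x (c%:E * (normal_pdf 0%R (c * s) x)%:E))%E).
    apply: ge0_le_integral => //.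
    - move=> x _; rewrite adde_ge0//.
      by rewrite !mule_ge0 ?lee_fin ?sqr_ge0 ?normal_pdf_ge0// ltW.
      by rewrite lee_fin normal_pdf_ge0.
    - by apply: emeasurable_funD; [exact: mlxp|exact: mpdf].
    - exact: mcp.
    - by move=> x _; rewrite -!EFinM -EFinD lee_fin mulrA.
  rewrite ge0_integralZl ?integral_normal_pdf ?mule1//.
  - exact: mpdf.
  - by move=> x _; rewrite lee_fin normal_pdf_ge0.
  - by rewrite lee_fin ltW.
have I0 : (0 <= \int[mu]_x ((x ^+ 2)%:E * (normal_pdf 0 s x)%:E))%E.
  by apply: integral_ge0 => x _; rewrite mule_ge0 ?lee_fin ?sqr_ge0 ?normal_pdf_ge0.
(* An infinite integral would contradict the bound by [c], as [l > 0]. *)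
case: (integral _ _ _) I0 => [r| |]//= _; last by rewrite gt0_muley ?lte_fin.
rewrite -EFinM -EFinD !lee_fin => H.
rewrite -(ler_pM2l l0); apply: le_trans (_ : c - 1 <= _); first by lra.
rewrite le_eqVlt; apply/orP; left; apply/eqP; rewrite /l; field.
by rewrite !gt_eqF//; lra.
Qed.

Lemma normal_second_moment (s : R) : 0 < s ->
  (\int[normal_prob 0%R s]_x (x ^+ 2)%:E <= (s ^+ 2)%:E)%E.
Proof.
move=> s0; apply/lee_addgt0Pr => e e0.
(* As [c] tends to 1, [2 s^2 c^2 / (c + 1)] tends to [s^2]; this [c] keeps the excess below [e],
   because [c^2 / (c + 1) <= 1/2 + (c - 1)]. *)
pose c := 1 + e / (2 * s ^+ 2).
have d0 : 0 < e / (2 * s ^+ 2) by rewrite divr_gt0// mulr_gt0// exprn_gt0.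
have c1 : 1 < c by rewrite /c; lra.
apply: le_trans (normal_second_moment_aux s0 c1) _.
rewrite -EFinD lee_fin.
have -> : e = 2 * s ^+ 2 * (c - 1) by rewrite /c; field; rewrite gt_eqF.
have -> : s ^+ 2 + 2 * s ^+ 2 * (c - 1) = 2 * s ^+ 2 * (2^-1 + (c - 1)) by field.
rewrite ler_pM2l; last by rewrite mulr_gt0// exprn_gt0.
rewrite ler_pdivrMr; last by lra.
nra.
Qed.

(** The density never exceeds its peak. This will keep the parts of the corner entry, by which the
    estimate divides, away from 0. *)
Lemma normal_small_ball (m s t : R) : s != 0 -> 0 <= t ->
  (normal_prob m s [set x | (`|x| < t)%R] <= (normal_peak s * (2 * t))%:E)%E.
Proof.
move=> s0 t0; rewrite /normal_prob.
pose B := `]- t, t[%classic.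
have -> : [set x : R | `|x| < t] = B.
  by apply/seteqP; rewrite /B; split => x /=; rewrite in_itv/= ltr_norml.
have mB : measurable (B : set (measurableTypeR R)) by exact: measurable_itv.
apply: (@le_trans _ _ (\int[mu]_(x in B) (normal_peak s)%:E))%E.
  apply: ge0_le_integral => //=.
  - by move=> x _; rewrite lee_fin normal_pdf_ge0.
  - by apply/measurable_funTS/measurable_EFinP; exact: measurable_normal_pdf.
  - by move=> x _; rewrite lee_fin normal_pdf_ub.
rewrite integral_cst//= /B lebesgue_measure_itv/= lte_fin EFinM.
rewrite lee_wpmul2l ?lee_fin ?normal_peak_ge0//.
by case: ifP => _; rewrite -?EFinN -?EFinD lee_fin; lra.
Qed.

Lemma normal_countable (m s : R) (A : set R) : countable A ->
  normal_prob m s A = 0.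
Proof.
move=> cA; have mA : measurable A by exact: countable_measurable.
have /null_content_dominatesP := normal_prob_dominates m s.
by apply => //; exact: countable_lebesgue_measure0.
Qed.

End NormalDistribution.

(** * Laplace expansion of the permanent *)

Section Permanent.
Context (K : comNzRingType).

(** Permutations are grouped by the image [j] of 0; through [lift_perm], those with a given [j]
    correspond to the permutations of the remaining indices. *)
Lemma per_laplace n (A : 'M[K]_n.+1) :
  per A = \sum_j A ord0 j * per (row' ord0 (col' j A)).
Proof.
rewrite /per (partition_big (fun s : 'S_n.+1 => s ord0) xpredT) //=.
apply: eq_bigr => j _.
rewrite big_distrr /= (reindex (lift_perm ord0 j)); last first.
  (* Deletes [i] from the domain and [s i] from the range, which inverts [lift_perm]; the default
     [k] is never taken, since [s (lift i k)] differs from [s i]. *)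
  pose ulsf i (s : 'S_n.+1) k := odflt k (unlift (s i) (s (lift i k))).
  have ulsfK i (s : 'S_n.+1) k: lift (s i) (ulsf i s k) = s (lift i k).
    rewrite /ulsf; have:= neq_lift i k.
    by rewrite -(can_eq (permK s)) => /unlift_some[] ? ? ->.
  have inj_ulsf: injective (ulsf ord0 _).
    move=> s; apply: can_inj (ulsf (s ord0) s^-1%g) _ => k'.
    by rewrite {1}/ulsf ulsfK !permK liftK.
  exists (fun s => perm (inj_ulsf s)) => [s _ | s].
    by apply/permP=> k'; rewrite permE /ulsf lift_perm_lift lift_perm_id liftK.
  rewrite inE => /eqP <-; apply/permP=> k.
  case: (unliftP ord0 k) => [k'|] ->; rewrite ?lift_perm_id //.
  by rewrite lift_perm_lift -ulsfK permE.
apply: eq_big => [s|s _]; first by rewrite lift_perm_id eqxx.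
rewrite big_ord_recl lift_perm_id; congr (_ * _).
by apply: eq_bigr => i _; rewrite lift_perm_lift !mxE.
Qed.

Lemma per0 (A : 'M[K]_0) : per A = 1.
Proof.
rewrite /per (bigD1 1%g)//= big_ord0 big1 ?addr0// => s /eqP[].
by apply/permP => -[].
Qed.

End Permanent.

(** * Symmetries, measurability and second moment of the complex Gaussian law *)

Section ComplexGaussian.
Context (R : realType).
Local Notation C := R[i].

(** [|z|^2] as an element of [R], where integrals and a total order are available; the norm of
    [R[i]] takes its values in [R[i]]. *)
Definition sqn (z : C) : R := complex.Re z ^+ 2 + complex.Im z ^+ 2.

Lemma sqn_ge0 z : 0 <= sqn z.
Proof. by rewrite addr_ge0 ?sqr_ge0. Qed.

Lemma sqnM (y z : C) : sqn (y * z) = sqn y * sqn z.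
Proof. by case: y z => [a b] [c d]; rewrite /sqn /=; ring. Qed.

Lemma sqr_normcE (z : C) : `|z| ^+ 2 = (sqn z)%:C.
Proof.
by case: z => a b; rewrite normc_def /= -rmorphXn/= sqr_sqrtr// addr_ge0 ?sqr_ge0.
Qed.

Local Notation cval z := (z.1 +i* z.2).

Lemma mpres_integral d d' (T : measurableType d) (T' : measurableType d')
    (P : probability T R) (Q : probability T' R) (g : T -> T')
    (f : T' -> \bar R) :
  mpres P Q g -> measurable_fun setT f -> (forall x, 0 <= f x)%E ->
  (\int[Q]_x f x = \int[P]_x f (g x))%E.
Proof.
move=> [mg Pg] mf f0.
transitivity (\int[pushforward P g]_x f x)%E.
  by apply: eq_measure_integral => A mA _; exact/esym/Pg.
by rewrite ge0_integral_pushforward.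
Qed.

Lemma sqrtV2_neq0 : (Num.sqrt 2)^-1 != 0 :> R.
Proof. by rewrite invr_eq0 gt_eqF// sqrtr_gt0. Qed.

(** The map [z -> - conj z]; [conj_im] is complex conjugation, and their composite is [z -> - z]. *)
Definition conj_re (z : R * R) : R * R := (- z.1, z.2).
Definition conj_im (z : R * R) : R * R := (z.1, - z.2).

Lemma mpres_conj_re : mpres (cgauss R) (cgauss R) conj_re.
Proof.
exact: (mpres_prod (mpres_normal_oppr sqrtV2_neq0) (mpres_id _)).
Qed.

Lemma mpres_conj_im : mpres (cgauss R) (cgauss R) conj_im.
Proof.
exact: (mpres_prod (mpres_id _) (mpres_normal_oppr sqrtV2_neq0)).
Qed.

(** Measurability is imposed part by part, so that [R[i]] needs no sigma-algebra of its own. *)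
Definition cmeas d (T : measurableType d) (f : T -> C) :=
  measurable_fun setT (fun x => complex.Re (f x)) /\
  measurable_fun setT (fun x => complex.Im (f x)).

Section Cmeas.
Context d (T : measurableType d).

Lemma cmeas_cst c : cmeas (fun _ : T => c).
Proof. by split; exact: measurable_cst. Qed.

Lemma cmeasD (f g : T -> C) : cmeas f -> cmeas g -> cmeas (fun x => f x + g x).
Proof.
move=> [f1 f2] [g1 g2]; split.
  rewrite (_ : (fun x => _) = (fun x => complex.Re (f x) + complex.Re (g x))).
    exact: measurable_funD.
  by apply/funext => x; case: (f x) (g x) => [a b] [].
rewrite (_ : (fun x => _) = (fun x => complex.Im (f x) + complex.Im (g x))).
  exact: measurable_funD.
by apply/funext => x; case: (f x) (g x) => [a b] [].
Qed.

Lemma cmeasM (f g : T -> C) : cmeas f -> cmeas g -> cmeas (fun x => f x * g x).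
Proof.
move=> [f1 f2] [g1 g2]; split.
  rewrite (_ : (fun x => _) = (fun x => complex.Re (f x) * complex.Re (g x)
    - complex.Im (f x) * complex.Im (g x))).
    by apply: measurable_funB; exact: measurable_funM.
  by apply/funext => x; case: (f x) (g x) => [a b] [].
rewrite (_ : (fun x => _) = (fun x => complex.Re (f x) * complex.Im (g x)
  + complex.Im (f x) * complex.Re (g x))).
  by apply: measurable_funD; exact: measurable_funM.
by apply/funext => x; case: (f x) (g x) => [a b] [].
Qed.

Lemma cmeas_sum I (r : seq I) (P : pred I) (F : I -> T -> C) :
  (forall i, cmeas (F i)) -> cmeas (fun x => \sum_(i <- r | P i) F i x).
Proof.
move=> mF; elim: r => [|i r IHr].
  by under eq_fun do rewrite big_nil; exact: cmeas_cst.
by under eq_fun do rewrite big_cons; case: (P i) => //; exact: cmeasD.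
Qed.

Lemma cmeas_prod I (r : seq I) (P : pred I) (F : I -> T -> C) :
  (forall i, cmeas (F i)) -> cmeas (fun x => \prod_(i <- r | P i) F i x).
Proof.
move=> mF; elim: r => [|i r IHr].
  by under eq_fun do rewrite big_nil; exact: cmeas_cst.
by under eq_fun do rewrite big_cons; case: (P i) => //; exact: cmeasM.
Qed.

Lemma cmeas_per n (F : T -> 'M[C]_n) :
  (forall i j, cmeas (fun x => F x i j)) -> cmeas (fun x => per (F x)).
Proof. by move=> mF; apply: cmeas_sum => s; exact: cmeas_prod. Qed.

Lemma measurable_sqn (f : T -> C) :
  cmeas f -> measurable_fun setT (fun x => sqn (f x)).
Proof.
by move=> [f1 f2]; apply: measurable_funD; exact: measurable_funX.
Qed.

Lemma measurable_sqnE (f : T -> C) :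
  cmeas f -> measurable_fun setT (fun x => (sqn (f x))%:E).
Proof. by move=> mf; apply/measurable_EFinP; exact: measurable_sqn. Qed.

Lemma cmeas_comp d' (T' : measurableType d') (f : T -> C) (g : T' -> T) :
  cmeas f -> measurable_fun setT g -> cmeas (fun x => f (g x)).
Proof.
move=> [f1 f2] mg; split; first exact: (measurableT_comp f1 mg).
exact: (measurableT_comp f2 mg).
Qed.

End Cmeas.

Local Notation RR := (measurableTypeR R * measurableTypeR R)%type.

Lemma cmeas_cval : cmeas (fun z : RR => cval z).
Proof. by split; [exact: measurable_fst|exact: measurable_snd]. Qed.

Lemma cgauss_second_moment :
  (\int[cgauss R]_z (sqn (cval z))%:E <= 1)%E.
Proof.
have s0 : 0 < (Num.sqrt 2)^-1 :> R by rewrite invr_gt0 sqrtr_gt0.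
have mx2 : measurable_fun setT (fun x : measurableTypeR R => (x ^+ 2)%:E).
  by apply/measurable_EFinP; exact: measurable_funX.
have -> : (\int[cgauss R]_z (sqn (cval z))%:E =
    \int[cgauss R]_z ((z.1 ^+ 2)%:E + (z.2 ^+ 2)%:E))%E.
  by apply: eq_integral => z _; rewrite -EFinD.
rewrite ge0_integralD//; first last.
- exact: (measurableT_comp mx2 measurable_snd).
- by move=> x _; rewrite lee_fin sqr_ge0.
- exact: (measurableT_comp mx2 measurable_fst).
- by move=> x _; rewrite lee_fin sqr_ge0.
have h1 := mpres_integral (mpres_fst (normal_prob 0 (Num.sqrt 2)^-1)
  (normal_prob 0 (Num.sqrt 2)^-1)) mx2.
have h2 := mpres_integral (mpres_snd (normal_prob 0 (Num.sqrt 2)^-1)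
  (normal_prob 0 (Num.sqrt 2)^-1)) mx2.
have -> : (1 = ((Num.sqrt 2)^-1 ^+ 2)%:E + ((Num.sqrt 2)^-1 ^+ 2)%:E :> \bar R)%E.
  by rewrite -EFinD exprVn sqr_sqrtr//; congr EFin; field.
apply: leeD.
  rewrite -[leLHS]h1; first exact: normal_second_moment.
  by move=> x; rewrite lee_fin sqr_ge0.
rewrite -[leLHS]h2; first exact: normal_second_moment.
by move=> x; rewrite lee_fin sqr_ge0.
Qed.

End ComplexGaussian.

(** * Second moment of the permanent of a Gaussian matrix *)

Section PermanentMoment.
Context (R : realType).
Local Notation C := R[i].
Local Notation cval z := (z.1 +i* z.2).
Local Notation RR := (measurableTypeR R * measurableTypeR R)%type.

Lemma sqn_parallelogram (z a c : C) :
  sqn (z * a + c) + sqn (z * (- a) + c) = 2 * sqn a * sqn z + 2 * sqn c.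
Proof. by case: z a c => [z1 z2] [a1 a2] [c1 c2]; rewrite /sqn /=; ring. Qed.

(** The law is invariant under [z -> - z], so twice the integral is that of the sum over [z] and
    [- z], where the parallelogram identity cancels the cross term. All integrands stay nonnegative,
    hence no integrability conditions arise. *)
Lemma cgauss_affine (a c : C) :
  (\int[cgauss R]_z (sqn (cval z * a + c))%:E <= (sqn a + sqn c)%:E)%E.
Proof.
pose f (z : RR) := (sqn (cval z * a + c))%:E.
have mza b : measurable_fun setT (fun z : RR => (sqn (cval z * b + c))%:E).
  apply: measurable_sqnE; apply: cmeasD; last exact: cmeas_cst.
  by apply: cmeasM; [exact: cmeas_cval|exact: cmeas_cst].
have f0 z : (0 <= f z)%E by rewrite lee_fin sqn_ge0.
have mN := mpres_comp (mpres_conj_re R) (mpres_conj_im R).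
have I0 : (0 <= \int[cgauss R]_z f z)%E by exact: integral_ge0.
have IE : (\int[cgauss R]_z f z =
    \int[cgauss R]_z (sqn (cval z * (- a) + c))%:E)%E.
  rewrite (mpres_integral mN) //; last exact: mza.
  apply: eq_integral => z _; congr (sqn (_ + c))%:E.
  by rewrite mulrN -mulNr; congr (_ * _); case: z.
have mz2 : measurable_fun setT (fun z : RR => (sqn (cval z))%:E).
  by apply: measurable_sqnE; exact: cmeas_cval.
have I2 : (\int[cgauss R]_z f z + \int[cgauss R]_z f z <= (2 * (sqn a + sqn c))%:E)%E.
  rewrite {2}IE.
  have <- : (\int[cgauss R]_z (f z + (sqn (cval z * (- a) + c))%:E) =
    \int[cgauss R]_z f z + \int[cgauss R]_z (sqn (cval z * (- a) + c))%:E)%E.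
    rewrite ge0_integralD//.
    - exact: (mza a).
    - by move=> z _; rewrite lee_fin sqn_ge0.
  have -> : (\int[cgauss R]_z (f z + (sqn (cval z * (- a) + c))%:E) =
      \int[cgauss R]_z ((2 * sqn a)%:E * (sqn (cval z))%:E + (2 * sqn c)%:E))%E.
    apply: eq_integral => z _; rewrite /f -EFinM -!EFinD; congr EFin.
    exact: sqn_parallelogram.
  rewrite ge0_integralD//; first last.
  - by move=> z _; rewrite lee_fin mulr_ge0 ?sqn_ge0.
  - exact: measurable_funeM.
  - by move=> z _; rewrite mule_ge0 ?lee_fin ?mulr_ge0 ?sqn_ge0.
  rewrite ge0_integralZl//; last 2 first.
  - by move=> z _; rewrite lee_fin sqn_ge0.
  - by rewrite lee_fin mulr_ge0 ?sqn_ge0.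
  rewrite integral_cst// [X in (_ + _ * X)%E](probability_setT (cgauss R)) mule1.
  rewrite (mulrDr _ (sqn a)) EFinD leeD2r// -[leRHS]mule1 lee_wpmul2l ?lee_fin ?mulr_ge0 ?sqn_ge0//.
  exact: cgauss_second_moment.
case: (\int[_]_z f z)%E I0 I2 => [r| |]//= _.
by rewrite -EFinD !lee_fin; lra.
Qed.

(** The Laplace expansion along a row, as a linear form in that row with coefficients [A], later the
    permanents of the minors. *)
Definition row_form n (z : n.-tuple (R * R)) (A : 'I_n -> C) : C :=
  \sum_(j < n) cval (tnth z j) * A j.

Lemma cmeas_row_form d (T : measurableType d) n (z : T -> n.-tuple RR) (A : 'I_n -> T -> C) :
  measurable_fun setT z -> (forall j, cmeas (A j)) ->
  cmeas (fun x => row_form (z x) (fun j => A j x)).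
Proof.
move=> mz mA; apply: cmeas_sum => j; apply: cmeasM => //.
apply: (cmeas_comp (f := fun z : RR => cval z) (g := fun x => tnth (z x) j)).
  exact: cmeas_cval.
exact: (measurableT_comp (measurable_tnth j) mz).
Qed.

(** Tonelli isolates the first entry; for fixed other entries their contribution is a constant, and
    [cgauss_affine] splits off [sqn (A ord0)]. *)
Lemma row_second_moment n (A : 'I_n -> C) (c : C) :
  (\int[iid (cgauss R) n]_z (sqn (row_form z A + c))%:E <=
    (\sum_(j < n) sqn (A j) + sqn c)%:E)%E.
Proof.
elim: n A c => [|n IHn] A c.
  under eq_integral do rewrite /row_form big_ord0 add0r.
  by rewrite integral_cst// big_ord0 add0r [X in (_ * X)%E]probability_setT mule1.
have mf m (B : 'I_m -> C) c' : measurable_fun setT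
    (fun z : m.-tuple RR => (sqn (row_form z B + c'))%:E).
  apply: measurable_sqnE; apply: cmeasD; last exact: cmeas_cst.
  by apply: (@cmeas_row_form _ _ m id (fun j _ => B j)) => // j; exact: cmeas_cst.
rewrite (mpres_integral (mpres_tcons (cgauss R) n)); last 2 first.
- exact: mf.
- by move=> z; rewrite lee_fin sqn_ge0.
have mg : measurable_fun setT (fun x : RR * n.-tuple RR => (sqn (row_form (tcons x) A + c))%:E).
  exact: (measurableT_comp (mf _ _ _) (@measurable_tcons _ _ _)).
rewrite fubini_tonelli2//=; last by move=> z; rewrite lee_fin sqn_ge0.
pose A' j := A (lift ord0 j).
apply: (@le_trans _ _ (\int[iid (cgauss R) n]_z
   ((sqn (A ord0))%:E + (sqn (row_form z A' + c))%:E))%E).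
  apply: ge0_le_integral => //.
  - by move=> z _; apply: integral_ge0 => y _; rewrite lee_fin sqn_ge0.
  - by apply: measurable_fun_fubini_tonelli_G => // z; rewrite lee_fin sqn_ge0.
  - by apply: emeasurable_funD => //; exact: mf.
  move=> z _; rewrite -EFinD; apply: le_trans (cgauss_affine _ _).
  rewrite le_eqVlt; apply/orP; left; apply/eqP; apply: eq_integral => x _.
  congr (sqn _)%:E; rewrite /row_form big_ord_recl addrA; congr (_ * _ + _ + _).
  by apply: eq_bigr => j _; rewrite tnthS.
rewrite ge0_integralD//; first last.
- exact: mf.
- by move=> z _; rewrite lee_fin sqn_ge0.
- by move=> z _; rewrite lee_fin sqn_ge0.
rewrite integral_cst// [X in (_ * X + _)%E]probability_setT mule1.
by rewrite big_ord_recl -(addrA (sqn (A ord0))) (EFinD (sqn (A ord0))) leeD2l// IHn.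
Qed.

(** Recursive along [tcons], so that preservation of the product law follows by the same
    recursion. *)
Fixpoint tdel T n : 'I_n.+1 -> n.+1.-tuple T -> n.-tuple T :=
  match n with
  | 0 => fun _ _ => [tuple]
  | m.+1 => fun j t => if unlift ord0 j is Some j'
                       then tcons (thead t, tdel j' [tuple of behead t])
                       else [tuple of behead t]
  end.

Lemma tnth_tdel T n (j : 'I_n.+1) (t : n.+1.-tuple T) (k : 'I_n) :
  tnth (tdel j t) k = tnth t (lift j k).
Proof.
elim: n j t k => [|n IHn] j t k; first by case: k.
have tnth_beheadS (i : 'I_n.+1) : tnth [tuple of behead t] i = tnth t (lift ord0 i).
  by case/tupleP: t => x t; rewrite tnthS; congr tnth; apply/val_inj.
rewrite /=; case: unliftP => [j'|] -> //.
case: (unliftP ord0 k) => [k'|] ->.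
  rewrite tnthS IHn tnth_beheadS; congr tnth; apply/val_inj => /=.
  by rewrite /bump /=; lia.
by rewrite [LHS](_ : _ = tnth t ord0)//; congr tnth; apply/val_inj.
Qed.

Lemma mpres_tdel d (T : measurableType d) (P : probability T R) n (j : 'I_n.+1) :
  mpres (iid P n.+1) (iid P n) (tdel j).
Proof.
elim: n j => [|n IHn] j.
  split; first exact: measurable_cst.
  move=> A mA; rewrite [RHS]/= /dirac indicE.
  have [A0|A0] := boolP (([tuple] : 0.-tuple T) \in A).
    rewrite [X in _ X = _](_ : _ = setT) ?probability_setT//.
    by apply/seteqP; split => // x _; move: A0; rewrite inE.
  rewrite [X in _ X = _](_ : _ = set0) ?measure0//.
  by apply/seteqP; split => // x; move: A0; rewrite notin_setE.
rewrite /=; case: unlift => [j'|]; last exact: mpres_behead.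
apply: mpres_comp (mpres_tcons _ _) _.
exact: mpres_comp (mpres_prod (mpres_id _) (IHn j')) (mpres_tuncons _ _).
Qed.

Lemma cmeas_mx_of_tuples n i j :
  cmeas (fun t : n.-tuple (n.-tuple RR) => mx_of_tuples t i j).
Proof.
under eq_fun do rewrite mxE.
apply: (cmeas_comp (f := fun z : RR => cval z)
  (g := fun t : n.-tuple (n.-tuple RR) => tnth (tnth t i) j)).
  exact: cmeas_cval.
exact: (measurableT_comp (measurable_tnth j) (measurable_tnth i)).
Qed.

(** For fixed lower rows, integrating over the first row leaves the sum of the squared permanents of
    the minors. Each minor is again Gaussian, and [n + 1] bounds [n!] add up to [(n + 1)!]. *)
Lemma per_second_moment n :
  (\int[iid (iid (cgauss R) n) n]_t (sqn (per (mx_of_tuples t)))%:E <=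
   (n`!%:R)%:E)%E.
Proof.
elim: n => [|n IHn].
  under eq_integral do rewrite per0.
  by rewrite integral_cst// [X in (_ * X)%E]probability_setT mule1 lee_fin
    /sqn/= expr1n expr0n addr0.
have mper m : measurable_fun setT (fun t : m.-tuple (m.-tuple RR) =>
    (sqn (per (mx_of_tuples t)))%:E).
  by apply: measurable_sqnE; apply: cmeas_per => i j; exact: cmeas_mx_of_tuples.
pose M (r : n.-tuple (n.+1.-tuple RR)) j := mx_of_tuples [tuple of map (tdel j) r].
have mmin j : mpres (iid (iid (cgauss R) n.+1) n) (iid (iid (cgauss R) n) n)
    (fun r : n.-tuple (n.+1.-tuple RR) => [tuple of map (tdel j) r]).
  by apply: mpres_map; exact: mpres_tdel.
have mM j : cmeas (fun r : n.-tuple (n.+1.-tuple RR) => per (M r j)).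
  apply: cmeas_per => i k.
  by apply: (cmeas_comp (cmeas_mx_of_tuples i k)); case: (mmin j).
rewrite (mpres_integral (mpres_tcons (iid (cgauss R) n.+1) n)); last 2 first.
- exact: mper.
- by move=> z; rewrite lee_fin sqn_ge0.
have perE x : per (mx_of_tuples (tcons x)) = row_form x.1 (fun j => per (M x.2 j)) + 0.
  rewrite addr0 per_laplace; apply: eq_bigr => j _; rewrite mxE; congr (_ * per _).
  by apply/matrixP => a b; rewrite !mxE tnth_map tnth_tdel tnthS.
have mg : measurable_fun setT (fun x : n.+1.-tuple RR * n.-tuple (n.+1.-tuple RR) =>
    (sqn (per (mx_of_tuples (tcons x))))%:E).
  exact: (measurableT_comp (mper _) (@measurable_tcons _ _ _)).
rewrite fubini_tonelli2//=; last by move=> z; rewrite lee_fin sqn_ge0.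
apply: (@le_trans _ _ (\int[iid (iid (cgauss R) n.+1) n]_r
  \sum_(j < n.+1) (sqn (per (M r j)))%:E)%E).
  apply: ge0_le_integral => //.
  - by move=> z _; apply: integral_ge0 => y _; rewrite lee_fin sqn_ge0.
  - by apply: measurable_fun_fubini_tonelli_G => // z; rewrite lee_fin sqn_ge0.
  - by apply: emeasurable_sum => j; exact: measurable_sqnE.
  move=> z _; rewrite sumEFin /fubini_G; under eq_integral do rewrite perE /=.
  apply: le_trans (row_second_moment (fun j => per (M z j)) 0) _.
  by rewrite lee_fin [sqn 0]/sqn/= expr0n addr0 addr0.
rewrite ge0_integral_sum//; last 2 first.
- by move=> j; exact: measurable_sqnE.
- by move=> j z _; rewrite lee_fin sqn_ge0.
apply: (@le_trans _ _ (\sum_(j < n.+1) (n`!%:R)%:E)%E); last first.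
  by rewrite sumEFin lee_fin sumr_const card_ord factS natrM mulr_natl.
apply: lee_sum => j _; apply: le_trans IHn.
rewrite (mpres_integral (mmin j)) //; first exact: mper.
by move=> z; rewrite lee_fin sqn_ge0.
Qed.

End PermanentMoment.

(** * Events on Gaussian matrices *)

Section MatrixEvents.
Context (R : realType).
Local Notation C := R[i].
Local Notation cval z := (z.1 +i* z.2).
Local Notation RR := (measurableTypeR R * measurableTypeR R)%type.
Local Notation tmx n := (n.-tuple (n.-tuple RR)).

Definition mevent n (E : set 'M[C]_n) : Prop :=
  measurable (@mx_of_tuples R n @^-1` E : set (tmx n)).

(** [e] bounds the probability of failure. Measurability is part of the notion because intersections
    are treated through complements. *)
Definition likely n (e : R) (E : set 'M[C]_n) : Prop :=
  mevent E /\ ((1 - e)%:E <= PrG E)%E.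

Lemma meventI n (E F : set 'M[C]_n) : mevent E -> mevent F -> mevent (E `&` F).
Proof. by move=> mE mF; rewrite /mevent preimage_setI; exact: measurableI. Qed.

Lemma meventC n (E : set 'M[C]_n) : mevent E -> mevent (~` E).
Proof. by move=> mE; rewrite /mevent preimage_setC; exact: measurableC. Qed.

Lemma mevent_le n (f g : 'M[C]_n -> R) :
  measurable_fun setT (fun t : tmx n => f (mx_of_tuples t)) ->
  measurable_fun setT (fun t : tmx n => g (mx_of_tuples t)) ->
  mevent [set X | f X <= g X].
Proof.
move=> mf mg; rewrite /mevent -[X in measurable X]setTI.
exact: measurable_fun_le measurableT mf mg.
Qed.

Lemma mevent_bigcup n (I : countType) (F : I -> set 'M[C]_n) :
  (forall i, mevent (F i)) -> mevent [set X | exists i, F i X].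
Proof.
move=> mF; rewrite /mevent [X in measurable X](_ : _ =
    \bigcup_i (@mx_of_tuples R n @^-1` F i)); last first.
  apply/seteqP; split => x /= [j]; first by exists j.
  by move=> _ ?; exists j.
by apply: countable_bigcupT_measurable => //; exact: countableP.
Qed.

Lemma mevent_forall n (I : finType) (F : I -> set 'M[C]_n) :
  (forall i, mevent (F i)) -> mevent [set X | forall i, F i X].
Proof.
move=> mF; rewrite /mevent [X in measurable X](_ : _ =
    \bigcap_i (@mx_of_tuples R n @^-1` F i)); last first.
  by apply/seteqP; split => x /=; [move=> h i _; exact: h|move=> h i; exact: h].
by apply: fin_bigcap_measurable => // i _; exact: mF.
Qed.

Lemma likely_mono n e (E F : set 'M[C]_n) :
  likely e E -> mevent F -> E `<=` F -> likely e F.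
Proof.
move=> [mE PE] mF EF; split => //; apply: le_trans PE _.
by apply: le_measure; rewrite ?inE// => x /=; exact: EF.
Qed.

(** Union bound on the complements, which applies to events as dependent as those about several
    queries derived from one input. *)
Lemma likelyI n e1 e2 (E F : set 'M[C]_n) :
  likely e1 E -> likely e2 F -> likely (e1 + e2) (E `&` F).
Proof.
move=> [mE PE] [mF PF]; split; first exact: meventI.
have compl e (A : set 'M[C]_n) : mevent A -> ((1 - e)%:E <= PrG A)%E =
    (PrG (~` A) <= e%:E)%E.
  move=> mA; have -> : (PrG (~` A) = 1 - PrG A)%E.
    by rewrite /PrG preimage_setC probability_setC.
  have [r ->] : exists r, PrG A = r%:E.
    exists (fine (PrG A)); rewrite fineK//.
    exact: (fin_num_measure (iid (iid (cgauss R) n) n) _ mA).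
  by rewrite -EFinB !lee_fin; apply/idP/idP; lra.
move: PE PF; rewrite !compl//; last exact: meventI.
move=> PE PF.
rewrite setCI EFinD; apply: le_trans (leeD PE PF).
rewrite /PrG preimage_setU.
by apply: measureU2; exact: meventC.
Qed.

Lemma likely_weaken n e1 e2 (E : set 'M[C]_n) :
  e1 <= e2 -> likely e1 E -> likely e2 E.
Proof.
move=> e12 [mE PE]; split => //; apply: le_trans PE.
by rewrite lee_fin lerB.
Qed.

Lemma likelyT n e : 0 <= e -> likely e [set: 'M[C]_n].
Proof.
move=> e0; split; first exact: measurableT.
rewrite /PrG preimage_setT [leRHS]probability_setT lee_fin; lra.
Qed.

Lemma likely_forall n e N (F : nat -> set 'M[C]_n) : 0 <= e ->
  (forall i, (i < N)%N -> likely e (F i)) ->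
  likely (N%:R * e) [set X | forall i, (i < N)%N -> F i X].
Proof.
move=> e0; elim: N => [|N IHN] lF.
  by rewrite [X in likely _ X](_ : _ = setT) ?mul0r; [exact: likelyT|apply/seteqP].
rewrite [X in likely _ X](_ : _ = [set X | forall i, (i < N)%N -> F i X] `&` F N).
  rewrite -natr1 mulrDl mul1r; apply: likelyI; last exact: lF.
  by apply: IHN => i iN; apply: lF; exact: ltnW.
apply/seteqP; split => X /=.
  by move=> h; split => [i iN|]; apply: h => //; exact: ltnW.
by move=> [h1 h2] i; rewrite ltnS leq_eqVlt => /orP[/eqP ->|/h1].
Qed.

(** Expresses that [G X] is Gaussian when [X] is, so that a likely event, such as accuracy of the
    oracle, can be pulled back along [G]. The witness acts on tuples, where the law is defined. *)
Definition mtrans n k (G : 'M[C]_n -> 'M[C]_k) : Prop :=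
  exists2 g : tmx n -> tmx k,
    mpres (iid (iid (cgauss R) n) n) (iid (iid (cgauss R) k) k) g &
    forall t, mx_of_tuples (g t) = G (mx_of_tuples t).

Lemma mtrans_id n : mtrans (@id 'M[C]_n).
Proof. by exists id => //; exact: mpres_id. Qed.

Lemma mtrans_comp n k m (G : 'M[C]_k -> 'M[C]_m) (H : 'M[C]_n -> 'M[C]_k) :
  mtrans G -> mtrans H -> mtrans (G \o H).
Proof.
move=> [g mg gE] [h mh hE]; exists (g \o h); first exact: mpres_comp mg mh.
by move=> t /=; rewrite gE hE.
Qed.

Lemma likely_mtrans n k (G : 'M[C]_n -> 'M[C]_k) e (E : set 'M[C]_k) :
  mtrans G -> likely e E -> likely e (G @^-1` E).
Proof.
move=> [g [mg Pg] gE] [mE PE].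
have preE : @mx_of_tuples R n @^-1` (G @^-1` E) = g @^-1` (@mx_of_tuples R k @^-1` E).
  by apply/seteqP; split => t /=; rewrite gE.
split; first by rewrite /mevent preE -[_ @^-1` _]setTI; exact: mg.
by rewrite /PrG preE Pg.
Qed.

Definition mxflip (f : R * R -> R * R) n (X : 'M[C]_n.+1) : 'M[C]_n.+1 :=
  \matrix_(i, j) if (i == ord0) && (j == ord0) then
    cval (f (complex.Re (X i j), complex.Im (X i j))) else X i j.

Lemma mtrans_mxflip f n : mpres (cgauss R) (cgauss R) f ->
  mtrans (@mxflip f n).
Proof.
move=> mf; apply: (ex_intro2 _ _ _ (mpres_map_head n (mpres_map_head n mf))).
move=> t; apply/matrixP => i j; rewrite !mxE.
case/tupleP: t => r t; case/tupleP: r => x r; rewrite !theadE.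
have tS T m (y : T) (u : m.-tuple T) k : tnth (tcons (y, u)) (lift ord0 k) = tnth u k.
  exact: tnthS.
have t0 T m (y : T) (u : m.-tuple T) : tnth (tcons (y, u)) ord0 = y by [].
have bE T m (y : T) (u : m.-tuple T) : [tuple of behead [tuple of y :: u]] = u.
  exact/val_inj.
case: (unliftP ord0 i) => [i'|] ->; rewrite ?tS ?t0; first by rewrite bE.
case: (unliftP ord0 j) => [j'|] ->; rewrite ?tS ?t0; first by rewrite bE.
by case: x.
Qed.

Lemma mtrans_minor n : mtrans (fun X : 'M[C]_n.+1 => row' ord0 (col' ord0 X)).
Proof.
apply: (ex_intro2 _ _ _ (mpres_comp (mpres_map n (mpres_tdel (cgauss R) ord0))
  (mpres_tdel (iid (cgauss R) n.+1) ord0))).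
by move=> t; apply/matrixP => i j; rewrite !mxE !tnth_map !tnth_tdel.
Qed.

(** Natural indices match the address arithmetic of the programs and spare casts between blocks of
    different sizes. *)
Definition ent n (X : 'M[C]_n) (a b : nat) : C :=
  if insub a is Some i then if insub b is Some j then X i j else 0 else 0.

Lemma entE n (X : 'M[C]_n) (i j : 'I_n) : ent X i j = X i j.
Proof. by rewrite /ent !valK. Qed.

Lemma ent_Ordinal n (X : 'M[C]_n) a b (an : (a < n)%N) (bn : (b < n)%N) :
  ent X a b = X (Ordinal an) (Ordinal bn).
Proof. exact: (entE X (Ordinal an) (Ordinal bn)). Qed.

Definition brsub n k (X : 'M[C]_n) : 'M[C]_k :=
  \matrix_(i, j) ent X (n - k + i) (n - k + j).

Lemma brsub_id n (X : 'M[C]_n) : brsub n X = X.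
Proof. by apply/matrixP => i j; rewrite mxE subnn !add0n entE. Qed.

Lemma brsubS n k (X : 'M[C]_n.+1) : (k <= n)%N ->
  brsub k X = brsub k (row' ord0 (col' ord0 X)).
Proof.
move=> kn; apply/matrixP => i j; rewrite !mxE.
have h (x : 'I_k) : (n - k + x < n)%N by case: x => x /=; lia.
have -> : (n.+1 - k + i)%N = lift ord0 (Ordinal (h i)) by rewrite /= /bump /=; lia.
have -> : (n.+1 - k + j)%N = lift ord0 (Ordinal (h j)) by rewrite /= /bump /=; lia.
by rewrite entE (ent_Ordinal _ (h i) (h j)) !mxE.
Qed.

Lemma mtrans_brsub n k : (k <= n)%N -> mtrans (@brsub n k).
Proof.
elim: n => [|n IHn].
  rewrite leqn0 => /eqP ->.
  have -> : @brsub 0 0 = id by apply/funext => X; rewrite brsub_id.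
  exact: mtrans_id.
rewrite leq_eqVlt => /orP[/eqP -> {IHn}|].
  have -> : @brsub n.+1 n.+1 = id by apply/funext => X; rewrite brsub_id.
  exact: mtrans_id.
rewrite ltnS => kn.
have -> : @brsub n.+1 k = @brsub n k \o (fun X => row' ord0 (col' ord0 X)).
  by apply/funext => X; rewrite brsubS.
by apply: mtrans_comp (mtrans_minor n); exact: IHn.
Qed.

Lemma brsub_brsub n k j (X : 'M[C]_n) : (j <= k <= n)%N ->
  brsub j (brsub k X) = brsub j X.
Proof.
move=> /andP[jk kn]; apply/matrixP => a b; rewrite !mxE.
have h (x : 'I_j) : (k - j + x < k)%N by case: x => x /=; lia.
by rewrite (ent_Ordinal _ (h a) (h b)) mxE /=; congr ent;
  case: a b => [a ?] [b ?] /=; lia.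
Qed.

Lemma brsub_minor n (X : 'M[C]_n.+1) : brsub n X = row' ord0 (col' ord0 X).
Proof. by rewrite brsubS// brsub_id. Qed.

Lemma likely_head n e (A : set RR) : measurable A -> ((1 - e)%:E <= cgauss R A)%E ->
  likely e [set X : 'M[C]_n.+1 | A (complex.Re (X ord0 ord0), complex.Im (X ord0 ord0))].
Proof.
move=> mA PA.
have [mh Ph] := mpres_comp (mpres_thead (cgauss R) n) (mpres_thead (iid (cgauss R) n.+1) n).
have E : @mx_of_tuples R n.+1 @^-1`
    [set X | A (complex.Re (X ord0 ord0), complex.Im (X ord0 ord0))] =
    ((fun t => thead t) \o (fun t => thead t)) @^-1` A.
  by apply/seteqP; split => t; rewrite /= mxE /thead; case: (tnth (tnth _ _) _).
split; last by rewrite /PrG E Ph.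
by rewrite /mevent E -[_ @^-1` _]setTI; exact: mh.
Qed.

End MatrixEvents.

(** * Likely bounds on permanents and entries; measurability of oracle events *)

Section LikelyEvents.
Context (R : realType).
Local Notation C := R[i].
Local Notation cval z := (z.1 +i* z.2).
Local Notation RR := (measurableTypeR R * measurableTypeR R)%type.
Local Notation tmx n := (n.-tuple (n.-tuple RR)).

Lemma markov_le d (T : measurableType d) (P : probability T R) (f : T -> R) (c t : R) :
  measurable_fun setT f -> (forall x, 0 <= f x) -> 0 < c -> 0 < t ->
  (\int[P]_x (f x)%:E <= c%:E)%E ->
  ((1 - t^-1)%:E <= P [set x | (f x <= t * c)%R])%E.
Proof.
move=> mf f0 c0 t0 If.
have mA : measurable [set x | f x <= t * c].
  by rewrite -[X in measurable X]setTI; exact: measurable_fun_le.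
set B := ~` [set x | f x <= t * c].
have mB : measurable B by exact: measurableC.
have mfE : measurable_fun setT (fun x => (f x)%:E) by exact/measurable_EFinP.
have PB : ((t * c)%:E * P B <= c%:E)%E.
  apply: le_trans If; rewrite -integral_cst//.
  apply: (@le_trans _ _ (\int[P]_(x in B) (f x)%:E)%E).
    apply: ge0_le_integral => //.
    - by move=> x _; rewrite lee_fin mulr_ge0// ltW.
    - exact: measurable_funTS.
    - by move=> x; rewrite /B/= lee_fin => /negP; rewrite -ltNge => /ltW.
  by apply: ge0_subset_integral => // x _; rewrite lee_fin.
have -> : [set x | f x <= t * c] = ~` B by rewrite setCK.
rewrite probability_setC//.
have [r Er] : exists r, P B = r%:E.
  by exists (fine (P B)); rewrite fineK// fin_num_measure.
move: PB; rewrite Er -EFinM -EFinB !lee_fin => PB.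
suff : r <= t^-1 by lra.
rewrite -(ler_pM2l (mulr_gt0 t0 c0)).
by have -> : t * c * t^-1 = c by field; rewrite gt_eqF.
Qed.

Lemma measurable_sqn_per n :
  measurable_fun setT (fun X : tmx n => sqn (per (mx_of_tuples X))).
Proof.
by apply: measurable_sqn; apply: cmeas_per => i j; exact: cmeas_mx_of_tuples.
Qed.

Lemma per_upper_likely n (t : R) : 0 < t ->
  likely t^-1 [set X : 'M[C]_n | sqn (per X) <= t * n`!%:R].
Proof.
move=> t0; split; first by apply: mevent_le => //; exact: measurable_sqn_per.
have n0 : 0 < n`!%:R :> R by rewrite ltr0n fact_gt0.
have s0 (X : tmx n) : 0 <= sqn (per (mx_of_tuples X)) by exact: sqn_ge0.
exact: (markov_le (@measurable_sqn_per n) s0 n0 t0 (per_second_moment R n)).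
Qed.

(** Anti-concentration in terms of squared moduli. Positivity of [p] makes both sides of the
    original inequality nonnegative, so that it may be squared. *)
Lemma per_lower_likely (p : {poly {poly R}}) :
  (forall n (delta : R), 0 < delta -> 0 < p.[n%:R, delta^-1]) ->
  (forall n (delta : R), 0 < delta ->
      (PrG [set X : 'M[R[i]]_n |
         (`|per X| < (Num.sqrt (n`!)%:R / p.[n%:R, delta^-1])%:C)%R]
       < delta%:E)%E) ->
  forall n (delta : R), 0 < delta ->
  likely delta [set X : 'M[C]_n | n`!%:R / p.[n%:R, delta^-1] ^+ 2 <= sqn (per X)].
Proof.
move=> p0 pacc n delta d0; split.
  by apply: mevent_le => //; exact: measurable_sqn_per.
have {pacc} := pacc n delta d0.
set B := [set X | _].
have -> : [set X : 'M[C]_n | n`!%:R / p.[n%:R, delta^-1] ^+ 2 <= sqn (per X)] = ~` B.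
  apply/seteqP; split => X; rewrite /B /= normc_def ltcR.
    move=> h; apply/negP; rewrite -leNgt.
    rewrite -[leLHS]ger0_norm; last by rewrite divr_ge0 ?sqrtr_ge0// ltW// p0.
    by rewrite -sqrtr_sqr ler_wsqrtr// expr_div_n sqr_sqrtr// ler0n.
  move=> /negP; rewrite -leNgt => h.
  rewrite -(sqr_sqrtr (ler0n R n`!)) -expr_div_n.
  rewrite -[sqn _]sqr_sqrtr ?sqn_ge0// lerXn2r// ?nnegrE ?sqrtr_ge0//.
  by rewrite divr_ge0 ?sqrtr_ge0// ltW// p0.
have mB : mevent B.
  have -> : B = ~` [set X | Num.sqrt n`!%:R / p.[n%:R, delta^-1] <= Num.sqrt (sqn (per X))].
    apply/seteqP; split => X; rewrite /B /= normc_def ltcR.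
      by rewrite ltNge => /negP.
    by move=> /negP; rewrite -ltNge.
  apply: meventC; apply: mevent_le => //.
  apply: (measurableT_comp _ (@measurable_sqn_per n)).
  by apply: continuous_measurable_fun; exact: sqrt_continuous.
rewrite /PrG preimage_setC => PB; rewrite probability_setC//.
by rewrite EFinB leeB// ltW.
Qed.

(** The peak is [1 / sqrt (2 pi s^2)], which for [s^2 = 1/2] equals [1 / sqrt pi]. *)
Lemma normal_peak_le1 : normal_peak ((Num.sqrt 2)^-1 : R) <= 1.
Proof.
rewrite /normal_peak invf_le1 ?sqrtr_gt0; last first.
  by rewrite mulrn_wgt0// mulr_gt0 ?pi_gt0// exprn_even_gt0//= invr_eq0 gt_eqF// sqrtr_gt0.
rewrite exprVn sqr_sqrtr// -mulrnAl -mulr_natr mulVf// mul1r.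
by rewrite -sqrtr1 ler_wsqrtr// (le_trans _ (pi_ge2 R))// ler1n.
Qed.

Lemma normal_avoid (A : set (measurableTypeR R)) (e : R) : measurable A ->
  (normal_prob 0%R (Num.sqrt 2)^-1 A <= e%:E)%E ->
  ((1 - e)%:E <= cgauss R (fst @^-1` (~` A)))%E /\
  ((1 - e)%:E <= cgauss R (snd @^-1` (~` A)))%E.
Proof.
move=> mA PA; have mCA : measurable (~` A) by exact: measurableC.
rewrite /cgauss (mpres_fst _ _).2// (mpres_snd _ _).2//.
rewrite probability_setC//.
by split; rewrite EFinB leeB.
Qed.

Lemma likely_coord n (A : set (measurableTypeR R)) (e : R) : measurable A ->
  (normal_prob 0%R (Num.sqrt 2)^-1 A <= e%:E)%E ->
  likely (e + e) [set X : 'M[C]_n.+1 |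
    ~ A (complex.Re (X ord0 ord0)) /\ ~ A (complex.Im (X ord0 ord0))].
Proof.
move=> mA PA; have [P1 P2] := normal_avoid mA PA.
have mCA : measurable (~` A) by exact: measurableC.
have := likelyI (likely_head n _ P1) (likely_head n _ P2); apply.
  by rewrite -[_ @^-1` _]setTI; exact: measurable_fst.
by rewrite -[_ @^-1` _]setTI; exact: measurable_snd.
Qed.

Definition noninteger (x : R) : Prop := forall m : int, x <> m%:~R.

(** The lower bounds serve the divisions by the parts of the corner entry, non-integrality makes
    rounding compatible with a change of sign, and the upper bound controls [|Z / Y|] by the modulus
    of the ratio of permanents. *)
Definition nice_entry (b : nat) (L : R) (z : C) : Prop :=
  [/\ L^-1 <= `|complex.Re z| /\ L^-1 <= `|complex.Im z|,
      noninteger (2 ^+ b * complex.Re z) /\ noninteger (2 ^+ b * complex.Im z) &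
      sqn z <= L].

(** The 5 is made of [2 / L] for each part being too small, 0 for the countably many dyadic values,
    and [1 / L] from Markov's inequality for the squared modulus. *)
Lemma nice_entry_likely n b (L : R) : 0 < L ->
  likely (5 * L^-1) [set X : 'M[C]_n.+1 | nice_entry b L (X ord0 ord0)].
Proof.
move=> L0; have s0 := sqrtV2_neq0 R.
have V0 : 0 < L^-1 by rewrite invr_gt0.
pose A := [set x : measurableTypeR R | `|x| < L^-1].
have mA : measurable A.
  have -> : A = [set` `]- L^-1, L^-1[%R].
    by rewrite /A; apply/seteqP; split => x /=; rewrite in_itv/= ltr_norml.
  exact: measurable_itv.
have PA : (normal_prob 0%R (Num.sqrt 2)^-1 A <= (2 * L^-1)%:E)%E.
  apply: le_trans (normal_small_ball _ _ _) _ => //; first exact: ltW.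
  rewrite lee_fin -[leRHS]mul1r ler_wpM2r ?normal_peak_le1//.
  by rewrite mulr_ge0// ltW.
pose B := range (fun m : int => m%:~R / 2 ^+ b : R).
have cB : countable B by apply: sub_countable (card_image_le _ _) _; exact: countableP.
have mB : measurable (B : set (measurableTypeR R)).
  exact: (@countable_measurable _ (measurableTypeR R)).
have PB : (normal_prob 0%R (Num.sqrt 2)^-1 B <= 0%:E)%E.
  by rewrite normal_countable.
have lA := likely_coord n mA PA; have lB := likely_coord n mB PB.
have mC : measurable_fun setT (fun z : RR => sqn (cval z)).
  by apply: measurable_sqn; exact: cmeas_cval.
have lC : likely L^-1 [set X : 'M[C]_n.+1 | sqn (X ord0 ord0) <= L].
  have -> : [set X : 'M[C]_n.+1 | sqn (X ord0 ord0) <= L] =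
    [set X | [set z : RR | sqn (cval z) <= L * 1]
      (complex.Re (X ord0 ord0), complex.Im (X ord0 ord0))].
    by apply/seteqP; split => X /=; rewrite mulr1; case: (X _ _).
  apply: likely_head.
    by rewrite -[X in measurable X]setTI; exact: measurable_fun_le.
  apply: markov_le => //; first by move=> z; exact: sqn_ge0.
  exact: cgauss_second_moment.
have := likelyI (likelyI lA lB) lC.
have -> : (2 * L^-1 + 2 * L^-1 + (0 + 0) + L^-1) = 5 * L^-1 by ring.
have nB (x : R) : ~ B x -> noninteger (2 ^+ b * x).
  move=> nBx m xm; apply: nBx; exists m => //.
  by rewrite -xm mulrC mulrA mulVf ?mul1r// expf_neq0.
have nA (x : R) : ~ A x -> L^-1 <= `|x| by move=> /negP; rewrite -leNgt.
have nB' (x : R) : noninteger (2 ^+ b * x) -> ~ B x.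
  by move=> h [m _ mE]; apply: (h m); rewrite -mE mulrC divfK// expf_neq0.
have nA' (x : R) : L^-1 <= `|x| -> ~ A x by rewrite leNgt => /negP.
congr likely; apply/seteqP; split => X /=.
  by move=> [[[h1 h2] [h3 h4]] h5]; split => //; split; auto.
by move=> [[h1 h2] [h3 h4] h5]; split => //; split; split; auto.
Qed.

Lemma real_complex_normE (x : R) : `|x%:C| = `|x|%:C.
Proof. by rewrite normc_def /= expr0n addr0 sqrtr_sqr. Qed.

Lemma GPE2_addP n (X : 'M[C]_n) s w : GPE2_add X s w <->
  `|(w`_0)%:~R / (w`_1)%:~R - sqn (per X)| <= s%:R^-1 * n`!%:R :> R.
Proof.
rewrite /GPE2_add sqr_normcE.
have -> : (w`_0)%:~R / (w`_1)%:~R - (sqn (per X))%:C =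
    ((w`_0)%:~R / (w`_1)%:~R - sqn (per X))%:C :> C.
  by rewrite rmorphB fmorph_div !rmorph_int.
have -> : s%:R^-1 * (n`!)%:R = (s%:R^-1 * (n`!)%:R)%:C :> C.
  by rewrite rmorphM fmorphV !rmorph_nat.
by rewrite real_complex_normE lecR.
Qed.

Lemma GPE_mulP n (X : 'M[C]_n) s w : GPE_mul X s w <->
  sqn (((w`_0)%:~R +i* (w`_1)%:~R) / (w`_2)%:~R - per X) <=
    s%:R^-1 ^+ 2 * sqn (per X).
Proof.
rewrite /GPE_mul.
have n0 (z : C) : 0 <= `|z| by [].
have s0 : 0 <= s%:R^-1 * `|per X| :> C by rewrite mulr_ge0// invr_ge0 ler0n.
rewrite -(@ler_pXn2r _ 2)// ?nnegrE//.
have -> : (s%:R^-1 * `|per X|) ^+ 2 = (s%:R^-1 ^+ 2 * sqn (per X))%:C.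
  by rewrite exprMn sqr_normcE rmorphM rmorphXn/= fmorphV rmorph_nat.
by rewrite sqr_normcE lecR.
Qed.

Lemma mevent_GPE2_add n s w : mevent [set X : 'M[C]_n | GPE2_add X s w].
Proof.
rewrite [X in mevent X](_ : _ = [set X : 'M[C]_n |
    `|(w`_0)%:~R / (w`_1)%:~R - sqn (per X)| <= s%:R^-1 * n`!%:R]).
  apply: mevent_le => //; apply: (measurableT_comp (@normr_measurable R setT)).
  by apply: measurable_funB => //; exact: measurable_sqn_per.
by apply/seteqP; split => X /= /GPE2_addP.
Qed.

Lemma mevent_GPE_mul n s w : mevent [set X : 'M[C]_n | GPE_mul X s w].
Proof.
rewrite [X in mevent X](_ : _ = [set X : 'M[C]_n |
    sqn (((w`_0)%:~R +i* (w`_1)%:~R) / (w`_2)%:~R - per X) <=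
    s%:R^-1 ^+ 2 * sqn (per X)]).
  have mper : cmeas (fun t : tmx n => per (mx_of_tuples t)).
    by apply: cmeas_per => i j; exact: cmeas_mx_of_tuples.
  apply: mevent_le.
    apply: measurable_sqn; under eq_fun do rewrite addrC -mulN1r.
    by apply: cmeasD; [apply: cmeasM => //|]; exact: cmeas_cst.
  by apply: measurable_funM => //; exact: measurable_sqn.
by apply/seteqP; split => X /= /GPE_mulP.
Qed.

Definition round_entry (b : nat) (z : C) : int * int :=
  (Num.floor (2 ^+ b * complex.Re z), Num.floor (2 ^+ b * complex.Im z)).

(** Rounded matrices form a countable set, so the event is a countable union of measurable pieces,
    one for each value [G]. No regularity of the oracle is involved. *)
Lemma mevent_round n b (E : 'M[int * int]_n -> set 'M[C]_n) :
  (forall G, mevent (E G)) ->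
  mevent [set X : 'M[C]_n | E (\matrix_(i, j) round_entry b (X i j)) X].
Proof.
move=> mE.
rewrite [X in mevent X](_ : _ = [set X | exists G, (E G `&`
    [set X : 'M[C]_n | forall ij : 'I_n * 'I_n, round_entry b (X ij.1 ij.2) = G ij.1 ij.2]) X]).
  apply: mevent_bigcup => G; apply: meventI => //.
  apply: mevent_forall => -[i j] /=.
  have mfl (f : 'M[C]_n -> R) (z : int) :
      measurable_fun setT (fun t : tmx n => f (mx_of_tuples t)) ->
      mevent [set X | Num.floor (2 ^+ b * f X) = z].
    move=> mf.
    rewrite [X in mevent X](_ : _ = [set X | z%:~R <= 2 ^+ b * f X] `&`
        ~` [set X | (z + 1)%:~R <= 2 ^+ b * f X]).
      by apply: meventI; [|apply: meventC]; apply: mevent_le => //; exact: measurable_funM.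
    apply/seteqP; split => X /=.
      move=> /eqP; rewrite floor_eq => /andP[h1 h2]; split => //.
      by apply/negP; rewrite -ltNge.
    by move=> [h1 /negP]; rewrite -ltNge => h2; apply/eqP; rewrite floor_eq h1.
  have [m1 m2] := @cmeas_mx_of_tuples R n i j.
  rewrite [X in mevent X](_ : _ =
     [set X : 'M[C]_n | Num.floor (2 ^+ b * complex.Re (X i j)) = (G i j).1] `&`
     [set X : 'M[C]_n | Num.floor (2 ^+ b * complex.Im (X i j)) = (G i j).2]).
    by apply: meventI; apply: mfl.
  by apply/seteqP; split => X; rewrite /round_entry /=; case: (G i j) => [g1 g2] /= [-> ->].
apply/seteqP; split => X /=.
  by move=> h; eexists; split; [exact: h|move=> [i j]; rewrite mxE].
move=> [G [EG h]]; rewrite [X in E X](_ : _ = G)//.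
by apply/matrixP => i j; rewrite mxE (h (i, j)).
Qed.

Lemma mevent_encode n s t b (E : seq int -> set 'M[C]_n) :
  (forall w, mevent (E w)) -> mevent [set X | E (encode s t b X) X].
Proof.
move=> mE; pose enc (G : 'M[int * int]_n) := [:: n%:Z; s%:Z; t%:Z; b%:Z] ++
  nseq (s + t + b) (0 : int) ++
  flatten [seq [:: (G i j).1; (G i j).2] | i <- enum 'I_n, j <- enum 'I_n].
have encE (X : 'M[C]_n) : enc (\matrix_(i, j) round_entry b (X i j)) = encode s t b X.
  by congr (_ ++ _ ++ flatten _); apply: eq_allpairs => i j; rewrite !mxE.
have := @mevent_round n b (fun G => E (enc G)) (fun G => mE _).
by congr mevent; apply/seteqP; split => X /=; rewrite encE.
Qed.

End LikelyEvents.

(** * Error analysis of the ratios *)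

Section ErrorAnalysis.
Context (R : realType).
Local Notation C := R[i].

Definition modc (z : C) : R := Num.sqrt (sqn z).

Lemma modc_ge0 z : 0 <= modc z. Proof. exact: sqrtr_ge0. Qed.

Lemma sqr_modc z : modc z ^+ 2 = sqn z.
Proof. by rewrite sqr_sqrtr ?sqn_ge0. Qed.

Lemma modcE z : `|z| = (modc z)%:C.
Proof. exact: normc_def. Qed.

Lemma modcM (y z : C) : modc (y * z) = modc y * modc z.
Proof. by rewrite /modc sqnM sqrtrM ?sqn_ge0. Qed.

Lemma modcD (y z : C) : modc (y + z) <= modc y + modc z.
Proof. by rewrite -lecR rmorphD/= -!modcE ler_normD. Qed.

Lemma modcN (z : C) : modc (- z) = modc z.
Proof. by apply: complexI; rewrite -!modcE normrN. Qed.

Lemma modc_le_sqn (y z : C) c : 0 <= c ->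
  (modc y <= c * modc z) = (sqn y <= c ^+ 2 * sqn z).
Proof.
move=> c0; rewrite -!sqr_modc -exprMn ler_pXn2r// nnegrE ?modc_ge0//.
by rewrite mulr_ge0// modc_ge0.
Qed.

Lemma Re_le_modc (z : C) : `|complex.Re z| <= modc z.
Proof. by rewrite -sqrtr_sqr ler_wsqrtr// lerDl sqr_ge0. Qed.

Lemma Im_le_modc (z : C) : `|complex.Im z| <= modc z.
Proof. by rewrite -sqrtr_sqr ler_wsqrtr// lerDr sqr_ge0. Qed.

Lemma modc_le_ReIm (z : C) : modc z <= `|complex.Re z| + `|complex.Im z|.
Proof.
rewrite -[leRHS]ger0_norm ?addr_ge0// -sqrtr_sqr ler_wsqrtr// /sqn.
rewrite -(real_normK (num_real (complex.Re z))) -(real_normK (num_real (complex.Im z))).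
have := normr_ge0 (complex.Re z); have := normr_ge0 (complex.Im z); nra.
Qed.

Lemma modc_gt0 (z : C) : (0 < modc z) = (z != 0).
Proof. by rewrite -normr_gt0 modcE ltcR. Qed.

(** From [(1 - e)|p| <= |z| <= (1 + e)|p|]; the 3 absorbs [2 e + e^2]. *)
Lemma sqn_approx (z p : C) (e : R) : 0 <= e <= 1 ->
  sqn (z - p) <= e ^+ 2 * sqn p -> `|sqn z - sqn p| <= 3 * e * sqn p.
Proof.
move=> /andP[e0 e1]; rewrite -modc_le_sqn// -!sqr_modc => h.
have h1 : modc z <= modc p + e * modc p.
  by have := modcD (z - p) p; rewrite subrK; lra.
have h2 : modc p - e * modc p <= modc z.
  have := modcD (p - z) z; rewrite subrK -opprB modcN; lra.
have p0 := modc_ge0 p; have z0 := modc_ge0 z.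
have ep : 0 <= e * modc p by rewrite mulr_ge0.
have ep1 : e * modc p <= modc p by rewrite ler_piMl.
have ee : (e * modc p) ^+ 2 <= e * modc p ^+ 2.
  by rewrite exprMn ler_wpM2r ?sqr_ge0// expr2 ler_piMl.
have u : modc z ^+ 2 <= (modc p + e * modc p) ^+ 2.
  by rewrite lerXn2r// nnegrE addr_ge0.
have l : (modc p - e * modc p) ^+ 2 <= modc z ^+ 2.
  by rewrite lerXn2r// nnegrE subr_ge0.
by rewrite ler_norml; apply/andP; split; nra.
Qed.

(** Here [r] is a part of [Z / Y], [y = |Y|^2] with estimate [N0], [a] is a part of the corner entry
    with rounding [a'], and [S], [S1] are squared moduli with estimates [N], [N1]. [K] is the
    factorial of the previous level and [k * K] that of the current one. The numerator of the error
    splits into the errors of [a], of [y] and of the difference. *)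
Lemma difference_quotient_error (a a' r y N N1 N0 S S1 d e K k L : R) :
  S - S1 = 4 * a * r * y ->
  `|N - S| <= e * (k * K) -> `|N1 - S1| <= e * (k * K) -> `|N0 - y| <= e * K ->
  `|a' - a| <= d -> 0 <= y -> y <= L * K -> 1 <= 2 * L * `|a'| ->
  K <= 2 * L * N0 -> 0 < K -> 0 < L -> 0 <= k -> 0 <= d -> 0 <= e ->
  `|(N - N1) / (4 * a' * N0) - r| <=
     `|r| * (4 * L ^+ 3 * d + 2 * L * e) + 2 * L ^+ 2 * e * k.
Proof.
move=> SE NS N1S N0y a'a y0 yL a'L N0L K0 L0 k0 d0 e0.
have L2 : 0 < 2 * L by lra.
have N00 : 0 < N0 by rewrite -(pmulr_rgt0 _ L2); lra.
have a'0 : 0 < `|a'| by rewrite -(pmulr_rgt0 _ L2); lra.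
have a'n : a' != 0 by rewrite -normr_gt0.
have aN : 0 < `|a'| * N0 by rewrite mulr_gt0.
have -> : (N - N1) / (4 * a' * N0) - r =
    (4 * (r * ((a - a') * y + a' * (y - N0))) + ((N - S) - (N1 - S1))) / (4 * a' * N0).
  have -> : N - N1 = (N - S) - (N1 - S1) + 4 * a * r * y by rewrite -SE; ring.
  by field; rewrite a'n gt_eqF.
rewrite normrM normfV !normrM (ger0_norm (ltW N00)) (ger0_norm (ler0n _ 4)).
rewrite ler_pdivrMr; last by rewrite !mulr_gt0.
apply: le_trans (ler_normD _ _) _.
rewrite normrM (ger0_norm (ler0n _ 4)) (normrM r).
have h1 : `|(a - a') * y + a' * (y - N0)| <= d * y + `|a'| * (e * K).
  apply: le_trans (ler_normD _ _) _; rewrite !normrM (ger0_norm y0).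
  by rewrite lerD ?ler_wpM2r ?ler_wpM2l ?normr_ge0// distrC.
have h2 : `|N - S - (N1 - S1)| <= 2 * e * (k * K).
  by apply: le_trans (ler_normB _ _) _; lra.
(* Lower bound for the denominator, the source of the powers of [L] in the result. *)
have KN : K <= 4 * L ^+ 2 * (`|a'| * N0).
  have : 1 * K <= (2 * L * `|a'|) * (2 * L * N0) by rewrite ler_pM// ltW.
  lra.
have q1 : d * y <= 4 * L ^+ 3 * d * (`|a'| * N0).
  have -> : 4 * L ^+ 3 * d * (`|a'| * N0) = d * (L * (4 * L ^+ 2 * (`|a'| * N0))) by ring.
  rewrite ler_wpM2l//; apply: le_trans yL _.
  by rewrite ler_wpM2l// ltW.
have q2 : `|a'| * (e * K) <= 2 * L * e * (`|a'| * N0).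
  have -> : 2 * L * e * (`|a'| * N0) = `|a'| * (e * (2 * L * N0)) by ring.
  by rewrite !ler_wpM2l.
have q3 : 2 * e * (k * K) <= 2 * L ^+ 2 * e * k * (4 * (`|a'| * N0)).
  have -> : 2 * L ^+ 2 * e * k * (4 * (`|a'| * N0)) =
    2 * e * (k * (4 * L ^+ 2 * (`|a'| * N0))) by ring.
  by rewrite ler_wpM2l ?mulr_ge0// ler_wpM2l.
have r0 := normr_ge0 r.
have h1r : `|r| * `|(a - a') * y + a' * (y - N0)| <=
    `|r| * (4 * L ^+ 3 * d * (`|a'| * N0) + 2 * L * e * (`|a'| * N0)).
  by rewrite ler_wpM2l//; apply: le_trans h1 _; rewrite lerD.
lra.
Qed.

(* The three queries differ in the sign of one part of the corner entry [x], so
   their squared moduli differ by the real and imaginary parts of [Z / Y]. *)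
Lemma ratio_error (a b a' b' N N1 N2 N0 d e K k L : R) (Y Z : C) :
  let P := (a +i* b) * Y + Z in
  `|N - sqn P| <= e * (k * K) ->
  `|N1 - sqn ((- a +i* b) * Y + Z)| <= e * (k * K) ->
  `|N2 - sqn ((a +i* - b) * Y + Z)| <= e * (k * K) ->
  `|N0 - sqn Y| <= e * K ->
  `|a' - a| <= d -> `|b' - b| <= d ->
  K / L <= sqn Y -> sqn Y <= L * K -> k * K / L <= sqn P ->
  L^-1 <= `|a| -> L^-1 <= `|b| -> sqn (a +i* b) <= L ->
  0 < K -> 1 <= L -> 1 <= k -> 0 <= d -> 0 <= e ->
  2 * L * d <= 1 -> 2 * L * e <= 1 ->
  modc (((a' + (N - N1) / (4 * a' * N0)) +i*
         (b' + (N - N2) / (4 * b' * N0))) * Y - P) <=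
    (18 * L ^+ 5 * d + 12 * L ^+ 5 * k * e) * modc P.
Proof.
move=> P NP NP1 NP2 N0Y a'a b'b Yl Yu Pl al bl xu K0 L1 k1 d0 e0 Ld Le.
set r := (X in modc (X * Y - P)).
have L0 : 0 < L by lra.
have Ln : L != 0 by rewrite gt_eqF.
have V0 : 0 < L^-1 by rewrite invr_gt0.
have LV : L * L^-1 = 1 by rewrite divff.
have Y0 : 0 < sqn Y by apply: lt_le_trans Yl; rewrite divr_gt0.
have mY0 : 0 < modc Y by rewrite sqrtr_gt0.
have Yn : Y != 0 by rewrite -modc_gt0.
pose w := Z / Y.
have ZE : Z = w * Y by rewrite /w divfK.
(* Rounding costs at most [d <= 1 / (2 L)], half of the lower bound [1 / L]. *)
have cl (c c' : R) : L^-1 <= `|c| -> `|c' - c| <= d -> 1 <= 2 * L * `|c'|.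
  move=> h1 h2; have h3 : L^-1 - d <= `|c'|.
    have := ler_normB c' (c' - c); rewrite opprB addrC subrK; lra.
  have : L * (L^-1 - d) <= L * `|c'| by rewrite ler_wpM2l// ltW.
  rewrite mulrBr LV; lra.
have YK : K <= L * sqn Y.
  by move: Yl; rewrite ler_pdivrMr// mulrC.
have N0K : K <= 2 * L * N0.
  have h : sqn Y - e * K <= N0 by move: N0Y; rewrite ler_norml; lra.
  have : L * (sqn Y - e * K) <= L * N0 by rewrite ler_wpM2l// ltW.
  have : 2 * L * e * K <= 1 * K by rewrite ler_wpM2r// ltW.
  lra.
have Ds1 : sqn P - sqn ((- a +i* b) * Y + Z) = 4 * a * complex.Re w * sqn Y.
  rewrite /P ZE; case: (Y) (w) => [y1 y2] [w1 w2]; rewrite /sqn /=; ring.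
have Ds2 : sqn P - sqn ((a +i* - b) * Y + Z) = 4 * b * complex.Im w * sqn Y.
  rewrite /P ZE; case: (Y) (w) => [y1 y2] [w1 w2]; rewrite /sqn /=; ring.
have k0 : 0 <= k by lra.
have g1 := difference_quotient_error Ds1 NP NP1 N0Y a'a
  (sqn_ge0 Y) Yu (cl _ _ al a'a) N0K K0 L0 k0 d0 e0.
have g2 := difference_quotient_error Ds2 NP NP2 N0Y b'b
  (sqn_ge0 Y) Yu (cl _ _ bl b'b) N0K K0 L0 k0 d0 e0.
(* The modulus of the exact ratio [x + Z / Y], against which all errors are measured. *)
pose q := modc P / modc Y.
have PE : P = (a +i* b + w) * Y by rewrite /P ZE mulrDl.
have qE : q = modc (a +i* b + w) by rewrite /q PE modcM mulfK// gt_eqF.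
have L2 : 1 <= L ^+ 2 by rewrite exprn_ege1.
have Lq : 1 <= L * q.
  rewrite /q mulrA ler_pdivlMr// mul1r modc_le_sqn; last exact: ltW.
  have : k * K <= L * sqn P by move: Pl; rewrite ler_pdivrMr// [_ * L]mulrC.
  have : K <= k * K by rewrite ler_peMl// ltW.
  move=> h1 h2; apply: le_trans Yu _.
  by rewrite expr2 -mulrA ler_pM2l//; exact: le_trans h1 h2.
have q0 : 0 <= q by rewrite qE modc_ge0.
have xL : modc (a +i* b) <= L.
  have -> : L = L * modc 1 by rewrite /modc /sqn/= expr1n expr0n addr0 sqrtr1 mulr1.
  rewrite (modc_le_sqn _ _ (ltW L0)) [sqn 1]/sqn/= expr1n expr0n addr0 mulr1.
  by apply: le_trans xu _; rewrite expr2 ler_peMr// ltW.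
(* [|w| <= q + |x| <= q + L], and [1 <= L q] turns the term [L] into [L^2 q]. *)
have wq : modc w <= 2 * L ^+ 2 * q.
  have := modcD (a +i* b + w) (- (a +i* b)); rewrite modcN -qE addrC addKr => h.
  have : L * 1 <= L * (L * q) by rewrite ler_wpM2l// ltW.
  have : 1 * q <= L ^+ 2 * q by rewrite ler_wpM2r.
  lra.
pose B := 4 * L ^+ 3 * d + 2 * L * e.
have B0 : 0 <= B by rewrite /B addr_ge0// !mulr_ge0 ?exprn_ge0// ltW.
have gw (u : R) : `|u| <= modc w -> `|u| * B + 2 * L ^+ 2 * e * k <=
    (8 * L ^+ 5 * d + 6 * L ^+ 5 * k * e) * q.
  move=> uw; have h1 : `|u| * B <= 2 * L ^+ 2 * q * B.
    by rewrite ler_wpM2r//; lra.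
  have ek : 0 <= e * k by rewrite mulr_ge0.
  have h2 : 2 * L ^+ 2 * e * k * 1 <= 2 * L ^+ 2 * e * k * (L * q).
    by rewrite ler_wpM2l// !mulr_ge0// ltW.
  have L35 : L ^+ 3 <= L ^+ 5 by rewrite ler_weXn2l.
  have h3 : L ^+ 3 * (e * q) <= L ^+ 3 * (k * e * q).
    by rewrite ler_pM2l ?exprn_gt0// -mulrA ler_peMl// mulr_ge0.
  have h4 : L ^+ 3 * (k * e * q) <= L ^+ 5 * (k * e * q).
    by apply: ler_wpM2r => //; apply: mulr_ge0 => //; exact: mulr_ge0.
  have : 2 * L ^+ 2 * q * B = 8 * L ^+ 5 * d * q + 4 * (L ^+ 3 * (e * q)).
    by rewrite /B; ring.
  have : 2 * L ^+ 2 * e * k * (L * q) = 2 * (L ^+ 3 * (k * e * q)) by ring.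
  lra.
have H1 := le_trans g1 (gw _ (Re_le_modc w)).
have H2 := le_trans g2 (gw _ (Im_le_modc w)).
have -> : r * Y - P = (r - (a +i* b + w)) * Y by rewrite PE; ring.
rewrite modcM -ler_pdivlMr// -(mulrA _ (modc P)) -/q.
apply: le_trans (modc_le_ReIm _) _.
have -> : complex.Re (r - (a +i* b + w)) =
    (a' - a) + ((N - N1) / (4 * a' * N0) - complex.Re w).
  by case: (w) => w1 w2 /=; ring.
have -> : complex.Im (r - (a +i* b + w)) =
    (b' - b) + ((N - N2) / (4 * b' * N0) - complex.Im w).
  by case: (w) => w1 w2 /=; ring.
apply: le_trans (lerD (ler_normD _ _) (ler_normD _ _)) _.
(* Relative to [q], each part contributes [8 L^5 d + 6 L^5 k e], and at most [L^5 d] more for the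
   rounding of the entry; twice this gives the 18 and the 12. *)
have dq : d <= L ^+ 5 * d * q.
  have h : L <= L ^+ 5 by rewrite -[leLHS]expr1 ler_weXn2l.
  have : d * 1 <= d * (L * q) by rewrite ler_wpM2l.
  have : L * (d * q) <= L ^+ 5 * (d * q) by rewrite ler_wpM2r// mulr_ge0.
  lra.
lra.
Qed.

(** [A (n+1) - P (n+1)] is [r (n+1)] times the previous error plus the new one, and
    [|r (n+1) P n| <= (1 + eta)|P (n+1)|]. The coefficient grows by [eta + 2 n eta^2], at most
    [2 eta] because [2 n eta <= 1]. *)
Lemma product_error (n : nat) (eta : R) (P r A : nat -> C) :
  0 <= eta -> 2 * n%:R * eta <= 1 -> P 0%N = 1 -> A 0%N = 1 ->
  (forall k, (k < n)%N -> A k.+1 = r k.+1 * A k) ->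
  (forall k, (k < n)%N -> modc (r k.+1 * P k - P k.+1) <= eta * modc (P k.+1)) ->
  modc (A n - P n) <= 2 * n%:R * eta * modc (P n).
Proof.
move=> eta0; elim: n => [|n IHn] n1 P0 A0 AS rP.
  by rewrite A0 P0 subrr /modc /sqn/= expr0n addr0 sqrtr0 !mulr0 !mul0r.
have nS : 2 * n%:R * eta <= 2 * n.+1%:R * eta.
  by rewrite ler_wpM2r// ler_wpM2l// ler_nat.
have {}IHn := IHn (le_trans nS n1) P0 A0 (fun k kn => AS k (ltnW kn))
  (fun k kn => rP k (ltnW kn)).
have h := rP n (ltnSn n).
have -> : A n.+1 - P n.+1 = r n.+1 * (A n - P n) + (r n.+1 * P n - P n.+1).
  by rewrite AS//; ring.
apply: le_trans (modcD _ _) _; rewrite modcM.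
have hr : modc (r n.+1) * modc (P n) <= (1 + eta) * modc (P n.+1).
  rewrite -modcM; have := modcD (r n.+1 * P n - P n.+1) (P n.+1).
  by rewrite subrK; lra.
have p0 := modc_ge0 (P n.+1).
have h1 : modc (r n.+1) * modc (A n - P n) <=
    (2 * n%:R * eta) * ((1 + eta) * modc (P n.+1)).
  apply: (@le_trans _ _ (2 * n%:R * eta * (modc (r n.+1) * modc (P n)))).
    rewrite [leRHS](_ : _ = modc (r n.+1) * (2 * n%:R * eta * modc (P n))); last by ring.
    by rewrite ler_wpM2l// modc_ge0.
  by rewrite ler_wpM2l// !mulr_ge0.
have h2 : 2 * n%:R * eta * (eta * modc (P n.+1)) <= 1 * (eta * modc (P n.+1)).
  by rewrite ler_wpM2r ?mulr_ge0//; exact: le_trans nS n1.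
rewrite -natr1; lra.
Qed.

End ErrorAnalysis.

(** * Costs of programs *)

Section Polybounded.
Local Open Scope nat_scope.

Definition polybounded (f : nat -> nat) : Prop :=
  exists T : {poly nat}, forall x, f x <= T.[x]%R.

Lemma polybounded_cst c : polybounded (fun=> c).
Proof. by exists c%:P%R => x; rewrite hornerC. Qed.

Lemma polybounded_id : polybounded id.
Proof. by exists 'X%R => x; rewrite hornerX. Qed.

Lemma polybounded_horner (T : {poly nat}) : polybounded (fun x => T.[x]%R).
Proof. by exists T. Qed.

Lemma polyboundedD f g :
  polybounded f -> polybounded g -> polybounded (fun x => f x + g x).
Proof. by move=> [T fT] [U gU]; exists (T + U)%R => x; rewrite hornerD leq_add. Qed.

Lemma polyboundedM f g :
  polybounded f -> polybounded g -> polybounded (fun x => f x * g x).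
Proof. by move=> [T fT] [U gU]; exists (T * U)%R => x; rewrite hornerM leq_mul. Qed.

Lemma polyboundedX f n : polybounded f -> polybounded (fun x => f x ^ n).
Proof.
move=> pf; elim: n => [|n IHn]; first exact: polybounded_cst.
have [T fT] := polyboundedM pf IHn.
by exists T => x; rewrite expnS.
Qed.

(** Natural coefficients make polynomials monotone, which closes [polybounded] under composition. *)
Lemma leq_horner (T : {poly nat}) x y : x <= y -> T.[x]%R <= T.[y]%R.
Proof.
move=> xy; rewrite !horner_coef; elim/big_ind2: _ => // [a b c d|i _].
  exact: leq_add.
apply: leq_mul => //; rewrite -[(x ^+ i)%R]/(x ^ i)%N.
by case: (nat_of_ord i) => // k; rewrite leq_exp2r.
Qed.

Lemma polybounded_comp f g :
  polybounded f -> polybounded g -> polybounded (fun x => f (g x)).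
Proof.
move=> [T fT] [U gU]; exists (T \Po U)%R => x; rewrite horner_comp.
exact: leq_trans (fT _) (leq_horner _ (gU x)).
Qed.

Lemma eq_polybounded f g : (forall x, f x <= g x) -> polybounded g -> polybounded f.
Proof. by move=> fg [T gT]; exists T => x; exact: leq_trans (fg x) (gT x). Qed.

End Polybounded.

(** * A program logic that carries costs and register lengths *)

Section CostedPrograms.
Variable O : seq int -> seq int.
Local Open Scope nat_scope.

(** Not strict, so that lengths simply add under multiplication and [2 ^ B] itself has [B] bits. *)
Definition bits (B : nat) (z : int) : Prop := `|z| <= 2 ^ B.

Definition bits_mem (B : nat) (m : memory) : Prop := forall x, bits B (m x).

Lemma bitsW B B' z : B <= B' -> bits B z -> bits B' z.
Proof. by move=> BB' /leq_trans; apply; rewrite leq_exp2l. Qed.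

Lemma bitsD B B' x y : bits B x -> bits B' y -> bits (B + B').+1 (x + y)%R.
Proof.
rewrite /bits => Bx By; apply: (@leq_trans (`|x| + `|y|)); first by lia.
rewrite expnS mul2n -addnn; apply: leq_add; first exact: bitsW (leq_addr _ _) Bx.
exact: bitsW (leq_addl _ _) By.
Qed.

Lemma bitsN B x : bits B x -> bits B (- x)%R.
Proof. by rewrite /bits abszN. Qed.

Lemma bitsB B B' x y : bits B x -> bits B' y -> bits (B + B').+1 (x - y)%R.
Proof. by move=> Bx By; apply: bitsD => //; exact: bitsN. Qed.

Lemma bitsM B B' x y : bits B x -> bits B' y -> bits (B + B') (x * y)%R.
Proof. by rewrite /bits => Bx By; rewrite abszM expnD leq_mul. Qed.

Lemma bits_zsize z : bits (zsize z) z.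
Proof. exact: ltnW (trunc_log_ltn _ _). Qed.

Lemma zsize_bits B z : bits B z -> zsize z <= B.+1.
Proof. by rewrite ltnS => /(leq_trunc_log 2); rewrite trunc_expnK. Qed.

Lemma bits_nat (n B : nat) : n <= B -> bits B n%:Z.
Proof. by move=> nB; apply: leq_trans nB (ltnW (ltn_expl _ _)). Qed.

Lemma wsize_cat v w : wsize (v ++ w) = wsize v + wsize w.
Proof. exact: big_cat. Qed.

Lemma wsize_nth w j : bits (wsize w) (w`_j)%R.
Proof.
have [jw|jw] := ltnP j (size w); last by rewrite nth_default.
apply: bitsW (bits_zsize _).
by rewrite -{2}(cat_take_drop j w) (drop_nth 0%R)// wsize_cat /wsize big_cons; lia.
Qed.

Lemma size_wsize w : size w <= wsize w.
Proof.
by elim: w => //= z w; rewrite /wsize big_cons /zsize; lia.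
Qed.

Lemma wsize_leq w B : (forall j, j < size w -> bits B (w`_j)%R) ->
  wsize w <= size w * B.+1.
Proof.
elim: w => [|z w IHw] Bw; first by rewrite /wsize big_nil.
rewrite /wsize big_cons mulSn leq_add ?zsize_bits//; first exact: (Bw 0).
by apply: IHw => j jw; exact: (Bw j.+1).
Qed.

(** Bounds the number of charged nodes and also, as a factor of [B], the length of every value met
    during evaluation; for the latter a constant counts with its length. *)
Fixpoint esize (e : aexpr) : nat :=
  match e with
  | Const z => zsize z
  | Reg a => (esize a).+1
  | Add e1 e2 | Defs.Sub e1 e2 | Mul e1 e2 => (esize e1 + esize e2).+1
  end.

Definition expr_cost_bound (B : nat) (e : aexpr) : nat := esize e * (esize e * B).+1.

(* Upper bound for the cost of a program all of whose registers keep values of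
   at most [B] bits and each of whose loops makes at most [B] iterations. *)
Fixpoint cost_bound (B : nat) (c : cmd) : nat :=
  match c with
  | Store ea e => expr_cost_bound B ea + expr_cost_bound B e
  | Seq c1 c2 => cost_bound B c1 + cost_bound B c2
  | If e c1 c2 => expr_cost_bound B e + cost_bound B c1 + cost_bound B c2
  | While e c => B.+1 * (expr_cost_bound B e + cost_bound B c)
  | Query ea ed => expr_cost_bound B ea + expr_cost_bound B ed + B + B
  end.

Lemma polybounded_cost_bound c : polybounded (fun B => cost_bound B c).
Proof.
have pe e : polybounded (fun B => expr_cost_bound B e).
  apply: (@eq_polybounded _ (fun B => esize e * (esize e * B + 1))).
    by move=> x; rewrite /expr_cost_bound addn1.
  apply: polyboundedM; first exact: polybounded_cst.
  apply: polyboundedD; last exact: polybounded_cst.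
  by apply: polyboundedM; [exact: polybounded_cst|exact: polybounded_id].
elim: c => /= [ea e|c1 IH1 c2 IH2|e c1 IH1 c2 IH2|e c IH|ea ed].
- exact: polyboundedD.
- exact: polyboundedD.
- by apply: polyboundedD => //; exact: polyboundedD.
- apply: (@eq_polybounded _ (fun B => (B + 1) * (expr_cost_bound B e + cost_bound B c))).
    by move=> x; rewrite addn1.
  apply: polyboundedM; last exact: polyboundedD.
  by apply: polyboundedD; [exact: polybounded_id|exact: polybounded_cst].
- apply: polyboundedD; last exact: polybounded_id.
  by apply: polyboundedD; [exact: polyboundedD|exact: polybounded_id].
Qed.

Lemma bits_aeval B m e : 0 < B -> bits_mem B m -> bits (esize e * B) (aeval m e).
Proof.
move=> B0 Bm; have dist a b : a * B + b * B < (a + b).+1 * B.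
  by rewrite mulSn mulnDl; lia.
elim: e => /= [z|a IHa|e1 IH1 e2 IH2|e1 IH1 e2 IH2|e1 IH1 e2 IH2].
- by apply: bitsW (bits_zsize z); rewrite leq_pmulr.
- by apply: bitsW (Bm _); rewrite leq_pmull.
- exact: bitsW (dist _ _) (bitsD IH1 IH2).
- exact: bitsW (dist _ _) (bitsB IH1 IH2).
- exact: bitsW (ltnW (dist _ _)) (bitsM IH1 IH2).
Qed.

Lemma leq_acost B m e : 0 < B -> bits_mem B m -> acost m e <= expr_cost_bound B e.
Proof.
move=> B0 Bm; rewrite /expr_cost_bound.
have zs e' : zsize (aeval m e') <= (esize e' * B).+1.
  by apply: zsize_bits; exact: bits_aeval.
suff h X : (forall e', esize e' <= esize e -> zsize (aeval m e') <= X) ->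
    acost m e <= esize e * X.
  by apply: h => e' ee; apply: leq_trans (zs e') _; rewrite ltnS leq_mul2r ee orbT.
elim: e => /= [z|a IHa|e1 IH1 e2 IH2|e1 IH1 e2 IH2|e1 IH1 e2 IH2] hX;
  rewrite ?mulSn.
- rewrite addn0; apply: leq_trans (hX (Const z) _) _ => //.
  by rewrite leq_addr.
- apply: leq_add; first exact: (hX (Reg a)).
  by apply: IHa => e' ee; apply: hX; exact: leq_trans ee _.
- apply: leq_add; first exact: (hX (Add e1 e2)).
  rewrite mulnDl; apply: leq_add; [apply: IH1|apply: IH2] => e' ee; apply: hX; lia.
- apply: leq_add; first exact: (hX (Defs.Sub e1 e2)).
  rewrite mulnDl; apply: leq_add; [apply: IH1|apply: IH2] => e' ee; apply: hX; lia.
- apply: leq_add; first exact: (hX (Mul e1 e2)).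
  rewrite mulnDl; apply: leq_add; [apply: IH1|apply: IH2] => e' ee; apply: hX; lia.
Qed.

(** A total-correctness triple with cost. For fixed [B] the bound [cost_bound] depends on the text
    of the program only, so verification is left with register contents, loop lengths and query
    sizes. *)
Definition wp (B : nat) (c : cmd) (Q : memory -> Prop) (m : memory) : Prop :=
  exists m' k, [/\ exec O c m m' k, k <= cost_bound B c, bits_mem B m' & Q m'].

Variable B : nat.
Hypothesis B0 : 0 < B.

Lemma wp_conseq c (Q Q' : memory -> Prop) m :
  (forall m', bits_mem B m' -> Q m' -> Q' m') -> wp B c Q m -> wp B c Q' m.
Proof. by move=> QQ [m' [k [ex kB Bm /QQ Qm]]]; exists m', k; split; auto. Qed.

Lemma wp_seq c1 c2 Q m :
  wp B c1 (fun m' => wp B c2 Q m') m -> wp B (Seq c1 c2) Q m.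
Proof.
move=> [m1 [k1 [e1 b1 _ [m2 [k2 [e2 b2 Bm2 Qm2]]]]]].
exists m2, (k1 + k2); split => //; first exact: ExecSeq e1 e2.
exact: leq_add.
Qed.

Lemma wp_store ea e (Q : memory -> Prop) m : bits_mem B m ->
  bits B (aeval m e) ->
  (bits_mem B [eta m with aeval m ea |-> aeval m e] ->
   Q [eta m with aeval m ea |-> aeval m e]) ->
  wp B (Store ea e) Q m.
Proof.
move=> Bm Be Qm.
have Bm' : bits_mem B [eta m with aeval m ea |-> aeval m e].
  by move=> x /=; case: ifP.
exists [eta m with aeval m ea |-> aeval m e], (acost m ea + acost m e).
split => //; [exact: ExecStore| |exact: Qm].
by apply: leq_add; exact: leq_acost.
Qed.

Lemma wp_if e c1 c2 Q m : bits_mem B m ->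
  ((0 < aeval m e)%R -> wp B c1 Q m) -> ((aeval m e <= 0)%R -> wp B c2 Q m) ->
  wp B (If e c1 c2) Q m.
Proof.
move=> Bm h1 h2; have ce := leq_acost e B0 Bm.
have [e0|e0] := ltP 0%R (aeval m e).
  have [m' [k [ex kB Bm' Qm']]] := h1 e0.
  exists m', (acost m e + k); split => //=; first exact: ExecIfPos.
  lia.
have [m' [k [ex kB Bm' Qm']]] := h2 e0.
exists m', (acost m e + k); split => //=; first exact: ExecIfNeg.
lia.
Qed.

(** [I i] holds after [i] rounds, and there are exactly [n]; the condition [n <= B] is what the
    factor [B.+1] of [cost_bound] pays for. *)
Lemma wp_while (I : nat -> memory -> Prop) n e c m : n <= B ->
  (forall i m', i < n -> bits_mem B m' -> I i m' ->
     (0 < aeval m' e)%R /\ wp B c (I i.+1) m') ->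
  (forall m', bits_mem B m' -> I n m' -> (aeval m' e <= 0)%R) ->
  bits_mem B m -> I 0 m -> wp B (While e c) (I n) m.
Proof.
move=> nB step stop.
(* Induction on the number [d] of remaining rounds; [d.+1] includes the final test, which fails. *)
suff h d : forall i m', i + d = n -> bits_mem B m' -> I i m' ->
    exists m2 k, [/\ exec O (While e c) m' m2 k,
      k <= d.+1 * (expr_cost_bound B e + cost_bound B c), bits_mem B m2 & I n m2].
  move=> Bm I0; have [m2 [k [ex kB Bm2 In]]] := h n 0 m (add0n n) Bm I0.
  exists m2, k; split => //=; apply: leq_trans kB _.
  by rewrite leq_mul2r ltnS nB orbT.
elim: d => [|d IHd] i m' idn Bm' Ii.
  rewrite addn0 in idn; rewrite idn in Ii.
  exists m', (acost m' e); split => //; first by apply: ExecWhileStop; exact: stop.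
  by rewrite mul1n; apply: leq_trans (leq_acost e B0 Bm') (leq_addr _ _).
have [e0 [m1 [k1 [ex1 k1B Bm1 I1]]]] := step i m' ltac:(lia) Bm' Ii.
have [m2 [k2 [ex2 k2B Bm2 In]]] := IHd i.+1 m1 ltac:(lia) Bm1 I1.
exists m2, (acost m' e + k1 + k2); split => //; first exact: ExecWhileLoop ex1 ex2.
by rewrite mulSn leq_add// leq_add// leq_acost.
Qed.

Lemma wp_query ea ed (Q : memory -> Prop) m : bits_mem B m ->
  wsize (read_word m (aeval m ea)) <= B ->
  wsize (O (read_word m (aeval m ea))) <= B ->
  let m' := write_word m (aeval m ed) (O (read_word m (aeval m ea))) in
  (bits_mem B m' -> Q m') ->
  wp B (Query ea ed) Q m.
Proof.
move=> Bm Bq Ba m' Qm; have Bm' : bits_mem B m'.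
  move=> x; rewrite /m' /write_word; case: ifP => // _.
  case: `|_|%N => [|j] /=.
    by apply: bits_nat; apply: leq_trans (size_wsize _) Ba.
  exact: bitsW Ba (wsize_nth _ _).
exists m'; eexists; split; [exact: ExecQuery| |exact: Bm'|exact: Qm].
by rewrite /= !leq_add// leq_acost.
Qed.

Definition assign (i : nat) (e : aexpr) : cmd := Store (Const (Negz i)) e.

(** Cells of nonnegative address and variables are described separately, here and in [wp_put], so
    that framing is mere rewriting. *)
Lemma wp_assign i e v (Q : memory -> Prop) m : bits_mem B m ->
  aeval m e = v -> bits B v ->
  (forall m', bits_mem B m' -> (forall x : nat, m' x = m x) ->
    (forall x, m' (Negz x) = if x == i then v else m (Negz x)) -> Q m') ->
  wp B (assign i e) Q m.
Proof.
move=> Bm ev Bv Qm; apply: wp_store => //; first by rewrite ev.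
by rewrite ev => Bm'; apply: Qm.
Qed.

Lemma wp_put ea e (a : nat) v (Q : memory -> Prop) m : bits_mem B m ->
  aeval m ea = a -> aeval m e = v -> bits B v ->
  (forall m', bits_mem B m' ->
    (forall x : nat, m' x = if x == a then v else m x) ->
    (forall x, m' (Negz x) = m (Negz x)) -> Q m') ->
  wp B (Store ea e) Q m.
Proof.
move=> Bm ea_ ev Bv Qm; apply: wp_store => //; first by rewrite ev.
by rewrite ev ea_ => Bm'; apply: Qm.
Qed.

End CostedPrograms.

(** * Layout of input and query words *)

Section Words.
Local Open Scope nat_scope.

Definition entry_letters (z : int * int) : seq int := [:: z.1; z.2].

(** The shape of [encode] with rounded entries given by any function of natural indices; it
    describes what a program writes, whether or not this is known to come from a Gaussian matrix. *)
Definition word (n s t b : nat) (g : nat -> nat -> int * int) : seq int :=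
  [:: n%:Z; s%:Z; t%:Z; b%:Z] ++ nseq (s + t + b) (0%R : int) ++
  flatten [seq entry_letters (g i j) | i <- iota 0 n, j <- iota 0 n].

Lemma mkseqS T (f : nat -> T) k : mkseq f k.+1 = mkseq f k ++ [:: f k].
Proof. by rewrite /mkseq -{1}(addn1 k) iotaD map_cat. Qed.

Lemma size_flatten_mkseq T (f : nat -> seq T) c k : (forall i, size (f i) = c) ->
  size (flatten (mkseq f k)) = k * c.
Proof.
move=> fc; elim: k => // k IHk.
by rewrite mkseqS flatten_cat size_cat IHk /= cats0 fc mulSnr.
Qed.

Lemma nth_flatten_mkseq T x0 (f : nat -> seq T) c k l :
  (forall i, size (f i) = c) -> l < k * c ->
  nth x0 (flatten (mkseq f k)) l = nth x0 (f (l %/ c)) (l %% c).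
Proof.
move=> fc; elim: k l => [//|k IHk] l lk.
have c0 : 0 < c by move: lk; case: c {fc IHk} => //; rewrite muln0.
rewrite mkseqS flatten_cat nth_cat (size_flatten_mkseq _ fc).
have [lkc|klc] := ltnP l (k * c); first exact: IHk.
have -> : l = k * c + (l - k * c) by lia.
have lc : l - k * c < c by move: lk; rewrite mulSn; lia.
by rewrite divnMDl// divn_small// addn0 modnMDl modn_small//= cats0 addnC addnK.
Qed.

Lemma word_entriesE n g :
  flatten [seq entry_letters (g i j) | i <- iota 0 n, j <- iota 0 n] =
  flatten (mkseq (fun i => flatten (mkseq (fun j => entry_letters (g i j)) n)) n).
Proof.
suff h r q : flatten [seq entry_letters (g i j) | i <- r, j <- q] =
    flatten [seq flatten [seq entry_letters (g i j) | j <- q] | i <- r] by exact: h.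
by elim: r => //= i r IHr; rewrite flatten_cat IHr.
Qed.

Lemma size_word n s t b g : size (word n s t b g) = 4 + (s + t + b) + n * n.*2.
Proof.
rewrite !size_cat size_nseq word_entriesE /= (@size_flatten_mkseq _ _ n.*2) ?addnA//.
by move=> i; rewrite (@size_flatten_mkseq _ _ 2)// muln2.
Qed.

Lemma nth_word_zeros n s t b g j : j < s + t + b ->
  ((word n s t b g)`_(4 + j) = 0)%R.
Proof.
by move=> jl; rewrite /word nth_cat [size _]/= ltnNge leq_addr addKn
  nth_cat size_nseq jl nth_nseq jl.
Qed.

Definition letter (g : nat -> nat -> int * int) (n l : nat) : int :=
  let z := g (l %/ n.*2) (l %% n.*2)./2 in if odd l then z.2 else z.1.

Lemma nth_word_entries n s t b g l : l < n * n.*2 ->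
  ((word n s t b g)`_(4 + (s + t + b) + l))%R = letter g n l.
Proof.
move=> ln; have n0 : 0 < n by case: n ln.
rewrite /word nth_cat [size _]/= ltnNge -addnA leq_addr /= addKn nth_cat size_nseq.
rewrite ltnNge leq_addr addKn word_entriesE.
rewrite (@nth_flatten_mkseq _ _ _ n.*2); last exact: ln.
  have lm : l %% n.*2 < n * 2 by rewrite muln2 ltn_mod double_gt0.
  rewrite (nth_flatten_mkseq _ _ lm)// divn2 /letter modn2 odd_mod ?odd_double//.
  by case: odd.
by move=> i; rewrite (@size_flatten_mkseq _ _ 2)// muln2.
Qed.

Lemma eq_word n s t b g h :
  (forall i j, i < n -> j < n -> g i j = h i j) ->
  word n s t b g = word n s t b h.
Proof.
move=> gh; congr (_ ++ _ ++ flatten _).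
apply/eq_in_allpairs => i j /=; rewrite !mem_iota /= add0n => ? ?; rewrite gh//.
Qed.

(** Recovers the rounded entries from an input, so that the function computed by a reduction can be
    defined on all words. *)
Definition decode (w : seq int) (i j : nat) : int * int :=
  let n := `|(w`_0)%R| in
  let l := 4 + (`|(w`_1)%R| + `|(w`_2)%R| + `|(w`_3)%R|) + (i * n.*2 + j.*2) in
  ((w`_l)%R, (w`_l.+1)%R).

Lemma decode_word n s t b g i j : i < n -> j < n ->
  decode (word n s t b g) i j = g i j.
Proof.
move=> ni nj.
have n2 : 0 < n.*2 by rewrite double_gt0; lia.
have h e : e < 2 -> i * n.*2 + (j.*2 + e) < n * n.*2.
  move=> e2; apply: (@leq_trans (i.+1 * n.*2)); last by rewrite leq_mul2r ni orbT.
  rewrite mulSn; lia.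
have d e : e < 2 -> (i * n.*2 + (j.*2 + e)) %/ n.*2 = i.
  by move=> e2; rewrite divnMDl// divn_small ?addn0//; lia.
have r e : e < 2 -> (i * n.*2 + (j.*2 + e)) %% n.*2 = j.*2 + e.
  by move=> e2; rewrite modnMDl modn_small//; lia.
rewrite /decode !absz_nat [RHS]surjective_pairing; congr pair.
  rewrite -[j.*2]addn0 nth_word_entries ?h// /letter d// r// addn0 doubleK.
  by rewrite oddD oddM !odd_double andbF.
have -> : (4 + (s + t + b) + (i * n.*2 + j.*2)).+1 =
    4 + (s + t + b) + (i * n.*2 + (j.*2 + 1)) by lia.
rewrite nth_word_entries ?h// /letter d// r//.
have -> : (j.*2 + 1)./2 = j by lia.
by rewrite oddD oddM oddD !odd_double andbF.
Qed.

Lemma bits_word_entry n s t b g i j : i < n -> j < n ->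
  bits (wsize (word n s t b g)) (g i j).1 /\ bits (wsize (word n s t b g)) (g i j).2.
Proof. by move=> ni nj; rewrite -(decode_word s t b g ni nj); split; exact: wsize_nth. Qed.

Lemma bits_letter n s t b g l : l < n * n.*2 ->
  bits (wsize (word n s t b g)) (letter g n l).
Proof. by move=> ln; rewrite -(nth_word_entries s t b g ln); exact: wsize_nth. Qed.

Lemma word_header n s t b g :
  [/\ (word n s t b g)`_0 = n, (word n s t b g)`_1 = s, (word n s t b g)`_2 = t &
      (word n s t b g)`_3 = b]%R.
Proof. by []. Qed.

Lemma leq_wsize_word n s t b g : 4 + (s + t + b) + n * n.*2 <= wsize (word n s t b g).
Proof. by apply: leq_trans (size_wsize _); rewrite size_word. Qed.

End Words.

Section Encoding.
Context (R : realType).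
Local Open Scope nat_scope.

Lemma encodeE n s t b (X : 'M[R[i]]_n) :
  encode s t b X = word n s t b (fun i j => round_entry b (ent X i j)).
Proof.
congr (_ ++ _ ++ flatten _); rewrite -val_enum_ord.
rewrite -(eq_allpairs (f1 := fun i j : 'I_n => entry_letters (round_entry b (ent X i j)))).
  by rewrite allpairs_mapl allpairs_mapr.
by move=> i j; rewrite entE.
Qed.

(** Dyadic entries are their own roundings. The length bound in [solves] concerns encodings of
    matrices; this extends it to every query, including those on exceptional inputs. *)
Lemma wordE n s t b (g : nat -> nat -> int * int) :
  exists X : 'M[R[i]]_n, encode s t b X = word n s t b g.
Proof.
exists (\matrix_(i, j) (((g i j).1%:~R / 2 ^+ b) +i* ((g i j).2%:~R / 2 ^+ b))%R).
rewrite encodeE; apply: eq_word => i j ni nj.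
rewrite (ent_Ordinal _ ni nj) mxE /round_entry /=.
have dK (z : int) : Num.floor (2 ^+ b * (z%:~R / 2 ^+ b) : R)%R = z.
  by rewrite mulrC divfK ?intrKfloor// expf_neq0.
by rewrite !dK; case: (g i j).
Qed.

End Encoding.

(** * The programs *)

(* Variables live at negative addresses: 0, 1 hold the inverse error bounds of
   the queries, 2 the size of the current block, 3, 4 loop indices, 5-7 the
   product of the ratios (real part, imaginary part, denominator), 8, 9 the last
   estimate of a squared modulus, 10-15 the three answers, 16 the scale 2^b,
   17-19 temporary values. The query is built right after the input, in cells
   that are still 0, so that its unary part need not be written; the answer
   goes after the query. *)
Definition reg (i : nat) : aexpr := Reg (Const (Negz i)).
Definition input_reg (i : nat) : aexpr := Reg (Const (Posz i)).
Definition lit (c : nat) : aexpr := Const (Posz c).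

Definition e_query : aexpr := Add (input_reg 0) (lit 1).
Definition e_entries : aexpr :=
  Add (Add (Add (Add e_query (lit 5)) (reg 0)) (reg 1)) (input_reg 4).
Definition e_answer : aexpr :=
  Add e_entries (Mul (lit 2) (Mul (input_reg 1) (input_reg 1))).

(** Address of letter [reg 4] in row [reg 3] of the bottom right block: past 5 cells of length and
    header, the unary part, [n - k] rows, and [n - k] entries of two letters. *)
Definition e_source : aexpr :=
  Add (Add (Add (Add (lit 5) (input_reg 2)) (input_reg 3)) (input_reg 4))
   (Add (Mul (Add (Defs.Sub (input_reg 1) (reg 2)) (reg 3)) (Mul (lit 2) (input_reg 1)))
      (Add (Mul (lit 2) (Defs.Sub (input_reg 1) (reg 2))) (reg 4))).

(** One loop replaces two nested ones: [reg 4] runs over the [2 k] letters of a row and wraps to the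
    next row; [assign 4 (reg 4)] is a no-op. *)
Definition copy_body : cmd :=
  Seq (Store (Add e_entries (Add (Mul (reg 3) (Mul (lit 2) (reg 2))) (reg 4)))
         (Reg e_source))
 (Seq (assign 4 (Add (reg 4) (lit 1)))
      (If (Defs.Sub (Mul (lit 2) (reg 2)) (reg 4)) (assign 4 (reg 4))
          (Seq (assign 3 (Add (reg 3) (lit 1))) (assign 4 (lit 0))))).

Definition copy : cmd :=
  Seq (assign 3 (lit 0)) (Seq (assign 4 (lit 0))
    (While (Defs.Sub (reg 2) (reg 3)) copy_body)).

(* A short answer would leave letters of an earlier one in place, whereas the
   specification reads [0] past the end of a word: hence the three resets. *)
Definition ask : cmd :=
  Seq (Store e_query (Add (Add (Add (Add (lit 4) (reg 0)) (reg 1)) (input_reg 4))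
                          (Mul (lit 2) (Mul (reg 2) (reg 2)))))
 (Seq (Store (Add e_query (lit 1)) (reg 2))
 (Seq (Store (Add e_answer (lit 1)) (lit 0))
 (Seq (Store (Add e_answer (lit 2)) (lit 0))
 (Seq (Store (Add e_answer (lit 3)) (lit 0))
      (Query e_query e_answer))))).

Definition fetch (i : nat) : cmd :=
  Seq ask (Seq (assign i (Reg (Add e_answer (lit 1))))
               (assign i.+1 (Reg (Add e_answer (lit 2))))).

(** * Verification of copying and querying *)

Section Calls.
Variables (O : seq int -> seq int) (B n s t b s' t' : nat).
Variable g : nat -> nat -> int * int.
Local Open Scope nat_scope.

(** The first cell after the input, whose 5 leading cells are length and header. The entry area that
    follows has room for a full [n] by [n] block, so that no address depends on the level. *)
Definition query_addr : nat := 5 + (s + t + b) + n * n.*2.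
Definition entries_addr : nat := query_addr + 5 + (s' + t' + b).
Definition answer_addr : nat := entries_addr + n * n.*2.
Local Notation L := query_addr.
Local Notation E := entries_addr.
Local Notation D := answer_addr.

(** The input and the constant part of the query. Cells [L] and [L + 1], with the length and
    dimension of the query, and the cells from [E] on are left out, being rewritten for each
    query. *)
Record heap (m : memory) : Prop := Heap {
  heap_len : m 0%N = (4 + (s + t + b) + n * n.*2)%N;
  heap_n : m 1%N = n;
  heap_s : m 2%N = s;
  heap_t : m 3%N = t;
  heap_b : m 4%N = b;
  heap_input : forall l, l < n * n.*2 -> m (5 + (s + t + b) + l)%N = letter g n l;
  heap_qs : m (L + 2)%N = s';
  heap_qt : m (L + 3)%N = t';
  heap_qb : m (L + 4)%N = b;
  heap_zeros : forall x, L + 5 <= x < E -> m x = 0%R;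
  heap_rs : m (Negz 0) = s';
  heap_rt : m (Negz 1) = t' }.

Lemma heap_ext (m m' : memory) :
  (forall x : nat, x < E -> x != L -> x != L.+1 -> m' x = m x) ->
  m' (Negz 0) = m (Negz 0) -> m' (Negz 1) = m (Negz 1) -> heap m -> heap m'.
Proof.
move=> mm' r0 r1 [h1 h2 h3 h4 h5 h6 h7 h8 h9 h10 h11 h12].
rewrite -r0 in h11; rewrite -r1 in h12.
have fr x : x < L -> m' x = m x.
  by move=> xL; apply: mm'; rewrite /entries_addr; lia.
have frq x : L.+1 < x < E -> m' x = m x by move=> xL; apply: mm'; lia.
have l5 : 4 < L by rewrite /query_addr; lia.
have LE : L + 5 <= E by rewrite /entries_addr; lia.
constructor => //; try by rewrite fr//; lia.
- by move=> l ln; rewrite fr ?h6// /query_addr; lia.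
- by rewrite frq//; lia.
- by rewrite frq//; lia.
- by rewrite frq//; lia.
- by move=> x xLE; rewrite frq ?h10//; lia.
Qed.

Lemma heap_ext_all (m m' : memory) : (forall x : nat, m' x = m x) ->
  m' (Negz 0) = m (Negz 0) -> m' (Negz 1) = m (Negz 1) -> heap m -> heap m'.
Proof. by move=> mm'; apply: heap_ext => x *; exact: mm'. Qed.

Section Addresses.
Variable m : memory.
Hypothesis Hm : heap m.

Lemma aeval_query : aeval m e_query = L.
Proof. by rewrite /= (heap_len Hm) /query_addr; lia. Qed.

Lemma aeval_entries : aeval m e_entries = E.
Proof.
rewrite /= (heap_len Hm) (heap_rs Hm) (heap_rt Hm) (heap_b Hm).
by rewrite /entries_addr /query_addr; lia.
Qed.

Lemma aeval_answer : aeval m e_answer = D.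
Proof.
rewrite [LHS]/= -[X in (X + _)%R]/(aeval m e_entries) aeval_entries (heap_n Hm).
by rewrite /answer_addr; lia.
Qed.

End Addresses.

Definition corner (k i j : nat) : int * int := g (n - k + i) (n - k + j).

(** A letter of the block is a letter of the input, [n - k] rows further down and [2 (n - k)]
    letters further right. *)
Lemma letter_corner k l : k <= n -> l < k * k.*2 ->
  letter (corner k) k l =
  letter g n ((n - k + l %/ k.*2) * n.*2 + ((n - k).*2 + l %% k.*2)) /\
  (n - k + l %/ k.*2) * n.*2 + ((n - k).*2 + l %% k.*2) < n * n.*2.
Proof.
move=> kn lk; have k0 : 0 < k.*2 by case: k lk {kn}.
have i0 : l %/ k.*2 < k by rewrite ltn_divLR.
have j0 : l %% k.*2 < k.*2 by rewrite ltn_mod.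
have r0 : (n - k).*2 + l %% k.*2 < n.*2 by lia.
have n0 : 0 < n.*2 by lia.
split; last first.
  have : (n - k + l %/ k.*2).+1 * n.*2 <= n * n.*2 by rewrite leq_mul2r; lia.
  rewrite mulSn; lia.
rewrite /letter /corner divnMDl// modnMDl (modn_small r0) (divn_small r0) addn0.
rewrite oddD oddM odd_double andbF /= oddD odd_double /= odd_mod ?odd_double//.
by rewrite halfD odd_double /= add0n doubleK.
Qed.

Hypothesis DB : D + 10 <= B.

Let B0 : 0 < B. Proof. lia. Qed.

Lemma wp_copy k m (Q : memory -> Prop) : k <= n -> heap m -> bits_mem B m ->
  (forall l, l < n * n.*2 -> bits B (letter g n l)) ->
  m (Negz 2) = k ->
  (forall m', bits_mem B m' -> heap m' ->
    (forall l, l < k * k.*2 -> m' (E + l)%N = letter (corner k) k l) ->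
    (forall x, x != 3 -> x != 4 -> m' (Negz x) = m (Negz x)) -> Q m') ->
  wp O B copy Q m.
Proof.
move=> kn Hm Bm Bg mk HQ.
have kkB : k * k.*2 <= n * n.*2 by rewrite leq_mul// leq_double.
have DE : E + n * n.*2 = D by [].
have nB : n.*2 <= n * n.*2 by case: (n) => // n0; rewrite leq_pmull.
pose I l m' := [/\ heap m', m' (Negz 3) = (l %/ k.*2)%N,
  m' (Negz 4) = (l %% k.*2)%N, 
  (forall l', l' < l -> m' (E + l')%N = letter (corner k) k l') &
  (forall x, x != 3 -> x != 4 -> m' (Negz x) = m (Negz x))].
apply: wp_seq; apply: (wp_assign O B0 Bm (v := 0%R)) => // m1 Bm1 p1 r1.
apply: wp_seq; apply: (wp_assign O B0 Bm1 (v := 0%R)) => // m2 Bm2 p2 r2.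
apply: (@wp_conseq _ _ _ (I (k * k.*2))).
  by move=> m' Bm' [h1 h2 h3 h4 h5]; apply: HQ.
apply: wp_while => //; first lia.
- move=> l m' lk Bm' [Hm' m'3 m'4 m'E m'r].
  have m'2 : m' (Negz 2) = k by rewrite m'r.
  have k0 : 0 < k.*2 by case: (k) lk.
  have i0 : l %/ k.*2 < k by rewrite ltn_divLR.
  have j0 : l %% k.*2 < k.*2 by rewrite ltn_mod.
  split; first by rewrite /= m'2 m'3; lia.
  have [lE lt] := letter_corner kn lk.
  apply: wp_seq.
  apply: (wp_put O B0 Bm' (a := E + l) (v := letter (corner k) k l)) => //.
  + rewrite [LHS]/= -[X in (X + _)%R]/(aeval m' e_entries) (aeval_entries Hm').
    rewrite m'2 m'3 m'4 {3}(divn_eq l k.*2); lia.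
  + rewrite lE -(heap_input Hm' lt) /=; congr m'.
    rewrite (heap_s Hm') (heap_t Hm') (heap_b Hm') (heap_n Hm') m'2 m'3 m'4.
    have -> : (n%:Z - k%:Z)%R = (n - k)%N by lia.
    by rewrite -!muln2; lia.
  + by rewrite lE; exact: Bg.
  move=> m3 Bm3 p3 r3.
  have H3 : heap m3.
    apply: (heap_ext _ (r3 0) (r3 1) Hm') => x xE _ _.
    by rewrite p3 ltn_eqF//; lia.
  apply: wp_seq.
  apply: (wp_assign O B0 Bm3 (v := (l %% k.*2).+1)) => //.
  + by rewrite /= r3 m'4; lia.
  + by apply: bits_nat; lia.
  move=> m4 Bm4 p4 r4.
  have H4 : heap m4 by apply: (heap_ext_all p4 _ _ H3); rewrite r4.
  have m4E l' : l' < l.+1 -> m4 (E + l')%N = letter (corner k) k l'.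
    rewrite ltnS leq_eqVlt p4 p3 => /orP[/eqP ->|ll]; first by rewrite eqxx.
    by rewrite eqn_add2l ltn_eqF// m'E.
  have ld : l = (l %/ k.*2) * k.*2 + l %% k.*2 by exact: divn_eq.
  apply: wp_if => //.
    rewrite /= !r4 !r3 /= m'2 => lt1.
    apply: (wp_assign O B0 Bm4 (v := (l %% k.*2).+1)) => //.
    + by rewrite /= r4.
    + by apply: bits_nat; lia.
    move=> m5 Bm5 p5 r5; have j1 : (l %% k.*2).+1 < k.*2 by lia.
    have lS : l.+1 = (l %/ k.*2) * k.*2 + (l %% k.*2).+1 by lia.
    split.
    + by apply: (heap_ext_all p5 _ _ H4); rewrite r5.
    + by rewrite r5 /= r4 /= r3 m'3 lS divnMDl// (divn_small j1) addn0.
    + by rewrite r5 /= lS modnMDl (modn_small j1).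
    + by move=> l' ll; rewrite p5 m4E.
    + by move=> x x3 x4; rewrite r5 r4 (negbTE x4) r3 m'r.
  rewrite /= !r4 !r3 /= m'2 => lt1.
  have j1 : (l %% k.*2).+1 = k.*2 by lia.
  have lS : l.+1 = (l %/ k.*2).+1 * k.*2 by rewrite mulSn; lia.
  apply: wp_seq; apply: (wp_assign O B0 Bm4 (v := (l %/ k.*2).+1)) => //.
  + by rewrite /= r4 /= r3 m'3; lia.
  + by apply: bits_nat; lia.
  move=> m5 Bm5 p5 r5; apply: (wp_assign O B0 Bm5 (v := 0%R)) => // m6 Bm6 p6 r6.
  split.
  + apply: (heap_ext_all _ _ _ H4); rewrite ?r6 ?r5//.
    by move=> x; rewrite p6 p5.
  + by rewrite r6 /= r5 /= lS mulnK.
  + by rewrite r6 /= lS modnMl.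
  + by move=> l' ll; rewrite p6 p5 m4E.
  + by move=> x x3 x4; rewrite r6 (negbTE x4) r5 (negbTE x3) r4 (negbTE x4) r3 m'r.
- move=> m' Bm' [Hm' m'3 _ _ m'r]; rewrite /= m'3 m'r// mk.
  case: (posnP k) => [->//|k0]; rewrite mulnK ?double_gt0//; lia.
- split => //.
  + apply: (heap_ext_all _ _ _ Hm); rewrite ?r2 ?r1//.
    by move=> x; rewrite p2 p1.
  + by rewrite r2 /= r1 /= div0n.
  + by rewrite r2 /= mod0n.
  + by move=> x x3 x4; rewrite r2 (negbTE x4) r1 (negbTE x3).
Qed.

(** [h] is arbitrary because the corner may have been flipped since the block was copied. Three
    letters of the answer are described, as many as the programs read. *)
Lemma wp_ask k h m (Q : memory -> Prop) : k <= n -> heap m -> bits_mem B m ->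
  m (Negz 2) = k -> (forall l, l < k * k.*2 -> m (E + l)%N = letter h k l) ->
  wsize (word k s' t' b h) <= B -> wsize (O (word k s' t' b h)) <= B ->
  (forall m', bits_mem B m' -> heap m' ->
    (forall l, l < k * k.*2 -> m' (E + l)%N = m (E + l)%N) ->
    (forall j, j < 3 -> m' (D + j.+1)%N = ((O (word k s' t' b h))`_j)%R) ->
    (forall x, m' (Negz x) = m (Negz x)) -> Q m') ->
  wp O B ask Q m.
Proof.
move=> kn Hm Bm mk mE wB OB HQ.
have kkB : k * k.*2 <= n * n.*2 by rewrite leq_mul// leq_double.
have DE : E + n * n.*2 = D by [].
have LE : L + 5 + (s' + t' + b) = E by [].
have nB : n.*2 <= n * n.*2 by case: (n) => // n0; rewrite leq_pmull.
have fix_heap (m1 m2 : memory) : heap m1 ->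
    (forall x : nat, x < E -> x != L -> x != L.+1 -> m2 x = m1 x) ->
    (forall x, m2 (Negz x) = m1 (Negz x)) -> heap m2.
  by move=> H1 p r; apply: (heap_ext p _ _ H1).
apply: wp_seq; apply: (wp_put O B0 Bm (a := L) (v := (4 + (s' + t' + b) + k * k.*2)%N)) => //.
- exact: aeval_query.
- by rewrite /= (heap_rs Hm) (heap_rt Hm) (heap_b Hm) mk -!muln2; lia.
- by apply: bits_nat; lia.
move=> m1 Bm1 p1 r1.
have H1 : heap m1.
  by apply: fix_heap Hm _ r1 => x xE xL xL1; rewrite p1 (negbTE xL).
apply: wp_seq; apply: (wp_put O B0 Bm1 (a := L.+1) (v := k%:Z)) => //.
- by rewrite [LHS]/= -[X in (X + _)%R]/(aeval m1 e_query) (aeval_query H1); lia.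
- by rewrite /= r1 mk.
- by apply: bits_nat; lia.
move=> m2 Bm2 p2 r2.
have H2 : heap m2.
  by apply: fix_heap H1 _ r2 => x xE xL xL1; rewrite p2 (negbTE xL1).
have zero c mm : heap mm -> bits_mem B mm -> (0 < c <= 3)%N ->
    forall QQ : memory -> Prop,
    (forall m', bits_mem B m' -> heap m' ->
      (forall x : nat, m' x = if x == D + c then 0%R else mm x) ->
      (forall x, m' (Negz x) = mm (Negz x)) -> QQ m') ->
    wp O B (Store (Add e_answer (lit c)) (lit 0)) QQ mm.
  move=> Hmm Bmm c3 QQ HQQ.
  apply: (wp_put O B0 Bmm (a := D + c) (v := 0%R)) => //.
    by rewrite [LHS]/= -[X in (X + _)%R]/(aeval mm e_answer) (aeval_answer Hmm); lia.
  move=> m' Bm' p' r'; apply: HQQ => //.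
  apply: fix_heap Hmm _ r' => x xE xL xL1; rewrite p' ltn_eqF//; lia.
apply: wp_seq; apply: (zero) => // m3 Bm3 H3 p3 r3.
apply: wp_seq; apply: (zero) => // m4 Bm4 H4 p4 r4.
apply: wp_seq; apply: (zero) => // m5 Bm5 H5 p5 r5.
have p52 x : x < D.+1 -> m5 x = m2 x.
  by move=> xD; rewrite p5 p4 p3 !ltn_eqF//; lia.
have p5D j : j < 3 -> m5 (D + j.+1)%N = 0%R.
  by case: j => [|[|[|//]]] _; rewrite p5 p4 p3 !eqn_add2l.
have rdE : read_word m5 L = word k s' t' b h.
  have m5L : m5 L = (4 + (s' + t' + b) + k * k.*2)%N.
    by rewrite p52 ?p2 ?p1 ?eqxx ?ltn_eqF//; lia.
  apply: (@eq_from_nth _ 0%R).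
    by rewrite size_map size_iota m5L size_word.
  rewrite size_map size_iota m5L /= => j jl.
  rewrite (nth_map 0) ?size_iota ?m5L// nth_iota ?m5L// add0n.
  have -> : (L%:Z + j.+1%:Z)%R = (L + j.+1)%N by lia.
  have [j4|j4] := ltnP j 4.
    have [c0 c1 c2 c3] := word_header k s' t' b h.
    case: j j4 jl => [|[|[|[|//]]]] _ _; rewrite p52; try lia.
    + by rewrite c0 p2 addn1 eqxx.
    + by rewrite c1 (heap_qs H2).
    + by rewrite c2 (heap_qt H2).
    + by rewrite c3 (heap_qb H2).
  have [jz|jz] := ltnP j (4 + (s' + t' + b)).
    have -> : j = 4 + (j - 4) by lia.
    rewrite nth_word_zeros; last by lia.
    rewrite p52; last by lia.
    by apply: (heap_zeros H2); lia.
  have -> : j = 4 + (s' + t' + b) + (j - (4 + (s' + t' + b))) by lia.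
  have jk : j - (4 + (s' + t' + b)) < k * k.*2 by lia.
  rewrite nth_word_entries// -mE//.
  rewrite p52; last by lia.
  rewrite p2 p1 !gtn_eqF; try lia.
  by congr (m (Posz _)); lia.
apply: wp_query => //.
- by rewrite (aeval_query H5) rdE.
- by rewrite (aeval_query H5) rdE.
rewrite (aeval_query H5) (aeval_answer H5) rdE.
set m6 := write_word _ _ _ => Bm6.
have m6lt x : x < D -> m6 x = m5 x.
  by move=> xD; rewrite /m6 /write_word ifF//; apply/negbTE; lia.
have m6r x : m6 (Negz x) = m5 (Negz x).
  by rewrite /m6 /write_word; have -> : (D%:Z <= Negz x)%R = false by lia.
apply: HQ => //.
- by apply: fix_heap H5 _ m6r => x xE _ _; apply: m6lt; lia.
- move=> l lk; rewrite m6lt; last by lia.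
  by rewrite p52 ?p2 ?p1 ?gtn_eqF//; lia.
- move=> j j3; rewrite /m6 /write_word.
  have [jo|jo] := ltnP j (size (O (word k s' t' b h))).
    rewrite ifT; last by lia.
    by have -> : (`|(D + j.+1)%N%:Z - D%:Z|)%N = j.+1 by lia.
  rewrite ifF; last by apply/negbTE; lia.
  by rewrite p5D// nth_default.
- by move=> x; rewrite m6r r5 r4 r3 r2 r1.
Qed.

Lemma wp_fetch i k h m (Q : memory -> Prop) : 1 < i -> k <= n -> heap m -> bits_mem B m ->
  m (Negz 2) = k -> (forall l, l < k * k.*2 -> m (E + l)%N = letter h k l) ->
  wsize (word k s' t' b h) <= B -> wsize (O (word k s' t' b h)) <= B ->
  (forall m', bits_mem B m' -> heap m' ->
    (forall l, l < k * k.*2 -> m' (E + l)%N = m (E + l)%N) ->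
    (forall x, m' (Negz x) = if x == i.+1 then ((O (word k s' t' b h))`_1)%R
       else if x == i then ((O (word k s' t' b h))`_0)%R else m (Negz x)) -> Q m') ->
  wp O B (fetch i) Q m.
Proof.
move=> i1 kn Hm Bm mk mE wB OB HQ.
apply: wp_seq; apply: (wp_ask kn Hm Bm mk mE wB OB) => m1 Bm1 H1 m1E m1D r1.
have ansB j : bits B ((O (word k s' t' b h))`_j)%R by exact: bitsW OB (wsize_nth _ _).
have addrE c mm : heap mm -> aeval mm (Add e_answer (lit c)) = (D + c)%N.
  by move=> Hmm; rewrite [LHS]/= -[X in (X + _)%R]/(aeval mm e_answer) (aeval_answer Hmm); lia.
apply: wp_seq; apply: (wp_assign O B0 Bm1 (v := ((O (word k s' t' b h))`_0)%R)) => //.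
  by rewrite [LHS]/= -[X in m1 X]/(aeval m1 (Add e_answer (lit 1))) (addrE 1 _ H1) m1D.
move=> m2 Bm2 p2 r2.
have H2 : heap m2.
  by apply: (heap_ext_all p2 _ _ H1); rewrite r2 ltn_eqF//; lia.
apply: (wp_assign O B0 Bm2 (v := ((O (word k s' t' b h))`_1)%R)) => //.
  by rewrite [LHS]/= -[X in m2 X]/(aeval m2 (Add e_answer (lit 2))) (addrE 2 _ H2) p2 m1D.
move=> m3 Bm3 p3 r3; apply: HQ => //.
- by apply: (heap_ext_all p3 _ _ H2); rewrite r3 ltn_eqF//; lia.
- by move=> l lk; rewrite p3 p2 m1E.
- by move=> x; rewrite r3 r2 r1.
Qed.

End Calls.

Definition setup (es et : aexpr) : cmd :=
  Seq (assign 0 es) (Seq (assign 1 et)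
 (Seq (Store (Add e_query (lit 2)) (reg 0))
 (Seq (Store (Add e_query (lit 3)) (reg 1))
      (Store (Add e_query (lit 4)) (input_reg 4))))).

(** Results are saved in variables before any output is written: the address [e_answer] is computed
    from input cells that the output overwrites. *)
Definition square_modulus_program (es et : aexpr) : cmd :=
  Seq (setup es et) (Seq (assign 2 (input_reg 1)) (Seq copy (Seq ask
 (Seq (assign 5 (Add (Mul (Reg (Add e_answer (lit 1))) (Reg (Add e_answer (lit 1))))
                  (Mul (Reg (Add e_answer (lit 2))) (Reg (Add e_answer (lit 2))))))
 (Seq (assign 6 (Mul (Reg (Add e_answer (lit 3))) (Reg (Add e_answer (lit 3)))))
 (Seq (Store (lit 1) (reg 5)) (Seq (Store (lit 2) (reg 6))
      (Store (lit 0) (lit 2))))))))).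

Definition e_re : aexpr := Reg e_entries.
Definition e_im : aexpr := Reg (Add e_entries (lit 1)).

(** [Negz 0] is -1. The map [x -> -1 - x] is an involution, so the same command undoes the flip. *)
Definition flip_re : cmd := Store e_entries (Defs.Sub (Const (Negz 0)) e_re).
Definition flip_im : cmd :=
  Store (Add e_entries (lit 1)) (Defs.Sub (Const (Negz 0)) e_im).

Definition e_common : aexpr :=
  Mul (lit 4) (Mul (Mul e_re e_im) (Mul (Mul (reg 11) (reg 13)) (Mul (reg 15) (reg 8)))).

Definition e_scale (e : aexpr) : aexpr := Mul e (Mul (Mul (reg 16) (reg 16)) (reg 9)).

(** [reg 19] delays the update of [reg 5], whose old value the imaginary part still needs; [reg 8]
    and [reg 9] change last, being read by [e_common] and [e_scale]. *)
Definition combine : cmd :=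
  Seq (assign 17 (Add (Mul e_re e_common)
    (Mul (e_scale (Defs.Sub (Mul (reg 10) (reg 13)) (Mul (reg 12) (reg 11)))) (Mul e_im (reg 15)))))
 (Seq (assign 18 (Add (Mul e_im e_common)
    (Mul (e_scale (Defs.Sub (Mul (reg 10) (reg 15)) (Mul (reg 14) (reg 11)))) (Mul e_re (reg 13)))))
 (Seq (assign 7 (Mul (reg 7) (Mul (reg 16) e_common)))
 (Seq (assign 19 (Defs.Sub (Mul (reg 5) (reg 17)) (Mul (reg 6) (reg 18))))
 (Seq (assign 6 (Add (Mul (reg 5) (reg 18)) (Mul (reg 6) (reg 17))))
 (Seq (assign 5 (reg 19)) (Seq (assign 8 (reg 10)) (assign 9 (reg 11)))))))).

(** Both flips are undone before [combine], which reads the original corner entry from the query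
    area. *)
Definition level : cmd :=
  Seq (assign 2 (Add (reg 2) (lit 1))) (Seq copy (Seq (fetch 10)
 (Seq flip_re (Seq (fetch 12) (Seq flip_re (Seq flip_im (Seq (fetch 14)
 (Seq flip_im combine)))))))).

Definition power2 : cmd :=
  Seq (assign 16 (lit 1)) (Seq (assign 3 (input_reg 4))
    (While (reg 3) (Seq (assign 16 (Mul (lit 2) (reg 16)))
                       (assign 3 (Defs.Sub (reg 3) (lit 1)))))).

Definition permanent_program (es et : aexpr) : cmd :=
  Seq (setup es et) (Seq power2 (Seq (assign 2 (lit 0)) (Seq (assign 5 (lit 1)) (Seq (assign 6 (lit 0))
 (Seq (assign 7 (lit 1)) (Seq (assign 8 (lit 1)) (Seq (assign 9 (lit 1))
 (Seq (While (Defs.Sub (input_reg 1) (reg 2)) level)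
 (Seq (Store (lit 1) (reg 5)) (Seq (Store (lit 2) (reg 6)) (Seq (Store (lit 3) (reg 7))
      (Store (lit 0) (lit 3))))))))))))).

(* The current product of ratios, as a numerator (real and imaginary parts) and
   a denominator, followed by the last estimate of a squared modulus. *)
Record progress := Progress {
  num_re : int; num_im : int; den : int; last_num : int; last_den : int }.

(* [floor (- y) = -1 - floor y] unless [y] is an integer. *)
Definition flip_word (f : nat) (z : int * int) : int * int :=
  match f with
  | 0 => z
  | 1 => ((-1 - z.1)%R, z.2)
  | _ => (z.1, (-1 - z.2)%R)
  end.

Section GaussianRatio.
Local Open Scope int_scope.
Local Open Scope ring_scope.
Variables (S : int) (z : int * int) (w w1 w2 : seq int) (p0 q0 : int).

(* With [a = z.1 / S], [c = z.2 / S], [N], [N1], [N2] the values of the answers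
   [w], [w1], [w2] and [N0 = p0 / q0], these are the numerator and denominator of
   [(a + (N - N1) / (4 a N0)) + i (c + (N - N2) / (4 c N0))]. *)
Definition ratio_common : int :=
  4 * ((z.1 * z.2) * ((w`_1 * w1`_1) * (w2`_1 * p0))).
Definition ratio_re : int :=
  z.1 * ratio_common +
  (w`_0 * w1`_1 - w1`_0 * w`_1) * (S * S * q0) * (z.2 * w2`_1).
Definition ratio_im : int :=
  z.2 * ratio_common +
  (w`_0 * w2`_1 - w2`_0 * w`_1) * (S * S * q0) * (z.1 * w1`_1).
Definition ratio_den : int := S * ratio_common.

End GaussianRatio.

Definition advance (S : int) (z : int * int) (w w1 w2 : seq int) (st : progress) :
    progress :=
  let nr := ratio_re S z w w1 w2 (last_num st) (last_den st) in
  let ni := ratio_im S z w w1 w2 (last_num st) (last_den st) in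
  let nd := ratio_den S z w w1 w2 (last_num st) in
  Progress (num_re st * nr - num_im st * ni)%R (num_re st * ni + num_im st * nr)%R
    (den st * nd)%R (w`_0)%R (w`_1)%R.

Section Bits.
Local Open Scope nat_scope.

Lemma bitsD_max B x y : bits B x -> bits B y -> bits B.+1 (x + y)%R.
Proof. by rewrite /bits expnS mul2n -addnn; lia. Qed.

Lemma bitsB_max B x y : bits B x -> bits B y -> bits B.+1 (x - y)%R.
Proof. by move=> Bx By; apply: bitsD_max => //; exact: bitsN. Qed.

(** Lengths add under products, so a ratio has linearly many bits in [U]; the coefficient 9 is
    generous. *)
Lemma bits_ratio U S z w w1 w2 p0 q0 :
  bits U S -> bits U z.1 -> bits U z.2 -> (forall j, bits U (w`_j)%R) ->
  (forall j, bits U (w1`_j)%R) -> (forall j, bits U (w2`_j)%R) ->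
  bits U p0 -> bits U q0 ->
  [/\ bits (9 * U + 3) (ratio_re S z w w1 w2 p0 q0),
      bits (9 * U + 3) (ratio_im S z w w1 w2 p0 q0) &
      bits (9 * U + 3) (ratio_den S z w w1 w2 p0)].
Proof.
move=> BS Bz1 Bz2 Bw Bw1 Bw2 Bp0 Bq0.
have Bc : bits (6 * U + 2) (ratio_common z w w1 w2 p0).
  have B4 : bits 2 4%R by [].
  apply: bitsW (bitsM B4 (bitsM (bitsM Bz1 Bz2)
    (bitsM (bitsM (Bw 1) (Bw1 1)) (bitsM (Bw2 1) Bp0)))).
  lia.
have Bd x y x' y' u v : bits U x -> bits U y -> bits U x' -> bits U y' ->
    bits U u -> bits U v ->
    bits (9 * U + 2) ((x * y - x' * y') * (S * S * q0) * (u * v))%R.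
  move=> *; apply: bitsW (bitsM (bitsM (bitsB_max (bitsM _ _) (bitsM _ _))
    (bitsM (bitsM BS BS) Bq0)) (bitsM _ _)); try eassumption; lia.
split.
- rewrite [9 * U + 3]addnS; apply: bitsD_max; last exact: Bd.
  by apply: bitsW (bitsM Bz1 Bc); lia.
- rewrite [9 * U + 3]addnS; apply: bitsD_max; last exact: Bd.
  by apply: bitsW (bitsM Bz2 Bc); lia.
- by apply: bitsW (bitsM BS Bc); lia.
Qed.

End Bits.

(** * Verification of the two programs *)

Section Programs.
Variables (O : seq int -> seq int) (B U n s t b s' t' : nat).
Variable g : nat -> nat -> int * int.
Variables (es et : aexpr).
Local Open Scope nat_scope.
Local Notation E := (entries_addr n s t b s' t').
Local Notation D := (answer_addr n s t b s' t').
Local Notation L := (query_addr n s t b).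
Local Notation heap := (heap n s t b s' t' g).
Local Notation corner := (corner n g).
Local Notation w := (word n s t b g).

Definition flipped (k f i j : nat) : int * int :=
  if (i == 0) && (j == 0) then flip_word f (corner k i j) else corner k i j.

Definition query (k f : nat) : seq int := word k s' t' b (flipped k f).

Fixpoint progress_at (k : nat) : progress :=
  if k is k'.+1 then
    advance (2 ^ b)%:Z (corner k 0 0) (O (query k 0)) (O (query k 1)) (O (query k 2))
      (progress_at k')
  else Progress 1 0 1 1 1.

Lemma letter_flipped k f l : l < k * k.*2 -> letter (flipped k f) k l =
  if l == 0 then (flip_word f (corner k 0 0)).1
  else if l == 1 then (flip_word f (corner k 0 0)).2 else letter (corner k) k l.
Proof.
move=> lk; have k0 : 0 < k by case: k lk.
have k2 : 1 < k.*2 by lia.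
case: l lk => [|[|l]] lk; rewrite /letter /flipped.
- by rewrite div0n mod0n.
- by rewrite divn_small// modn_small.
have -> // : (l.+2 %/ k.*2 == 0) && ((l.+2 %% k.*2)./2 == 0) = false.
apply/negbTE/negP => /andP[/eqP d0 /eqP m0].
have := divn_eq l.+2 k.*2; rewrite d0; lia.
Qed.

(** [U] bounds the lengths of input and answers, [B] those of all register contents. [UB] leaves
    room for [n] levels, each adding [9 U + 4] bits to the product of the ratios. *)
Hypothesis DB : D + 10 <= B.
Hypothesis UB : (n.+2) * (9 * U + 5) <= B.
Hypothesis wU : wsize w <= U.
Hypothesis bU : b < U.
Hypothesis qB : forall k f, k <= n -> wsize (query k f) <= B.
Hypothesis OU : forall k f, k <= n -> wsize (O (query k f)) <= U.
Hypothesis esE : forall m : memory, m 1%N = n -> m 2%N = s -> m 3%N = t ->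
  aeval m es = s'.
Hypothesis etE : forall m : memory, m 1%N = n -> m 2%N = s -> m 3%N = t ->
  aeval m et = t'.

Let B0 : 0 < B. Proof. lia. Qed.
Let U_B : U <= B. Proof. by apply: leq_trans UB; rewrite mulSn; lia. Qed.
Let U2_B : 2 * (9 * U + 5) <= B.
Proof. by apply: leq_trans UB; exact: leq_mul. Qed.
Let OB k f : k <= n -> wsize (O (query k f)) <= B.
Proof. by move=> kn; apply: leq_trans U_B; exact: OU. Qed.
Let nB : n.*2 <= n * n.*2.
Proof. by case: (n) => // n0; rewrite leq_pmull. Qed.
Let DE : E + n * n.*2 = D. Proof. by []. Qed.
Let EL : L + 5 + (s' + t' + b) = E. Proof. by []. Qed.

Let input : memory := write_word (fun=> 0%R) 0 w.

Lemma input_lt x : x < L -> input x = (((size w)%:Z :: w)`_x)%R.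
Proof.
move=> xL; rewrite /input /write_word ifT; first by rewrite subr0.
by rewrite size_word; move: xL; rewrite /query_addr; lia.
Qed.

Lemma input_ge (x : nat) : L <= x -> input x = 0%R.
Proof.
move=> xL; rewrite /input /write_word ifF//.
by apply/negbTE; rewrite size_word; move: xL; rewrite /query_addr; lia.
Qed.

Lemma input_neg x : input (Negz x) = 0%R.
Proof. by rewrite /input /write_word; have -> : (0 <= Negz x)%R = false by lia. Qed.

Lemma bits_input : bits_mem B input.
Proof.
move=> x; rewrite /input /write_word; case: ifP => // _.
case: `|_|%N => [|j] /=.
  by apply: bits_nat; apply: leq_trans (size_wsize _) (leq_trans wU U_B).
by apply: bitsW (wsize_nth _ _); exact: leq_trans wU U_B.
Qed.

Lemma wp_assignup (Q : memory -> Prop) :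
  (forall m, bits_mem B m -> heap m ->
    (forall x, 1 < x -> m (Negz x) = 0%R) -> Q m) ->
  wp O B (setup es et) Q input.
Proof.
move=> HQ.
have L5 : 4 < L by rewrite /query_addr; lia.
have [in1 in2 in3 in4] : [/\ input 1%N = n, input 2%N = s, input 3%N = t & input 4%N = b].
  by split; rewrite input_lt//; lia.
have in0 : input 0%N = (4 + (s + t + b) + n * n.*2)%N.
  by rewrite input_lt ?size_word//; lia.
apply: wp_seq; apply: (wp_assign O B0 bits_input (v := s')); first exact: esE.
  by apply: bits_nat; lia.
move=> m1 Bm1 p1 r1.
apply: wp_seq; apply: (wp_assign O B0 Bm1 (v := t')).
- by apply: etE; rewrite p1.
- by apply: bits_nat; lia.
move=> m2 Bm2 p2 r2.
have qE (m : memory) c : m 0%N = input 0%N -> aeval m (Add e_query (lit c)) = (L + c)%N.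
  by move=> /= ->; rewrite in0 /query_addr; lia.
apply: wp_seq; apply: (wp_put O B0 Bm2 (a := L + 2) (v := s')).
- by apply: qE; rewrite p2 p1.
- by rewrite /= r2 /= r1.
- by apply: bits_nat; lia.
move=> m3 Bm3 p3 r3.
have ne c : 0 == L + c = false by lia.
apply: wp_seq; apply: (wp_put O B0 Bm3 (a := L + 3) (v := t')).
- by apply: qE; rewrite p3 ne p2 p1.
- by rewrite /= r3 r2.
- by apply: bits_nat; lia.
move=> m4 Bm4 p4 r4.
apply: (wp_put O B0 Bm4 (a := L + 4) (v := b)).
- by apply: qE; rewrite p4 ne p3 ne p2 p1.
- by rewrite /= p4 p3 !ltn_eqF ?p2 ?p1 ?in4//; lia.
- by apply: bits_nat; lia.
move=> m5 Bm5 p5 r5.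
have lt x : x < L -> m5 x = input x.
  by move=> xL; rewrite p5 p4 p3 !ltn_eqF ?p2 ?p1//; lia.
apply: HQ => //; last first.
  by move=> x x1; rewrite r5 r4 r3 r2 r1 !gtn_eqF ?input_neg//; lia.
constructor; rewrite ?r5 ?r4 ?r3 ?r2 ?r1 //=; try by rewrite lt//; lia.
- move=> l ln; rewrite lt; last by rewrite /query_addr; lia.
  rewrite input_lt; last by rewrite /query_addr; lia.
  by rewrite -(nth_word_entries s t b g ln).
- by rewrite p5 p4 p3 !eqn_add2l.
- by rewrite p5 p4 !eqn_add2l.
- by rewrite p5 eqxx.
- move=> x xE; rewrite p5 p4 p3 !gtn_eqF ?p2 ?p1 ?input_ge//; lia.
Qed.

Let bits_g l : l < n * n.*2 -> bits B (letter g n l).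
Proof.
by move=> ln; apply: bitsW (bits_letter s t b g ln); exact: leq_trans wU U_B.
Qed.

Lemma bits_corner k : 0 < k <= n -> bits U (corner k 0 0).1 /\ bits U (corner k 0 0).2.
Proof.
move=> /andP[k0 kn].
have i : n - k + 0 < n by lia.
have [h1 h2] := bits_word_entry s t b g i i.
by split; [exact: bitsW h1|exact: bitsW h2].
Qed.

Lemma bits_answer k f j : k <= n -> bits U ((O (query k f))`_j)%R.
Proof. by move=> kn; apply: bitsW (wsize_nth _ _); exact: OU. Qed.

Lemma bits_pow2 : bits U (2 ^ b)%:Z.
Proof. by rewrite /bits /= leq_exp2l// ltnW. Qed.

(** A product with a ratio adds [9 U + 3] bits, and the sum inside a complex product one more;
    growth over the levels is therefore linear. *)
Lemma bits_progress k : k <= n ->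
  [/\ bits (k * (9 * U + 4)) (num_re (progress_at k)),
      bits (k * (9 * U + 4)) (num_im (progress_at k)),
      bits (k * (9 * U + 4)) (den (progress_at k)),
      bits U (last_num (progress_at k)) & bits U (last_den (progress_at k))].
Proof.
elim: k => [_|k IHk kn]; first by split => //=; rewrite /bits /= expn_gt0.
have [h1 h2 h3 h4 h5] := IHk (ltnW kn).
have [c1 c2] := bits_corner (k := k.+1) ltac:(lia).
have [r1 r2 r3] := bits_ratio bits_pow2 c1 c2 (fun j => bits_answer 0 j kn)
  (fun j => bits_answer 1 j kn) (fun j => bits_answer 2 j kn) h4 h5.
have kE : k.+1 * (9 * U + 4) = (k * (9 * U + 4) + (9 * U + 3)).+1.
  by rewrite mulSn; lia.
split; [| | |exact: bits_answer|exact: bits_answer]; rewrite kE.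
- by apply: bitsB_max; exact: bitsM.
- by apply: bitsD_max; exact: bitsM.
- by apply: bitsW (leqnSn _) _; exact: bitsM.
Qed.

Lemma wp_power2 m (Q : memory -> Prop) : heap m -> bits_mem B m ->
  (forall m', bits_mem B m' -> heap m' -> m' (Negz 16) = (2 ^ b)%:Z -> Q m') ->
  wp O B power2 Q m.
Proof.
move=> Hm Bm HQ.
pose I i m' := [/\ heap m', m' (Negz 16) = (2 ^ i)%:Z & m' (Negz 3) = (b - i)%N].
apply: wp_seq; apply: (wp_assign O B0 Bm (v := 1%R)) => //; first exact: bits_nat.
move=> m1 Bm1 p1 r1.
have H1 : heap m1 by apply: (heap_ext_all p1 _ _ Hm); rewrite r1.
apply: wp_seq; apply: (wp_assign O B0 Bm1 (v := b%:Z)).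
- exact: heap_b H1.
- by apply: bits_nat; lia.
move=> m2 Bm2 p2 r2.
have H2 : heap m2 by apply: (heap_ext_all p2 _ _ H1); rewrite r2.
apply: (@wp_conseq _ _ _ (I b)).
  by move=> m' Bm' [h1 h2 h3]; apply: HQ.
apply: wp_while => //; first lia.
- move=> i m' ib Bm' [H' m'16 m'3]; split; first by rewrite /= m'3; lia.
  apply: wp_seq; apply: (wp_assign O B0 Bm' (v := (2 ^ i.+1)%:Z)).
  + by rewrite /= m'16 expnS PoszM.
  + by rewrite /bits /= leq_exp2l//; lia.
  move=> m3 Bm3 p3 r3.
  have H3 : heap m3 by apply: (heap_ext_all p3 _ _ H'); rewrite r3.
  apply: (wp_assign O B0 Bm3 (v := (b - i.+1)%:Z)).
  + by rewrite /= r3 /= m'3; lia.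
  + by apply: bits_nat; lia.
  move=> m4 Bm4 p4 r4; split.
  + by apply: (heap_ext_all p4 _ _ H3); rewrite r4.
  + by rewrite r4 /= r3.
  + by rewrite r4.
- by move=> m' Bm' [_ _ m'3]; rewrite /= m'3 subnn.
- by split => //; rewrite r2 //= ?r1 ?subn0.
Qed.

(** [c] is 0 for the real and 1 for the imaginary part of the corner entry. Leaving [h] and [h']
    general covers both performing and undoing a flip. *)
Lemma wp_flip c k (h h' : nat -> nat -> int * int) m v (Q : memory -> Prop) :
  0 < k <= n -> c < 2 -> heap m -> bits_mem B m ->
  (forall l, l < k * k.*2 -> m (E + l)%N = letter h k l) ->
  (forall l, l < k * k.*2 -> letter h' k l = if l == c then v else letter h k l) ->
  (v = -1 - letter h k c)%R -> bits B v ->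
  (forall m', bits_mem B m' -> heap m' ->
    (forall l, l < k * k.*2 -> m' (E + l)%N = letter h' k l) ->
    (forall x, m' (Negz x) = m (Negz x)) -> Q m') ->
  wp O B (if c == 0 then flip_re else flip_im) Q m.
Proof.
move=> /andP[k0 kn] c2 Hm Bm mh hh' vE Bv HQ.
have ck : c < k * k.*2.
  by apply: leq_trans c2 _; case: (k) k0 => // k1 _; rewrite mulSn doubleS; lia.
have EcE : aeval m (if c == 0 then e_entries else Add e_entries (lit 1)) = (E + c)%N.
  case: c c2 {ck vE hh'} => [|[|//]] _; first by rewrite addn0; exact: (aeval_entries Hm).
  by rewrite [LHS]/= -[X in (X + _)%R]/(aeval m e_entries) (aeval_entries Hm); lia.
have -> : (if c == 0 then flip_re else flip_im) =
    Store (if c == 0 then e_entries else Add e_entries (lit 1))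
      (Defs.Sub (Const (Negz 0)) (Reg (if c == 0 then e_entries else Add e_entries (lit 1)))).
  by case: (c == 0).
apply: (wp_put O B0 Bm (a := E + c) (v := v)) => //.
  by rewrite [LHS]/= EcE mh// vE.
move=> m1 Bm1 p1 r1; apply: HQ => //.
- apply: (heap_ext _ (r1 0) (r1 1) Hm) => x xE _ _.
  by rewrite p1 ltn_eqF//; lia.
- by move=> l lk; rewrite p1 eqn_add2l hh'// mh.
Qed.

Definition at_level (k : nat) (m : memory) : Prop :=
  heap m /\ [/\ m (Negz 2) = k, m (Negz 16) = (2 ^ b)%:Z,
  m (Negz 5) = num_re (progress_at k) /\ m (Negz 6) = num_im (progress_at k),
  m (Negz 7) = den (progress_at k) &
  m (Negz 8) = last_num (progress_at k) /\ m (Negz 9) = last_den (progress_at k)].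

Lemma wp_combine k m : k < n -> heap m -> bits_mem B m ->
  m E = (corner k.+1 0 0).1 -> m (E + 1)%N = (corner k.+1 0 0).2 ->
  m (Negz 2) = k.+1 -> m (Negz 16) = (2 ^ b)%:Z ->
  m (Negz 5) = num_re (progress_at k) -> m (Negz 6) = num_im (progress_at k) ->
  m (Negz 7) = den (progress_at k) ->
  m (Negz 8) = last_num (progress_at k) -> m (Negz 9) = last_den (progress_at k) ->
  m (Negz 10) = ((O (query k.+1 0))`_0)%R -> m (Negz 11) = ((O (query k.+1 0))`_1)%R ->
  m (Negz 12) = ((O (query k.+1 1))`_0)%R -> m (Negz 13) = ((O (query k.+1 1))`_1)%R ->
  m (Negz 14) = ((O (query k.+1 2))`_0)%R -> m (Negz 15) = ((O (query k.+1 2))`_1)%R ->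
  wp O B combine (at_level k.+1) m.
Proof.
move=> kn Hm Bm mE mE1 m2 m16 m5 m6 m7 m8 m9 m10 m11 m12 m13 m14 m15.
have [b1 b2 b3 b4 b5] := bits_progress (ltnW kn).
have [c1 c2] := bits_corner (k := k.+1) ltac:(lia).
have [d1 d2 d3 d4 d5] := bits_progress kn.
have [r1 r2 r3] := bits_ratio bits_pow2 c1 c2 (fun j => bits_answer 0 j kn)
  (fun j => bits_answer 1 j kn) (fun j => bits_answer 2 j kn) b4 b5.
have kB : k.+1 * (9 * U + 4) <= B.
  by apply: leq_trans UB; apply: leq_mul; lia.
have rB : 9 * U + 3 <= B by lia.
have entry (mm : memory) : heap mm -> (forall x : nat, mm x = m x) ->
    aeval mm e_re = (corner k.+1 0 0).1 /\ aeval mm e_im = (corner k.+1 0 0).2.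
  move=> Hmm p; split.
    by rewrite [LHS]/= -[X in mm X]/(aeval mm e_entries) (aeval_entries Hmm) p.
  rewrite [LHS]/= -[X in mm (X + _)%R]/(aeval mm e_entries) (aeval_entries Hmm).
  by rewrite -PoszD p.
have [eR eI] := entry m Hm (fun=> erefl).
apply: wp_seq; apply: (wp_assign O B0 Bm (v := ratio_re (2 ^ b)%:Z (corner k.+1 0 0)
  (O (query k.+1 0)) (O (query k.+1 1)) (O (query k.+1 2))
  (last_num (progress_at k)) (last_den (progress_at k)))).
- move: eR eI; rewrite /= => -> ->.
  by rewrite m16 m8 m9 m10 m11 m12 m13 m15.
- exact: bitsW r1.
move=> v1 Bm1 p1 q1.
have H1 : heap v1 by apply: (heap_ext_all p1 _ _ Hm); rewrite q1.
have {eR eI}[eR eI] := entry v1 H1 p1.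
apply: wp_seq; apply: (wp_assign O B0 Bm1 (v := ratio_im (2 ^ b)%:Z (corner k.+1 0 0)
  (O (query k.+1 0)) (O (query k.+1 1)) (O (query k.+1 2))
  (last_num (progress_at k)) (last_den (progress_at k)))).
- move: eR eI; rewrite /= => -> ->.
  by rewrite !q1 /= m16 m8 m9 m10 m11 m13 m14 m15.
- exact: bitsW r2.
move=> v2 Bm2 p2 q2.
have H2 : heap v2 by apply: (heap_ext_all p2 _ _ H1); rewrite q2.
have p21 x : v2 (Posz x) = m x by rewrite p2 p1.
have {eR eI}[eR eI] := entry v2 H2 p21.
apply: wp_seq; apply: (wp_assign O B0 Bm2 (v := den (progress_at k.+1))).
- move: eR eI; rewrite /= => -> ->.
  by rewrite !(q2, q1) /= m16 m7 m8 m11 m13 m15.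
- exact: bitsW d3.
move=> v3 Bm3 p3 q3.
have H3 : heap v3 by apply: (heap_ext_all p3 _ _ H2); rewrite q3.
apply: wp_seq; apply: (wp_assign O B0 Bm3 (v := num_re (progress_at k.+1))).
- by rewrite /= !(q3, q2, q1) /= m5 m6.
- exact: bitsW d1.
move=> v4 Bm4 p4 q4.
have H4 : heap v4 by apply: (heap_ext_all p4 _ _ H3); rewrite q4.
apply: wp_seq; apply: (wp_assign O B0 Bm4 (v := num_im (progress_at k.+1))).
- by rewrite /= !(q4, q3, q2, q1) /= m5 m6.
- exact: bitsW d2.
move=> m5' Bm5 p5 q5.
have H5 : heap m5' by apply: (heap_ext_all p5 _ _ H4); rewrite q5.
apply: wp_seq; apply: (wp_assign O B0 Bm5 (v := num_re (progress_at k.+1))).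
- by rewrite /= !(q5, q4).
- exact: bitsW d1.
move=> m6' Bm6 p6 q6.
have H6 : heap m6' by apply: (heap_ext_all p6 _ _ H5); rewrite q6.
apply: wp_seq; apply: (wp_assign O B0 Bm6 (v := last_num (progress_at k.+1))).
- by rewrite /= !(q6, q5, q4, q3, q2, q1).
- by apply: bitsW d4.
move=> m7' Bm7 p7 q7.
have H7 : heap m7' by apply: (heap_ext_all p7 _ _ H6); rewrite q7.
apply: (wp_assign O B0 Bm7 (v := last_den (progress_at k.+1))).
- by rewrite /= !(q7, q6, q5, q4, q3, q2, q1).
- by apply: bitsW d5.
move=> m8' Bm8 p8 q8; split.
  by apply: (heap_ext_all p8 _ _ H7); rewrite q8.
by split; rewrite !(q8, q7, q6, q5, q4, q3, q2, q1).
Qed.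

Lemma wp_level k m : k < n -> bits_mem B m -> at_level k m ->
  wp O B level (at_level k.+1) m.
Proof.
move=> kn Bm [Hm [m2 m16 [m5 m6] m7 [m8 m9]]].
have knS : 0 < k.+1 <= n by [].
have [c1 c2] := bits_corner knS.
have negb x : bits U x -> bits B (-1 - x)%R.
  move=> Ux; apply: (@bitsW U.+1); first lia.
  by apply: bitsB_max => //; apply: (@bitsW 0).
have kk0 : 0 < k.+1 * k.+1.*2 by rewrite muln_gt0.
have kk1 : 1 < k.+1 * k.+1.*2 by rewrite mulSn doubleS; lia.
have flipK (x : int) : (x = -1 - (-1 - x))%R by lia.
have fl f l (h := flipped k.+1 f) : l < k.+1 * k.+1.*2 -> letter h k.+1 l = _ :=
  @letter_flipped k.+1 f l.
apply: wp_seq; apply: (wp_assign O B0 Bm (v := k.+1%:Z)).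
- by rewrite /= m2; lia.
- by apply: bits_nat; lia.
move=> u1 Bu1 p1 q1.
have H1 : heap u1 by apply: (heap_ext_all p1 _ _ Hm); rewrite q1.
apply: wp_seq; apply: (wp_copy O DB kn H1 Bu1 bits_g _ _); first by rewrite q1.
move=> u2 Bu2 H2 e2 q2.
have {}e2 l : l < k.+1 * k.+1.*2 -> u2 (E + l)%N = letter (flipped k.+1 0) k.+1 l.
  move=> lk; rewrite e2// fl//.
  by case: l lk => [|[|l]] lk //; rewrite /letter ?div0n ?mod0n// divn_small// modn_small.
have u22 : u2 (Negz 2) = k.+1 by rewrite q2// q1.
apply: wp_seq; apply: (wp_fetch (i := 10) DB erefl kn H2 Bu2 u22 e2 (qB 0 kn) (OB 0 kn)) => //.
move=> u3 Bu3 H3 e3 q3.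
have {}e3 l : l < k.+1 * k.+1.*2 -> u3 (E + l)%N = letter (flipped k.+1 0) k.+1 l.
  by move=> lk; rewrite e3// e2.
apply: wp_seq; apply: (@wp_flip 0 k.+1 _ (flipped k.+1 1) _
    (flip_word 1 (corner k.+1 0 0)).1 _ knS _ H3 Bu3 e3).
- by [].
- by move=> l lk; rewrite !fl//=; case: (l) => [|[|l']].
- by rewrite fl//=.
- exact: negb.
move=> u4 Bu4 H4 e4 q4.
have u42 : u4 (Negz 2) = k.+1 by rewrite q4 q3.
apply: wp_seq; apply: (wp_fetch (i := 12) DB erefl kn H4 Bu4 u42 e4 (qB 1 kn) (OB 1 kn)) => //.
move=> u5 Bu5 H5 e5 q5.
have {}e5 l : l < k.+1 * k.+1.*2 -> u5 (E + l)%N = letter (flipped k.+1 1) k.+1 l.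
  by move=> lk; rewrite e5// e4.
apply: wp_seq; apply: (@wp_flip 0 k.+1 _ (flipped k.+1 0) _
    (flip_word 0 (corner k.+1 0 0)).1 _ knS _ H5 Bu5 e5).
- by [].
- by move=> l lk; rewrite !fl//=; case: (l) => [|[|l']].
- by rewrite fl//=.
- exact: bitsW c1.
move=> u6 Bu6 H6 e6 q6.
apply: wp_seq; apply: (@wp_flip 1 k.+1 _ (flipped k.+1 2) _
    (flip_word 2 (corner k.+1 0 0)).2 _ knS _ H6 Bu6 e6).
- by [].
- by move=> l lk; rewrite !fl//=; case: (l) => [|[|l']].
- by rewrite fl//=.
- exact: negb.
move=> u7 Bu7 H7 e7 q7.
have u72 : u7 (Negz 2) = k.+1 by rewrite q7 q6 q5 q4 q3.
apply: wp_seq; apply: (wp_fetch (i := 14) DB erefl kn H7 Bu7 u72 e7 (qB 2 kn) (OB 2 kn)) => //.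
move=> u8 Bu8 H8 e8 q8.
have {}e8 l : l < k.+1 * k.+1.*2 -> u8 (E + l)%N = letter (flipped k.+1 2) k.+1 l.
  by move=> lk; rewrite e8// e7.
apply: wp_seq; apply: (@wp_flip 1 k.+1 _ (flipped k.+1 0) _
    (flip_word 0 (corner k.+1 0 0)).2 _ knS _ H8 Bu8 e8).
- by [].
- by move=> l lk; rewrite !fl//=; case: (l) => [|[|l']].
- by rewrite fl//=.
- exact: bitsW c2.
move=> u9 Bu9 H9 e9 q9.
have u9q x : u9 (Negz x) = u8 (Negz x) by exact: q9.
have qq x : x != 2 -> x != 3 -> x != 4 -> u2 (Negz x) = m (Negz x).
  by move=> x2 x3 x4; rewrite q2// q1 (negbTE x2).
apply: wp_combine => //; try by rewrite q9 q8 /= ?q7 ?q6 ?q5 /= ?q4 ?q3 /= ?u22 ?qq.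
- by rewrite -[E]addn0 e9// fl.
- by rewrite e9// fl.
Qed.

(** The term [5 * B.+1] pays for the charge on the output, which has at most four letters. *)
Lemma computes_output c (v : seq int) :
  (size v < 5)%N -> (forall j, bits B (v`_j)%R) ->
  wp O B c (fun m => read_word m 0 = v) input ->
  exists k, computes O c w v k /\ k <= cost_bound B c + 5 * B.+1.
Proof.
move=> v5 Bv [m [k [ex kB Bm mv]]].
exists (k + wsize v); split; first by exists m, k.
apply: leq_add => //; apply: leq_trans (wsize_leq (fun j _ => Bv j)) _.
by rewrite leq_mul2r ltnW ?orbT.
Qed.

Lemma square_modulus_computes :
  let a := O (query n 0) in
  exists k, computes O (square_modulus_program es et) w
    [:: (a`_0 * a`_0 + a`_1 * a`_1)%R; (a`_2 * a`_2)%R] k /\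
    k <= cost_bound B (square_modulus_program es et) + 5 * B.+1.
Proof.
move=> a.
have B1 : bits B (a`_0 * a`_0 + a`_1 * a`_1)%R.
  apply: (@bitsW (U + U).+1); first lia.
  by apply: bitsD_max; apply: bitsM; exact: bits_answer.
have B2 : bits B (a`_2 * a`_2)%R.
  apply: (@bitsW (U + U)); first lia.
  by apply: bitsM; exact: bits_answer.
apply: computes_output => //.
  by move=> [|[|j]] //=; rewrite nth_nil.
apply: wp_seq; apply: wp_assignup => m Bm Hm _.
apply: wp_seq; apply: (wp_assign O B0 Bm (v := n%:Z)).
- exact: heap_n Hm.
- by apply: bits_nat; lia.
move=> m1 Bm1 p1 q1.
have H1 : heap m1 by apply: (heap_ext_all p1 _ _ Hm); rewrite q1.
apply: wp_seq; apply: (wp_copy O DB (leqnn n) H1 Bm1 bits_g); first by rewrite q1.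
move=> m2 Bm2 H2 e2 q2.
have {}e2 l : l < n * n.*2 -> m2 (E + l)%N = letter (flipped n 0) n l.
  move=> lk; rewrite e2// letter_flipped//.
  have n2 : 1 < n.*2 by case: (n) lk => // ? _; rewrite doubleS.
  by case: l lk => [|[|l]] lk //; rewrite /letter ?div0n ?mod0n// divn_small// modn_small.
have m22 : m2 (Negz 2) = n by rewrite q2// q1.
apply: wp_seq; apply: (wp_ask DB (leqnn n) H2 Bm2 m22 e2 (qB 0 (leqnn n)) (OB 0 (leqnn n))).
move=> m3 Bm3 H3 e3 a3 q3.
have ad (mm : memory) c : heap mm -> aeval mm (Add e_answer (lit c)) = (D + c)%N.
  by move=> Hmm; rewrite [LHS]/= -[X in (X + _)%R]/(aeval mm e_answer) (aeval_answer Hmm); lia.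
have rd (mm : memory) c : heap mm -> (forall x : nat, mm x = m3 x) -> c < 3 ->
    aeval mm (Reg (Add e_answer (lit c.+1))) = (a`_c)%R.
  move=> Hmm pp c3; rewrite [LHS]/= -[X in mm X]/(aeval mm (Add e_answer (lit c.+1))).
  by rewrite ad// pp a3.
apply: wp_seq; apply: (wp_assign O B0 Bm3 (v := (a`_0 * a`_0 + a`_1 * a`_1)%R)) => //.
  by have := rd m3 0 H3 (fun=> erefl) erefl; have := rd m3 1 H3 (fun=> erefl) erefl;
     rewrite /= => -> ->.
move=> m4 Bm4 p4 q4.
have H4 : heap m4 by apply: (heap_ext_all p4 _ _ H3); rewrite q4.
apply: wp_seq; apply: (wp_assign O B0 Bm4 (v := (a`_2 * a`_2)%R)) => //.
  by have := rd m4 2 H4 p4 erefl; rewrite /= => ->.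
move=> m5 Bm5 p5 q5.
apply: wp_seq; apply: (wp_put O B0 Bm5 (a := 1) (v := (a`_0 * a`_0 + a`_1 * a`_1)%R)) => //.
  by rewrite /= q5 /= q4.
move=> m6 Bm6 p6 q6.
apply: wp_seq; apply: (wp_put O B0 Bm6 (a := 2) (v := (a`_2 * a`_2)%R)) => //.
  by rewrite /= q6 q5.
move=> m7 Bm7 p7 q7.
apply: (wp_put O B0 Bm7 (a := 0) (v := 2%:Z)) => //; first by apply: bits_nat; lia.
move=> m8 Bm8 p8 q8.
by rewrite /read_word (p8 0) /= !add0r (p8 1) (p8 2) /= (p7 1) (p7 2) /= (p6 1).
Qed.

Lemma permanent_computes :
  exists k, computes O (permanent_program es et) w
    [:: num_re (progress_at n); num_im (progress_at n); den (progress_at n)] k /\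
    k <= cost_bound B (permanent_program es et) + 5 * B.+1.
Proof.
have [b1 b2 b3 _ _] := bits_progress (leqnn n).
have nB' : n * (9 * U + 4) <= B by apply: leq_trans UB; apply: leq_mul; lia.
apply: computes_output => //.
  by move=> [|[|[|j]]] /=; rewrite ?nth_nil//; apply: bitsW nB' _.
apply: wp_seq; apply: wp_assignup => m Bm Hm m0.
apply: wp_seq; apply: wp_power2 => // m1 Bm1 H1 m116.
apply: wp_seq; apply: (wp_assign O B0 Bm1 (v := 0%R)) => // m2 Bm2 p2 q2.
apply: wp_seq; apply: (wp_assign O B0 Bm2 (v := 1%R)) => //; first exact: bits_nat.
move=> m3 Bm3 p3 q3.
apply: wp_seq; apply: (wp_assign O B0 Bm3 (v := 0%R)) => // m4 Bm4 p4 q4.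
apply: wp_seq; apply: (wp_assign O B0 Bm4 (v := 1%R)) => //; first exact: bits_nat.
move=> m5 Bm5 p5 q5.
apply: wp_seq; apply: (wp_assign O B0 Bm5 (v := 1%R)) => //; first exact: bits_nat.
move=> m6 Bm6 p6 q6.
apply: wp_seq; apply: (wp_assign O B0 Bm6 (v := 1%R)) => //; first exact: bits_nat.
move=> m7 Bm7 p7 q7.
have H7 : heap m7.
  apply: (heap_ext_all _ _ _ H1); rewrite ?(q7, q6, q5, q4, q3, q2)//.
  by move=> x; rewrite p7 p6 p5 p4 p3 p2.
have L7 : at_level 0 m7.
  by split => //; split; rewrite !(q7, q6, q5, q4, q3, q2).
apply: wp_seq; apply: (@wp_conseq _ _ _ (at_level n)); last first.
  apply: wp_while => //; first lia.
    move=> i m' iN Bm' Lm'; split; last exact: wp_level.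
    by case: Lm' => Hm' [m'2 *]; rewrite /= m'2 (heap_n Hm'); lia.
  by move=> m' Bm' [Hm' [m'2 *]]; rewrite /= m'2 (heap_n Hm') subrr.
move=> u Bu [Hu [u2 _ [u5 u6] u7 _]].
apply: wp_seq; apply: (wp_put O B0 Bu (a := 1) (v := num_re (progress_at n))) => //.
  exact: bitsW b1.
move=> u1 Bu1 r1 s1.
apply: wp_seq; apply: (wp_put O B0 Bu1 (a := 2) (v := num_im (progress_at n))) => //.
- by rewrite /= s1.
- exact: bitsW b2.
move=> u2' Bu2 r2 s2.
apply: wp_seq; apply: (wp_put O B0 Bu2 (a := 3) (v := den (progress_at n))) => //.
- by rewrite /= s2 s1.
- exact: bitsW b3.
move=> u3 Bu3 r3 s3.
apply: (wp_put O B0 Bu3 (a := 0) (v := 3%:Z)) => //; first by apply: bits_nat; lia.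
move=> u4 Bu4 r4 s4.
rewrite /read_word (r4 0) /= !add0r (r4 1) (r4 2) (r4 3) /=.
by rewrite (r3 1) (r3 2) (r3 3) /= (r2 1) (r2 2) /= (r1 1).
Qed.

End Programs.

(** * Polynomial running time *)

Section PolynomialTime.
Variables (R : realType) (O : seq int -> seq int).
Variable q : {poly nat}.
Local Open Scope nat_scope.
Hypothesis Oq : forall n s t b (X : 'M[R[i]]_n), 0 < s -> 0 < t ->
  wsize (O (encode s t b X)) <= q.[wsize (encode s t b X)]%R.

Lemma oracle_size n s t b g : 0 < s -> 0 < t ->
  wsize (O (word n s t b g)) <= q.[wsize (word n s t b g)]%R.
Proof. by have [X <-] := @wordE R n s t b g; exact: Oq. Qed.

(** A number of letters times a length per letter, with [W] the length of the input and [S] the sum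
    of the unary parameters of the query. *)
Definition query_size (W S : nat) : nat :=
  (5 * W + S + 4) * (4 * W + S + 3).

Lemma query_size_correct n s t b s' t' g k f :
  k <= n -> wsize (query n b s' t' g k f) <=
    query_size (wsize (word n s t b g)) (s' + t').
Proof.
set W := wsize (word n s t b g) => kn.
have W0 : 4 + (s + t + b) + n * n.*2 <= W by exact: leq_wsize_word.
have nn : n.*2 <= n * n.*2 by case: (n) => // n0; rewrite leq_pmull.
have kk : k * k.*2 <= n * n.*2 by rewrite leq_mul// leq_double.
apply: (@leq_trans ((4 + (s' + t' + b) + k * k.*2) * (4 * W + (s' + t') + 2).+1)); last first.
  by apply: leq_mul; lia.
rewrite -(size_word k s' t' b (flipped n g k f)); apply: wsize_leq.
rewrite size_word => j jl; rewrite /query.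
have [c0 c1 c2 c3] := word_header k s' t' b (flipped n g k f).
have [j4|j4] := ltnP j 4.
  case: j j4 {jl} => [|[|[|[|//]]]] _; rewrite ?c0 ?c1 ?c2 ?c3; apply: bits_nat; lia.
have [jz|jz] := ltnP j (4 + (s' + t' + b)).
  have -> : j = 4 + (j - 4) by lia.
  by rewrite nth_word_zeros//; lia.
have -> : j = 4 + (s' + t' + b) + (j - (4 + (s' + t' + b))) by lia.
have jk : j - (4 + (s' + t' + b)) < k * k.*2 by lia.
rewrite nth_word_entries// letter_flipped//.
have k0 : 0 < k by case: (k) jk.
have i0 : n - k + 0 < n by lia.
have [h1 h2] := bits_word_entry s t b g i0 i0.
have neg x : bits W x -> bits (4 * W + (s' + t') + 2) (-1 - x)%R.
  move=> Wx; apply: (@bitsW W.+1); first lia.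
  by apply: bitsB_max => //; apply: (@bitsW 0).
have pos x : bits W x -> bits (4 * W + (s' + t') + 2) x.
  by apply: bitsW; lia.
case: eqP => _.
  by case: f {c0 c1 c2 c3} => [|[|f]] /=; [exact: pos|exact: neg|exact: pos].
case: eqP => _.
  by case: f {c0 c1 c2 c3} => [|[|f]] /=; [exact: pos|exact: pos|exact: neg].
by have [-> lt] := letter_corner g kn jk; apply: pos; exact: bits_letter.
Qed.

(** Queries contain input data but no earlier answers, so the answer bound [q] is applied once
    instead of being iterated over the levels. *)
Lemma polybounded_program (p : aexpr -> aexpr -> cmd) (es et : aexpr)
    (fs ft : nat -> nat -> nat -> nat) (Ps : {poly nat})
    (out : nat -> nat -> nat -> nat -> nat -> (nat -> nat -> int * int) -> seq int) :
  (forall n s t, fs n s t + ft n s t <= Ps.[n + s + t]%R) ->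
  (forall n s t, 0 < s -> 0 < t -> 0 < fs n s t /\ 0 < ft n s t) ->
  (forall (n s t : nat) (m : memory), m 1%N = n -> m 2%N = s -> m 3%N = t ->
    aeval m es = fs n s t /\ aeval m et = ft n s t) ->
  (forall B U n s t b g (s' := fs n s t) (t' := ft n s t),
    answer_addr n s t b s' t' + 10 <= B -> n.+2 * (9 * U + 5) <= B ->
    wsize (word n s t b g) <= U -> b < U ->
    (forall k f, k <= n -> wsize (query n b s' t' g k f) <= B) ->
    (forall k f, k <= n -> wsize (O (query n b s' t' g k f)) <= U) ->
    (forall m : memory, m 1%N = n -> m 2%N = s -> m 3%N = t -> aeval m es = s') ->
    (forall m : memory, m 1%N = n -> m 2%N = s -> m 3%N = t -> aeval m et = t') ->
    exists k, computes O (p es et) (word n s t b g) (out n s' t' t b g) k /\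
      k <= cost_bound B (p es et) + 5 * B.+1) ->
  exists T : {poly nat}, forall n s t b g, 0 < s -> 0 < t ->
    exists k, computes O (p es et) (word n s t b g)
      (out n (fs n s t) (ft n s t) t b g) k /\ k <= T.[wsize (word n s t b g)]%R.
Proof.
move=> Pfs f0 ev comp.
(* In terms of the input length [W]: [QW] bounds queries, [UU] input and answers, [BB] registers;
   [3 * W] dominates [n + s + t]. *)
pose QW W := query_size W Ps.[3 * W]%R.
pose UU W := W + 1 + q.[QW W]%R.
pose BB W := (5 * W + 30 + Ps.[3 * W]%R) + (W + 2) * (9 * UU W + 5) + QW W.
have [T HT] : polybounded (fun W => cost_bound (BB W) (p es et) + 5 * (BB W + 1)).
  have pP : polybounded (fun W => Ps.[3 * W]%R).
    apply: (@polybounded_comp (fun x => Ps.[x]%R)).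
    - exact: polybounded_horner.
    - by apply: polyboundedM; [exact: polybounded_cst|exact: polybounded_id].
  have lin c d : polybounded (fun W => c * W + d).
    apply: polyboundedD; last exact: polybounded_cst.
    by apply: polyboundedM; [exact: polybounded_cst|exact: polybounded_id].
  have pQ : polybounded QW.
    apply: polyboundedM.
      apply: (@eq_polybounded _ (fun W => (5 * W + 4) + Ps.[3 * W]%R)).
        by move=> x; lia.
      exact: polyboundedD.
    apply: (@eq_polybounded _ (fun W => (4 * W + 3) + Ps.[3 * W]%R)).
      by move=> x; lia.
    exact: polyboundedD.
  have pU : polybounded UU.
    apply: polyboundedD.
      by apply: polyboundedD; [exact: polybounded_id|exact: polybounded_cst].
    apply: (@polybounded_comp (fun x => q.[x]%R)) => //.
    - exact: polybounded_horner.
  have pB : polybounded BB.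
    apply: polyboundedD => //; apply: polyboundedD; first exact: polyboundedD.
    apply: polyboundedM.
      by apply: polyboundedD; [exact: polybounded_id|exact: polybounded_cst].
    apply: polyboundedD; last exact: polybounded_cst.
    by apply: polyboundedM => //; exact: polybounded_cst.
  apply: polyboundedD.
    have [K HK] := polybounded_cost_bound (p es et).
    apply: (@eq_polybounded _ (fun x => K.[BB x]%R)); first by move=> x; exact: HK.
    apply: (@polybounded_comp (fun x => K.[x]%R)) => //.
    - exact: polybounded_horner.
  apply: polyboundedM; first exact: polybounded_cst.
  by apply: polyboundedD => //; exact: polybounded_cst.
exists T => n s t b g s0 t0.
set W := wsize (word n s t b g).
have W0 : 4 + (s + t + b) + n * n.*2 <= W by exact: leq_wsize_word.
have nn : n.*2 <= n * n.*2 by case: (n) => // n0; rewrite leq_pmull.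
have [s'0 t'0] := f0 n s t s0 t0.
have PW : fs n s t + ft n s t <= Ps.[3 * W]%R.
  by apply: leq_trans (Pfs n s t) _; apply: leq_horner; lia.
have qW k f : k <= n ->
    wsize (query n b (fs n s t) (ft n s t) g k f) <= QW W.
  move=> kn; apply: leq_trans (@query_size_correct n s t b (fs n s t) (ft n s t) g k f kn) _.
  by rewrite -/W /QW /query_size; apply: leq_mul; lia.
have h1 : answer_addr n s t b (fs n s t) (ft n s t) + 10 <= BB W.
  by rewrite /answer_addr /entries_addr /query_addr /BB -!addnA; lia.
have h2 : n.+2 * (9 * UU W + 5) <= BB W.
  apply: leq_trans (leq_trans (leq_mul _ (leqnn _)) (leq_addl _ _)) (leq_addr _ _).
  lia.
have h3 : W <= UU W by rewrite /UU -addnA leq_addr.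
have h4 : b < UU W by rewrite /UU addn1; apply: leq_trans (leq_addr _ _); lia.
have [k [ck kB]] := comp (BB W) (UU W) n s t b g h1 h2 h3 h4
  (fun k f kn => leq_trans (qW k f kn) (leq_addl _ _))
  (fun k f kn => leq_trans (oracle_size _ _ _ s'0 t'0)
     (leq_trans (leq_horner _ (qW k f kn)) (leq_addl _ _)))
  (fun m m1 m2 m3 => (ev n s t m m1 m2 m3).1)
  (fun m m1 m2 m3 => (ev n s t m m1 m2 m3).2).
exists k; split => //; apply: leq_trans kB _.
by apply: leq_trans (HT W); rewrite addn1.
Qed.

End PolynomialTime.

(** * The reductions *)

Section Reductions.
Context (R : realType).
Local Notation C := R[i].

Definition rounding n (b : nat) (X : 'M[C]_n) (i j : nat) : int * int :=
  round_entry b (ent X i j).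

(** Settles time, output length and the oracle's measurability for both reductions; beyond a
    verified program, each then supplies its parameters and a likely event of correctness. *)
Lemma reducible_by_program (pb1 pb2 : problem R)
    (p : aexpr -> aexpr -> cmd) (es et : aexpr) (fs ft : nat -> nat -> nat -> nat)
    (Ps : {poly nat})
    (out : (seq int -> seq int) -> nat -> nat -> nat -> nat ->
      (nat -> nat -> int * int) -> seq int) :
  (forall n s t, fs n s t + ft n s t <= Ps.[(n + s + t)%N])%N ->
  (forall n s t, 0 < s -> 0 < t -> 0 < fs n s t /\ 0 < ft n s t)%N ->
  (forall (n s t : nat) (m : memory), m 1%N = n -> m 2%N = s -> m 3%N = t ->
    aeval m es = fs n s t /\ aeval m et = ft n s t) ->
  (forall O B U n s t b g (s' := fs n s t) (t' := ft n s t),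
    answer_addr n s t b s' t' + 10 <= B -> n.+2 * (9 * U + 5) <= B ->
    wsize (word n s t b g) <= U -> b < U ->
    (forall k f, k <= n -> wsize (query n b s' t' g k f) <= B) ->
    (forall k f, k <= n -> wsize (O (query n b s' t' g k f)) <= U) ->
    (forall m : memory, m 1%N = n -> m 2%N = s -> m 3%N = t -> aeval m es = s') ->
    (forall m : memory, m 1%N = n -> m 2%N = s -> m 3%N = t -> aeval m et = t') ->
    exists k, computes O (p es et) (word n s t b g) (out O n s' t' b g) k /\
      k <= cost_bound B (p es et) + 5 * B.+1)%N ->
  (forall O n s' t' b g h, (forall i j, i < n -> j < n -> g i j = h i j)%N ->
    out O n s' t' b g = out O n s' t' b h) ->
  (forall n s w, mevent [set X : 'M[C]_n | pb1 n X s w]) ->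
  (forall n s w, mevent [set X : 'M[C]_n | pb2 n X s w]) ->
  (forall O (beta2 : {poly nat}),
    (forall n s t b, (0 < s)%N -> (0 < t)%N -> (beta2.[(n + s + t)%N] <= b)%N ->
      likely t%:R^-1 [set X : 'M[C]_n | pb2 n X s (O (encode s t b X))]) ->
    exists2 beta1 : nat -> nat, polybounded beta1 & forall n s t b,
      (0 < s)%N -> (0 < t)%N -> (beta1 (n + s + t) <= b)%N ->
      likely t%:R^-1 [set X : 'M[C]_n |
        pb1 n X s (out O n (fs n s t) (ft n s t) b (rounding b X))]) ->
  poly_reducible pb1 pb2.
Proof.
move=> Pfs f0 ev comp ext m1 m2 correct; exists (p es et) => O [[q Oq] [beta2 Ob]].
have [T HT] := @polybounded_program R O q Oq p es et fs ft Ps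
  (fun n s' t' _ => out O n s' t') Pfs f0 ev (comp O).
(* [decode] returns unrelated letters at indices outside the matrix; [ext] ensures that the output
   is independent of them. *)
pose F (w : seq int) := let n := `|(w`_0)%R|%N in let s := `|(w`_1)%R|%N in
  let t := `|(w`_2)%R|%N in let b := `|(w`_3)%R|%N in
  out O n (fs n s t) (ft n s t) b (decode w).
have FE n s t b (X : 'M[C]_n) :
    F (encode s t b X) = out O n (fs n s t) (ft n s t) b (rounding b X).
  rewrite encodeE /F [_ 0%N]/= !absz_nat; apply: ext => i j ni nj.
  by rewrite decode_word.
have run n s t b (X : 'M[C]_n) : (0 < s)%N -> (0 < t)%N -> exists k,
    computes O (p es et) (encode s t b X) (F (encode s t b X)) k /\
    (k <= T.[wsize (encode s t b X)])%N.
  by move=> s0 t0; rewrite FE encodeE; exact: HT.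
exists F; split; last by exists T.
split.
  (* The output is charged in [k], so the time bound also bounds its length. *)
  exists T => n s t b X s0 t0; have [k [[m [k0 [_ _ ->]]] kT]] := run n s t b X s0 t0.
  exact: leq_trans (leq_addl _ _) kT.
have Ob' n s t b : (0 < s)%N -> (0 < t)%N -> (beta2.[(n + s + t)%N] <= b)%N ->
    likely t%:R^-1 [set X : 'M[C]_n | pb2 n X s (O (encode s t b X))].
  move=> s0 t0 bb; split; last exact: Ob.
  by apply: (@mevent_encode R n s t b (fun w X => pb2 n X s (O w))) => w; exact: m2.
have [beta1 [beta Hbeta] ok] := correct O beta2 Ob'.
exists beta => n s t b s0 t0 bb.
have [_] := ok n s t b s0 t0 (leq_trans (Hbeta _) bb).
by congr (_ <= PrG _)%E; apply/seteqP; split => X /=; rewrite FE.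
Qed.

Lemma query_rounding n b s' t' (X : 'M[C]_n) :
  query n b s' t' (rounding b X) n 0 = encode s' t' b X.
Proof.
rewrite encodeE; apply: eq_word => i j ni nj.
by rewrite /flipped /corner subnn !add0n; case: ifP.
Qed.

Lemma eq_query n b s' t' g h k f :
  (forall i j, i < n -> j < n -> g i j = h i j)%N -> (k <= n)%N ->
  query n b s' t' g k f = query n b s' t' h k f.
Proof.
move=> gh kn; apply: eq_word => i j ik jk.
by rewrite /flipped /corner !gh//; lia.
Qed.

(** The oracle and Markov's inequality may each fail with probability [1 / (2 t)]. Otherwise the
    error is at most [3 / (6 s t)] times [2 t n!], that is [n! / s]; hence the 6 and the 2. *)
Lemma GPE2_add_reducible : poly_reducible (@GPE2_add R) (@GPE_mul R).
Proof.
pose es := Mul (lit 6) (Mul (input_reg 2) (input_reg 3)); pose et := Mul (lit 2) (input_reg 3).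
pose fs (n s t : nat) := (6 * (s * t))%N; pose ft (n s t : nat) := (2 * t)%N.
pose out O n s' t' b g := let a := O (query n b s' t' g n 0) in
  [:: a`_0 * a`_0 + a`_1 * a`_1; a`_2 * a`_2] : seq int.
have [Ps HPs] : polybounded (fun x => 6 * (x * x) + 2 * x)%N.
  have pid := polybounded_id; have pc := polybounded_cst.
  apply: polyboundedD; apply: polyboundedM; [exact: pc| |exact: pc|exact: pid].
  exact: polyboundedM.
apply: (@reducible_by_program _ _ square_modulus_program es et fs ft Ps out).
- move=> n s t; apply: leq_trans (HPs _); rewrite /fs /ft.
  apply: leq_add; first by rewrite leq_mul2l /= leq_mul; lia.
  by rewrite leq_mul2l; lia.
- by move=> n s t s0 t0; rewrite /fs /ft !muln_gt0 s0 t0.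
- by move=> n s t m m1 m2 m3; rewrite /= m2 m3.
- by move=> O B U n s t b g s' t' *; eapply square_modulus_computes; eassumption.
- by move=> O n s' t' b g h gh; rewrite /out (eq_query _ _ _ _ gh).
- by move=> n s w; exact: mevent_GPE2_add.
- by move=> n s w; exact: mevent_GPE_mul.
move=> O beta2 Ob; exists (fun x => beta2.[(x + 6 * (x * x) + 2 * x)%N]).
  apply: (@polybounded_comp (fun x => beta2.[x])).
  - exact: polybounded_horner.
  have pid := polybounded_id; have pc := polybounded_cst.
  apply: polyboundedD; [apply: polyboundedD; first exact: pid|];
    apply: polyboundedM; [exact: pc| |exact: pc|exact: pid].
  exact: polyboundedM.
move=> n s t b s0 t0 bb.
have s'0 : (0 < fs n s t)%N by rewrite /fs !muln_gt0 s0 t0.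
have t'0 : (0 < ft n s t)%N by rewrite /ft muln_gt0 t0.
have b2 : (beta2.[(n + fs n s t + ft n s t)%N] <= b)%N.
  apply: leq_trans bb; apply: leq_horner; rewrite /fs /ft.
  apply: leq_add; last by rewrite leq_mul2l; lia.
  by apply: leq_add; [lia|rewrite leq_mul2l /= leq_mul; lia].
have t'R : 0 < (ft n s t)%:R :> R by rewrite ltr0n.
have := likelyI (Ob _ _ _ _ s'0 t'0 b2) (per_upper_likely n t'R).
have -> : (ft n s t)%:R^-1 + (ft n s t)%:R^-1 = t%:R^-1 :> R.
  by rewrite /ft natrM; field; rewrite pnatr_eq0 -lt0n.
move=> lk; apply: likely_mono lk _ _.
  have -> : [set X : 'M[C]_n | GPE2_add X s (out O n (fs n s t) (ft n s t) b (rounding b X))] =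
    [set X : 'M[C]_n | (fun w => GPE2_add X s
      [:: (O w)`_0 * (O w)`_0 + (O w)`_1 * (O w)`_1; (O w)`_2 * (O w)`_2])
      (encode (fs n s t) (ft n s t) b X)].
    by apply/seteqP; split => X; rewrite /out /= query_rounding.
  apply: (@mevent_encode R n _ _ b (fun w X => GPE2_add X s
    [:: (O w)`_0 * (O w)`_0 + (O w)`_1 * (O w)`_1; (O w)`_2 * (O w)`_2])) => w.
  exact: mevent_GPE2_add.
move=> X [/GPE_mulP ok Pu]; rewrite /out /= query_rounding; apply/GPE2_addP.
set a := O _ in ok *; set z := _ / _ in ok.
(* Also true for a zero denominator, where both sides are 0. *)
have -> : ([:: a`_0 * a`_0 + a`_1 * a`_1; a`_2 * a`_2]`_0)%:~R /
    ([:: a`_0 * a`_0 + a`_1 * a`_1; a`_2 * a`_2]`_1)%:~R = sqn z :> R.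
  rewrite /z /=; have -> : (a`_2)%:~R^-1 = ((a`_2)%:~R^-1)%:C :> C.
    by rewrite fmorphV rmorph_int.
  rewrite sqnM /sqn /= expr0n addr0 !rmorphD !rmorphM /= -!expr2 exprVn.
  by [].
have sR : 0 < s%:R :> R by rewrite ltr0n.
have tR : 0 < t%:R :> R by rewrite ltr0n.
have fsE : (fs n s t)%:R = 6 * s%:R * t%:R :> R by rewrite /fs !natrM mulrA.
have e01 : 0 <= ((fs n s t)%:R^-1 : R) <= 1.
  by apply/andP; split; [rewrite invr_ge0 ler0n|rewrite invf_le1 ?ltr0n// ler1n].
apply: le_trans (sqn_approx e01 ok) _.
have ftE : (ft n s t)%:R = 2 * t%:R :> R by rewrite /ft natrM.
apply: (@le_trans _ _ (3 * (fs n s t)%:R^-1 * ((ft n s t)%:R * n`!%:R))).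
  by rewrite ler_wpM2l// mulr_ge0// invr_ge0 ler0n.
rewrite fsE ftE le_eqVlt; apply/orP; left; apply/eqP; field.
by rewrite !gt_eqF.
Qed.

End Reductions.

Section PolynomialBound.
Context (R : realType).

Lemma horner_bound (f : {poly R}) : exists M d : nat,
  forall y z : R, `|y| <= z -> 1 <= z -> `|f.[y]| <= M%:R * z ^+ d.
Proof.
elim/poly_ind: f => [|f c [M [d Hf]]].
  by exists 0%N, 0%N => y z _ _; rewrite horner0 normr0 mul0r.
exists (M + (Num.truncn `|c|).+1)%N, d.+1 => y z yz z1.
have z0 : 0 <= z by lra.
rewrite hornerMXaddC; apply: le_trans (ler_normD _ _) _.
rewrite natrD mulrDl lerD//.
  by rewrite normrM exprSr mulrA ler_pM//; exact: Hf.
apply: le_trans (ltW (truncnS_gt _)) _.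
by rewrite ler_peMr// exprn_ege1.
Qed.

(** The polynomial of the conjecture has arbitrary real coefficients, while a program needs an
    integer expression; a monomial with natural constants replaces it. *)
Lemma horner2_bound (p : {poly {poly R}}) : exists M d : nat,
  forall x y z : R, `|x| <= z -> `|y| <= z -> 1 <= z ->
    `|p.[x, y]| <= M%:R * z ^+ d.
Proof.
elim/poly_ind: p => [|p f [M [d Hp]]].
  by exists 0%N, 0%N => x y z _ _ _; rewrite horner0 horner0 normr0 mul0r.
have [M' [d' Hf]] := horner_bound f.
exists (M + M')%N, (d + d').+1 => x y z xz yz z1.
have z0 : 0 <= z by lra.
rewrite hornerMXaddC hornerD hornerM hornerC.
apply: le_trans (ler_normD _ _) _; rewrite natrD mulrDl lerD//.
  rewrite normrM exprSr mulrA ler_pM//; apply: le_trans (Hp x y z xz yz z1) _.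
  by rewrite ler_wpM2l// ler_weXn2l// leq_addr.
apply: le_trans (Hf y z yz z1) _.
by rewrite ler_wpM2l// ler_weXn2l//; lia.
Qed.

End PolynomialBound.

(** * From squared moduli to the permanent *)

Section PermanentReduction.
Context (R : realType).
Local Notation C := R[i].

Definition flip_entry (f : nat) : R * R -> R * R :=
  match f with 0 => id | 1 => @conj_re R | _ => @conj_im R end.

Definition flipped_minor n k f (X : 'M[C]_n) : 'M[C]_k.+1 :=
  mxflip (flip_entry f) (brsub k.+1 X).

Lemma mtrans_flipped_minor n k f : (k < n)%N -> mtrans (@flipped_minor n k f).
Proof.
move=> kn; apply: mtrans_comp (mtrans_brsub _ kn); apply: mtrans_mxflip.
case: f => [|[|f]]; [exact: mpres_id|exact: mpres_conj_re|exact: mpres_conj_im].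
Qed.

Definition ratio_estimate (b : nat) (z : int * int) (w w1 w2 : seq int) (p0 q0 : int) : C :=
  let a := z.1%:~R / 2 ^+ b in let c := z.2%:~R / 2 ^+ b in
  let N := (w`_0)%:~R / (w`_1)%:~R in let N1 := (w1`_0)%:~R / (w1`_1)%:~R in
  let N2 := (w2`_0)%:~R / (w2`_1)%:~R in let N0 := p0%:~R / q0%:~R in
  (a + (N - N1) / (4 * a * N0)) +i* (c + (N - N2) / (4 * c * N0)).

Definition progress_value (st : progress) : C :=
  ((num_re st)%:~R +i* (num_im st)%:~R) / (den st)%:~R.

(** Division by 0 yields 0 in [R], so clearing denominators requires them to be nonzero; accuracy of
    the answers will provide this. *)
Lemma advance_value b z w w1 w2 st :
  z.1 != 0 -> z.2 != 0 -> w`_1 != 0 -> w1`_1 != 0 -> w2`_1 != 0 ->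
  last_num st != 0 -> last_den st != 0 ->
  progress_value (advance (2 ^ b)%N z w w1 w2 st) =
    ratio_estimate b z w w1 w2 (last_num st) (last_den st) * progress_value st.
Proof.
move=> z1 z2 q q1 q2 p0 q0.
have intC (x : int) : x%:~R = (x%:~R)%:C :> C by rewrite rmorph_int.
have nz (x : int) : x != 0 -> x%:~R != 0 :> R by rewrite intr_eq0.
rewrite /progress_value /advance /=.
set nr := ratio_re _ _ _ _ _ _ _; set ni := ratio_im _ _ _ _ _ _ _.
set nd := ratio_den _ _ _ _ _ _.
suff -> : ratio_estimate b z w w1 w2 (last_num st) (last_den st) =
    (nr%:~R +i* ni%:~R) / nd%:~R.
  rewrite mulf_div -rmorphM /= [den st * nd]mulrC; congr (_ / _).
  by apply/eqP; rewrite eq_complex /= !(rmorphB, rmorphD, rmorphN, rmorphM) /=;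
     apply/andP; split; apply/eqP; ring.
have S0 : (2 ^+ b : R) != 0 by rewrite expf_neq0.
have SE : (2 ^ b)%N%:~R = 2 ^+ b :> R by rewrite -natrX.
rewrite intC -fmorphV.
have scaleC (u v r : R) : (u +i* v) * r%:C = (u * r) +i* (v * r).
  by apply/eqP; rewrite eq_complex /= !mulr0 subr0 add0r !eqxx.
rewrite scaleC /ratio_estimate /nr /ni /nd /ratio_re /ratio_im /ratio_den /ratio_common.
rewrite !(rmorphB, rmorphD, rmorphN, rmorphM) /= SE.
have := (nz _ z1, nz _ z2, nz _ q, nz _ q1, nz _ q2, nz _ p0, nz _ q0).
move: (z.1%:~R : R) (z.2%:~R : R) ((w`_0)%:~R : R) ((w`_1)%:~R : R)
  ((w1`_0)%:~R : R) ((w1`_1)%:~R : R) ((w2`_0)%:~R : R) ((w2`_1)%:~R : R)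
  ((last_num st)%:~R : R) ((last_den st)%:~R : R) (2 ^+ b : R) S0.
move=> {}z1 {}z2 p' q' p1 q1' p2 q2' p0' q0' S S0 [[[[[[h1 h2] h3] h4] h5] h6] h7].
by congr (_ +i* _); field; rewrite ?h1 ?h2 ?h3 ?h4 ?h5 ?h6 ?h7 ?S0.
Qed.

Lemma floor_opp_noninteger (x : R) : noninteger x ->
  Num.floor (- x) = -1 - Num.floor x.
Proof.
move=> nx; apply/eqP; rewrite floor_eq.
have h := floor_itv x; move: h => /andP[h1 h2].
have h3 : (Num.floor x)%:~R < x by rewrite lt_neqAle h1 andbT; apply/eqP => /esym; exact: nx.
by move: h2 h3; rewrite !rmorphD !rmorphN /=; lra.
Qed.

(** The word that the program writes by integer operations is the encoding of the flipped matrix, to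
    which the guarantee of the oracle applies. *)
Lemma query_flipped_minor n k f s' t' b (X : 'M[C]_n) : (k < n)%N -> (f < 3)%N ->
  noninteger (2 ^+ b * complex.Re (brsub k.+1 X ord0 ord0)) ->
  noninteger (2 ^+ b * complex.Im (brsub k.+1 X ord0 ord0)) ->
  query n b s' t' (rounding b X) k.+1 f = encode s' t' b (flipped_minor k f X).
Proof.
move=> kn f3 nre nim; rewrite encodeE; apply: eq_word => i j ik jk.
have cE (i' j' : 'I_k.+1) : corner n (rounding b X) k.+1 i' j' =
    round_entry b (brsub k.+1 X i' j').
  by rewrite /corner /rounding mxE.
rewrite /flipped (cE (Ordinal ik) (Ordinal jk)).
rewrite (ent_Ordinal _ ik jk) /flipped_minor [mxflip _ _ _ _]mxE -!val_eqE /=.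
case: ifP => // /andP[/eqP i0 /eqP j0].
have -> : Ordinal ik = ord0 by apply/val_inj.
have -> : Ordinal jk = ord0 by apply/val_inj.
case: f f3 => [|[|[|//]]] _ /=; rewrite /round_entry /=; first by case: (brsub _ _ _ _).
  by rewrite mulrN floor_opp_noninteger.
by rewrite mulrN floor_opp_noninteger.
Qed.

(** Only the corner entry changes, so the other terms of the expansion, whose sum is [Z], are common
    to both matrices. *)
Lemma per_flipped_minor n k f (X : 'M[C]_n) : (k < n)%N ->
  let z := brsub k.+1 X ord0 ord0 in
  let u := flip_entry f (complex.Re z, complex.Im z) in
  exists Z, per (brsub k.+1 X) = z * per (brsub k X) + Z /\
    per (flipped_minor k f X) = (u.1 +i* u.2) * per (brsub k X) + Z.
Proof.
move=> kn z u.
have Y : brsub k X = row' ord0 (col' ord0 (brsub k.+1 X)).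
  by rewrite -brsub_minor brsub_brsub// leqnSn.
exists (\sum_j brsub k.+1 X ord0 (lift ord0 j) *
  per (row' ord0 (col' (lift ord0 j) (brsub k.+1 X)))).
split; first by rewrite per_laplace big_ord_recl -Y.
have minor j : row' ord0 (col' j (flipped_minor k f X)) = row' ord0 (col' j (brsub k.+1 X)).
  by apply/matrixP => a c; rewrite !mxE.
rewrite per_laplace big_ord_recl minor -Y; congr (_ * _ + _).
  by rewrite mxE.
by apply: eq_bigr => j _; rewrite minor mxE.
Qed.

(** The lower bound is asked of all three matrices: together with accuracy it makes every answer
    positive, hence every denominator nonzero. *)
Definition level_good (O : seq int -> seq int) n s' t' b (L : R) k (X : 'M[C]_n) : Prop :=
  nice_entry b L (brsub k.+1 X ord0 ord0) /\
  forall f, (f < 3)%N -> let M := flipped_minor k f X in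
    [/\ GPE2_add M s' (O (encode s' t' b M)), (k.+1)`!%:R / L <= sqn (per M) &
        sqn (per M) <= L * (k.+1)`!%:R].

(* The factor 10 counts the event on the entry and three events for each of the
   three queries. *)
Lemma likely_level_good O n s' t' b (L e : R) k : (k < n)%N -> 0 < L ->
  0 <= e -> 5 * L^-1 <= e ->
  likely e [set X : 'M[C]_k.+1 | GPE2_add X s' (O (encode s' t' b X))] ->
  likely e [set X : 'M[C]_k.+1 | (k.+1)`!%:R / L <= sqn (per X)] ->
  likely (10 * e) [set X : 'M[C]_n | level_good O s' t' b L k X].
Proof.
move=> kn L0 e0 Le acc low.
have V0 : 0 < L^-1 by rewrite invr_gt0.
have LVe : L^-1 <= e by lra.
have e3 : 0 <= e + e + e by lra.
have up := likely_weaken LVe (per_upper_likely k.+1 L0).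
have lf f := likely_mtrans (mtrans_flipped_minor f kn) (likelyI (likelyI acc low) up).
have le := likely_weaken Le (nice_entry_likely k b L0).
have := likelyI (likely_mtrans (mtrans_brsub _ kn) le)
  (likely_forall (N := 3) e3 (fun f _ => lf f)).
have -> : e + 3%:R * (e + e + e) = 10 * e by ring.
congr likely; apply/seteqP; split => X /= [h1 h2]; split => // f f3.
  by have [[]] := h2 f f3.
by have [] := h2 f f3.
Qed.

(** * Deterministic accuracy on a good matrix *)

Section Pointwise.
Variables (O : seq int -> seq int) (n s s' t' b : nat) (L : R) (X : 'M[C]_n).
Hypothesis s0 : (0 < s)%N.
Hypothesis L1 : 1 <= L.
Hypothesis s'E : 48 * L ^+ 5 * n.+1%:R ^+ 2 * s%:R <= s'%:R.
Hypothesis bE : 72 * L ^+ 5 * n.+1%:R * s%:R <= 2 ^+ b.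
Hypothesis good : forall k, (k < n)%N -> level_good O s' t' b L k X.

Let P k := per (brsub k X).
Let st k := progress_at O n b s' t' (rounding b X) k.
Let e : R := s'%:R^-1.
Let d : R := (2 ^+ b)^-1.
(** Relative error allowed to one ratio, so that [product_error] ends within [1 / s]. Oracle error
    and rounding receive [eta / 2] each, which turns the 12 and 18 of [ratio_error] into the 48 and
    72 above. *)
Let eta : R := (2 * n.+1%:R * s%:R)^-1.
Let L5 : 1 <= L ^+ 5. Proof. exact: exprn_ege1. Qed.
Let sR : 1 <= s%:R :> R. Proof. by rewrite ler1n. Qed.
Let nR : 1 <= n.+1%:R :> R. Proof. by rewrite ler1n. Qed.
Let L0 : 0 < L. Proof. exact: lt_le_trans ltr01 L1. Qed.

Let facts : [/\ 1 <= L, 0 < L, 1 <= L ^+ 5, 1 <= s%:R :> R & 1 <= n.+1%:R :> R].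
Proof. by split. Qed.

Let eK k : (k < n)%N -> 12 * L ^+ 5 * k.+1%:R * e <= eta / 2.
Proof.
have [? ? ? ? ?] := facts.
move=> kn; have kR : k.+1%:R <= n.+1%:R :> R by rewrite ler_nat; lia.
have D0 : 0 < 48 * L ^+ 5 * n.+1%:R ^+ 2 * s%:R :> R.
  by rewrite !mulr_gt0 ?exprn_gt0//; lra.
apply: (@le_trans _ _ (12 * L ^+ 5 * n.+1%:R * (48 * L ^+ 5 * n.+1%:R ^+ 2 * s%:R)^-1)).
  apply: ler_pM => //.
  - by rewrite !mulr_ge0//; lra.
  - by rewrite invr_ge0.
  - by rewrite ler_wpM2l// mulr_ge0//; lra.
  - by rewrite lef_pV2// posrE//; exact: lt_le_trans s'E.
rewrite le_eqVlt; apply/orP; left; apply/eqP; rewrite /eta; field.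
by rewrite !gt_eqF//; lra.
Qed.

Let dK : 18 * L ^+ 5 * d <= eta / 2.
Proof.
have [? ? ? ? ?] := facts.
have D0 : 0 < 72 * L ^+ 5 * n.+1%:R * s%:R :> R by rewrite !mulr_gt0//; lra.
apply: (@le_trans _ _ (18 * L ^+ 5 * (72 * L ^+ 5 * n.+1%:R * s%:R)^-1)).
  rewrite ler_wpM2l//; first by rewrite mulr_ge0//; lra.
  by rewrite lef_pV2// posrE ?exprn_gt0//.
rewrite le_eqVlt; apply/orP; left; apply/eqP; rewrite /eta; field.
by rewrite !gt_eqF//; lra.
Qed.

Let eta1 : eta <= 1.
Proof.
have [? ? ? ? ?] := facts.
rewrite /eta invf_le1; last by rewrite !mulr_gt0//; lra.
have : 1 * 1 <= n.+1%:R * s%:R :> R by apply: ler_pM.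
by rewrite -mulrA; lra.
Qed.

Let e0 : 0 <= e. Proof. by rewrite invr_ge0. Qed.
Let d0 : 0 <= d. Proof. by rewrite invr_ge0 exprn_ge0. Qed.
Let LL5 : L <= L ^+ 5. Proof. by rewrite -[leLHS]expr1 ler_weXn2l. Qed.

Let Le k : (k < n)%N -> 2 * L * e <= 1.
Proof.
have [? ? ? ? ?] := facts.
move=> kn; have h := eK kn; have := eta1.
have k1 : 1 <= k.+1%:R :> R by rewrite ler1n.
have : L * e <= L ^+ 5 * e by rewrite ler_wpM2r.
have : L ^+ 5 * e * 1 <= L ^+ 5 * e * k.+1%:R.
  by rewrite ler_wpM2l// mulr_ge0//; lra.
have : 0 <= L ^+ 5 * e by rewrite mulr_ge0//; lra.
lra.
Qed.

Let Ld : 2 * L * d <= 1.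
Proof.
have [? ? ? ? ?] := facts.
have h := dK; have := eta1; have : L * d <= L ^+ 5 * d by rewrite ler_wpM2r.
have : 0 <= L ^+ 5 * d by rewrite mulr_ge0//; lra.
lra.
Qed.

Let N k f : R := let w := O (encode s' t' b (flipped_minor k f X)) in
  (w`_0)%:~R / (w`_1)%:~R.

Let accurate k f : (k < n)%N -> (f < 3)%N ->
  `|N k f - sqn (per (flipped_minor k f X))| <= e * (k.+1%:R * k`!%:R).
Proof.
by move=> kn f3; have [_ /(_ f f3)[/GPE2_addP]] := good kn; rewrite factS natrM.
Qed.

(** The estimate is within [e K] of a number at least [K / L], and [2 L e <= 1] leaves at least half
    of that. *)
Let N_gt0 k f : (k < n)%N -> (f < 3)%N -> 0 < N k f.
Proof.
have [? ? ? ? ?] := facts.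
move=> kn f3; have := accurate kn f3.
have [_ /(_ f f3)[_ + _]] := good kn; rewrite factS natrM.
set K := k.+1%:R * k`!%:R; have K0 : 0 < K :> R.
  by rewrite mulr_gt0// ltr0n ?fact_gt0.
rewrite ler_pdivrMr// ler_norml => h1 /andP[h2 _].
have h3 : e * K * (2 * L) <= K.
  by rewrite mulrAC mulrC -[leRHS]mulr1 ler_pM2l// mulrC; have := Le kn; lra.
rewrite -(pmulr_rgt0 _ L0); have : L * (sqn (per (flipped_minor k f X)) - e * K) <= L * N k f.
  by rewrite ler_pM2l//; lra.
lra.
Qed.

Let query_eq k f : (k < n)%N -> (f < 3)%N ->
  query n b s' t' (rounding b X) k.+1 f = encode s' t' b (flipped_minor k f X).
Proof.
by move=> kn f3; have [[_ [h1 h2] _] _] := good kn; exact: query_flipped_minor.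
Qed.

Let flipped_minor0 k : flipped_minor k 0 X = brsub k.+1 X.
Proof.
apply/matrixP => i j; rewrite mxE; case: ifP => // /andP[/eqP -> /eqP ->].
by case: (brsub _ _ _ _).
Qed.

Let lastE k : (last_num (st k))%:~R / (last_den (st k))%:~R =
  if k is k'.+1 then (((O (query n b s' t' (rounding b X) k 0))`_0)%:~R /
    ((O (query n b s' t' (rounding b X) k 0))`_1)%:~R) else 1 :> R.
Proof. by case: k => [|k] //=; rewrite divr1. Qed.

(** The recursion starts from [Per X_0 = 1], estimated exactly by [1 / 1]; afterwards the answer to
    the unflipped query of the previous level is reused. *)
Let last_estimate k : (k < n)%N ->
  [/\ 0 < (last_num (st k))%:~R / (last_den (st k))%:~R :> R,
   `|(last_num (st k))%:~R / (last_den (st k))%:~R - sqn (P k)| <= e * k`!%:R,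
   k`!%:R / L <= sqn (P k) & sqn (P k) <= L * k`!%:R].
Proof.
rewrite lastE; case: k => [_|k kn].
  have -> : sqn (P 0) = 1 by rewrite /P per0 /sqn /= expr1n expr0n addr0.
  rewrite subrr normr0 fact0 !mulr1 mul1r; split => //.
  by rewrite invf_le1.
have kn' := ltnW kn; rewrite query_eq//.
have := accurate kn' (isT : (0 < 3)%N); have := N_gt0 kn' (isT : (0 < 3)%N).
have [_ /(_ 0%N isT)[_]] := good kn'.
by rewrite /N flipped_minor0 factS natrM => h1 h2 h3 h4; split.
Qed.

Let quotient_neq0 (p q : int) : 0 < p%:~R / q%:~R :> R -> p != 0 /\ q != 0.
Proof.
move=> h; split; apply/eqP => E; move: h; rewrite E; first by rewrite mul0r ltxx.
by rewrite invr0 mulr0 ltxx.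
Qed.

Let rounded_near (x : R) : `|(Num.floor (2 ^+ b * x))%:~R / 2 ^+ b - x| <= d.
Proof.
have [? ? ? ? ?] := facts.
have S0 : 0 < 2 ^+ b :> R by rewrite exprn_gt0.
have /andP[h1 h2] := floor_itv (2 ^+ b * x).
have -> : (Num.floor (2 ^+ b * x))%:~R / 2 ^+ b - x =
    ((Num.floor (2 ^+ b * x))%:~R - 2 ^+ b * x) / 2 ^+ b.
  by field; rewrite gt_eqF.
rewrite normrM [`|_^-1|]gtr0_norm ?invr_gt0// -[leRHS]mul1r ler_wpM2r//.
by rewrite ler_norml; move: h2; rewrite rmorphD /=; lra.
Qed.

Let rounded_neq0 (x : R) : L^-1 <= `|x| -> Num.floor (2 ^+ b * x) != 0.
Proof.
have [? ? ? ? ?] := facts.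
move=> Lx; apply/eqP => E; have := rounded_near x.
rewrite E mul0r sub0r normrN => h.
have : L * L^-1 <= L * d by rewrite ler_pM2l//; lra.
rewrite divff ?gt_eqF//; have := Ld; lra.
Qed.

Let step k : (k < n)%N -> exists r : C,
  progress_value (st k.+1) = r * progress_value (st k) /\
  modc (r * P k - P k.+1) <= eta * modc (P k.+1).
Proof.
have [? ? ? ? ?] := facts.
move=> kn; have [nice lev] := good kn.
have [[are aim] [nre nim] xL] := nice.
set z := brsub k.+1 X ord0 ord0 in are aim nre nim xL.
have [N00 N0a Pl Pu] := last_estimate kn.
have [p0 q0] := quotient_neq0 N00.
have kk1 : corner n (rounding b X) k.+1 0 0 = round_entry b z.
  by rewrite /corner /rounding /z mxE.
have z1 : (corner n (rounding b X) k.+1 0 0).1 != 0.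
  by rewrite kk1; exact: rounded_neq0.
have z2 : (corner n (rounding b X) k.+1 0 0).2 != 0.
  by rewrite kk1; exact: rounded_neq0.
have nq f : (f < 3)%N -> (O (query n b s' t' (rounding b X) k.+1 f))`_1 != 0.
  by move=> f3; rewrite query_eq//; have [] := quotient_neq0 (N_gt0 kn f3).
exists (ratio_estimate b (corner n (rounding b X) k.+1 0 0)
  (O (query n b s' t' (rounding b X) k.+1 0)) (O (query n b s' t' (rounding b X) k.+1 1))
  (O (query n b s' t' (rounding b X) k.+1 2)) (last_num (st k)) (last_den (st k))).
split; first by apply: advance_value => //; exact: nq.
rewrite !query_eq// kk1.
have [Z [PE _]] := per_flipped_minor 0 X kn.
have per_f f : per (flipped_minor k f X) =
   ((flip_entry f (complex.Re z, complex.Im z)).1 +i*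
    (flip_entry f (complex.Re z, complex.Im z)).2) * P k + Z.
  have [Z' [PE' ->]] := per_flipped_minor f X kn; congr (_ + _).
  (* The [Z'] obtained for [f] is [Z], as both equal [Per X_(k+1) - z Per X_k]. *)
  by apply: (addrI (z * P k)); rewrite -PE' -PE.
have a0 := accurate kn (isT : (0 < 3)%N); have a1 := accurate kn (isT : (1 < 3)%N).
have a2 := accurate kn (isT : (2 < 3)%N).
have [_ low0 _] := lev 0%N isT.
rewrite !per_f /= in a0 a1 a2 low0; rewrite factS natrM in low0.
have PkE : P k.+1 = (complex.Re z +i* complex.Im z) * P k + Z.
  by rewrite -(per_f 0%N) flipped_minor0.
have K0 : 0 < k`!%:R :> R by rewrite ltr0n fact_gt0.
have k1 : 1 <= k.+1%:R :> R by rewrite ler1n.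
have xL' : sqn (complex.Re z +i* complex.Im z) <= L by exact: xL.
have := ratio_error a0 a1 a2 N0a (rounded_near (complex.Re z)) (rounded_near (complex.Im z))
  Pl Pu low0 are aim xL' K0 L1 k1 d0 e0 Ld (Le kn).
rewrite -PkE => h; apply: le_trans h _; rewrite ler_wpM2r ?modc_ge0//.
by have := eK kn; have := dK; lra.
Qed.

Lemma permanent_estimate :
  GPE_mul X s [:: num_re (st n); num_im (st n); den (st n)].
Proof.
have [? ? ? ? ?] := facts.
apply/GPE_mulP; rewrite [X in sqn (X - _)]/(progress_value (st n)).
rewrite -modc_le_sqn; last by rewrite invr_ge0.
have PnE : per X = P n by rewrite /P brsub_id.
rewrite PnE.
have [r Hr] : exists r : nat -> C, forall k, (k < n)%N ->
    progress_value (st k.+1) = r k.+1 * progress_value (st k) /\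
    modc (r k.+1 * P k - P k.+1) <= eta * modc (P k.+1).
  (* [product_error] indexes ratios from 1, whence the predecessor; the value 0 out of range is
     arbitrary. *)
  exists (fun k => if pselect (k.-1 < n)%N is left kn then projT1 (cid (step kn)) else 0).
  move=> k kn /=; case: pselect => // kn'.
  by case: cid.
have en : 2 * n%:R * eta <= s%:R^-1.
  have -> : s%:R^-1 = 2 * n.+1%:R * eta :> R.
    by rewrite /eta; field; rewrite !gt_eqF//; lra.
  rewrite ler_wpM2r// ?ler_wpM2l ?ler_nat//.
  by rewrite /eta invr_ge0 !mulr_ge0.
have s1 : s%:R^-1 <= 1 :> R by rewrite invf_le1//; lra.
apply: le_trans (product_error (eta := eta) (P := P) (r := r)
  (A := fun k => progress_value (st k)) _ _ _ _ _ _) _.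
- by rewrite /eta invr_ge0 !mulr_ge0.
- exact: le_trans en s1.
- by rewrite /P per0.
- by rewrite /progress_value /= divr1.
- by move=> k kn; have [] := Hr k kn.
- by move=> k kn; have [] := Hr k kn.
by rewrite ler_wpM2r ?modc_ge0.
Qed.

End Pointwise.

End PermanentReduction.

(** Exponents are fixed with the program, so a power unrolls into an expression. *)
Fixpoint epow (x : aexpr) (d : nat) : aexpr :=
  if d is d'.+1 then Mul x (epow x d') else lit 1.

Lemma aeval_epow m x d (v : nat) : aeval m x = v -> aeval m (epow x d) = (v ^ d)%N.
Proof. by move=> xv; elim: d => //= d ->; rewrite xv -PoszM -expnS. Qed.

Lemma aeval_mul m x y (u v : nat) : aeval m x = u -> aeval m y = v ->
  aeval m (Mul x y) = (u * v)%N.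
Proof. by rewrite PoszM /= => -> ->. Qed.

(** * Accuracy parameters of the queries, as numbers and as expressions *)

Section OracleAccuracy.
Variables M d : nat.
Local Open Scope nat_scope.

(** A level involves ten events, each failing with probability at most the inverse of this number;
    over [n] levels the total stays below [1 / t]. *)
Definition inverse_delta (n s t : nat) : nat := 10 * (n.+1 * t).
(* [spread] exceeds both [p(k, 1/delta)^2] and [5 / delta]; with this choice of
   [inverse_epsilon] each of the [n] ratios has relative error at most
   [1 / (2 (n + 1) s)]. *)
Definition spread (n s t : nat) : nat :=
  (M + 5) * (n + inverse_delta n s t + 1) ^ d.+1.
Definition inverse_epsilon (n s t : nat) : nat :=
  48 * (spread n s t ^ 5 * (n.+1 ^ 2 * s)).

Definition e_delta : aexpr := Mul (lit 10) (Mul (Add (input_reg 1) (lit 1)) (input_reg 3)).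
Definition e_spread : aexpr :=
  Mul (lit (M + 5)) (epow (Add (Add (input_reg 1) e_delta) (lit 1)) d.+1).
Definition e_epsilon : aexpr :=
  Mul (lit 48) (Mul (epow e_spread 5) (Mul (epow (Add (input_reg 1) (lit 1)) 2) (input_reg 2))).

Lemma aeval_parameters (n s t : nat) (m : memory) :
  m 1%N = n -> m 2%N = s -> m 3%N = t ->
  aeval m e_epsilon = inverse_epsilon n s t /\ aeval m e_delta = inverse_delta n s t.
Proof.
move=> m1 m2 m3.
have n1 : aeval m (Add (input_reg 1) (lit 1)) = n.+1 by rewrite /= m1; lia.
have dE : aeval m e_delta = inverse_delta n s t.
  by rewrite /e_delta /inverse_delta [LHS]/= m1 m3 !PoszM; lia.
have sE : aeval m e_spread = spread n s t.
  apply: aeval_mul => //; apply: aeval_epow.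
  rewrite -[LHS]/((m 1%N + aeval m e_delta) + 1)%R dE m1; lia.
split => //; apply: aeval_mul => //; apply: aeval_mul; first exact: aeval_epow.
by apply: aeval_mul; [exact: aeval_epow|exact: m2].
Qed.

Lemma parameters_polybounded : polybounded (fun x =>
  inverse_epsilon x x x + inverse_delta x x x + spread x x x).
Proof.
have pid := polybounded_id; have pc := polybounded_cst.
have pS : polybounded (fun x => x.+1).
  by apply: (@eq_polybounded _ (fun x => x + 1)) => [x|]; [rewrite addn1|exact: polyboundedD].
have pd : polybounded (fun x => inverse_delta x x x).
  by apply: polyboundedM; [exact: pc|exact: polyboundedM].
have ps : polybounded (fun x => spread x x x).
  apply: polyboundedM; first exact: pc.
  apply: (@polyboundedX (fun x => x + inverse_delta x x x + 1)).
  by apply: polyboundedD; [exact: polyboundedD|exact: pc].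
apply: polyboundedD => //; apply: polyboundedD => //.
apply: polyboundedM; first exact: pc.
apply: polyboundedM; first exact: (@polyboundedX (fun x => spread x x x)).
by apply: polyboundedM => //; exact: (@polyboundedX (fun x => x.+1)).
Qed.

Lemma leq_parameters n s t x : n <= x -> s <= x -> t <= x ->
  [/\ inverse_epsilon n s t <= inverse_epsilon x x x,
      inverse_delta n s t <= inverse_delta x x x & spread n s t <= spread x x x].
Proof.
move=> nx sx tx.
have h : inverse_delta n s t <= inverse_delta x x x.
  by rewrite leq_mul2l /= leq_mul.
have h2 : spread n s t <= spread x x x.
  by apply: leq_mul => //; rewrite leq_exp2r// leq_add2r leq_add.
split => //; apply: leq_mul => //; apply: leq_mul; first by rewrite leq_exp2r.
by apply: leq_mul => //; rewrite leq_exp2r.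
Qed.

Lemma parameters_gt0 n s t : 0 < s -> 0 < t ->
  0 < inverse_epsilon n s t /\ 0 < inverse_delta n s t.
Proof.
move=> s0 t0; rewrite /inverse_epsilon /inverse_delta /spread.
by rewrite !(muln_gt0, expn_gt0, addn_gt0) s0 t0 !orbT.
Qed.

End OracleAccuracy.

Section FinalReduction.
Context (R : realType).
Local Notation C := R[i].

Lemma GPE_mul_reducible : PACC R -> poly_reducible (@GPE_mul R) (@GPE2_add R).
Proof.
move=> [p [p0 pacc]].
have [M0 [d0 Hp]] := horner2_bound p.
(* The bound on [p] is squared because squared moduli are compared. [M] and [d] depend on [p] alone,
   so one program serves all oracles. *)
pose M := (M0 ^ 2)%N; pose d := (d0 * 2)%N.
pose out O n s' t' b g := let st := progress_at O n b s' t' g n in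
  [:: num_re st; num_im st; den st].
have out_ext O n s' t' b g h : (forall i j, i < n -> j < n -> g i j = h i j)%N ->
    out O n s' t' b g = out O n s' t' b h.
  move=> gh.
  suff E k : (k <= n)%N -> progress_at O n b s' t' g k = progress_at O n b s' t' h k.
    by rewrite /out E.
  elim: k => //= k IHk kn; rewrite IHk ?(ltnW kn)//.
  rewrite !(eq_query _ _ _ _ gh kn); congr advance.
  by rewrite /corner gh//; lia.
have [Ps HPs] := parameters_polybounded M d.
apply: (@reducible_by_program R _ _ permanent_program (e_epsilon M d) e_delta
  (inverse_epsilon M d) inverse_delta Ps out).
- move=> n s t; apply: leq_trans (HPs _); apply: leq_trans (leq_addr _ _).
  have [h1 h2 _] := @leq_parameters M d n s t (n + s + t)%N ltac:(lia) ltac:(lia) ltac:(lia).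
  exact: leq_add.
- by move=> n s t; exact: parameters_gt0.
- by move=> n s t m; exact: aeval_parameters.
- by move=> O B U n s t b g s' t' *; eapply permanent_computes; eassumption.
- exact: out_ext.
- by move=> n s w; exact: mevent_GPE_mul.
- by move=> n s w; exact: mevent_GPE2_add.
move=> O beta2 Ob.
(* The first term meets the oracle's demand on every query, the second makes rounding fine enough:
   as [b < 2^b], it suffices that [b] reaches [72 L^5 (n + 1) s]. *)
exists (fun x => beta2.[(x + Ps.[x])%N] +
  72 * (spread M d x x x ^ 5 * (x.+1 * x)))%N.
  have pid := polybounded_id; have pc := polybounded_cst.
  apply: polyboundedD.
    apply: (@polybounded_comp (fun x => beta2.[x])).
    - exact: polybounded_horner.
    - by apply: polyboundedD; [exact: pid|exact: polybounded_horner].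
  apply: polyboundedM; first exact: pc.
  apply: polyboundedM.
    apply: (@polyboundedX (fun x => spread M d x x x)).
    by apply: (eq_polybounded _ (polybounded_horner Ps)) => x;
      apply: leq_trans (HPs x); exact: leq_addl.
  apply: polyboundedM => //.
  by apply: (@eq_polybounded _ (fun x => x + 1)%N) => [x|]; [rewrite addn1|exact: polyboundedD].
move=> n s t b s0 t0 bb.
set T := inverse_delta n s t; set s' := inverse_epsilon M d n s t.
set L := spread M d n s t.
have [s'0 T0] := parameters_gt0 M d n s0 t0.
have [sx Tx Lx] := @leq_parameters M d n s t (n + s + t)%N ltac:(lia) ltac:(lia) ltac:(lia).
set x := (n + s + t)%N in bb sx Tx Lx.
have sTx : (s' + T <= Ps.[x])%N.
  by apply: leq_trans (HPs x); apply: leq_trans (leq_addr _ _); exact: leq_add.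
have b2 k : (k <= n)%N -> (beta2.[(k + s' + T)%N] <= b)%N.
  move=> kn; apply: leq_trans bb; apply: leq_trans (leq_addr _ _).
  by apply: leq_horner; rewrite -addnA leq_add// /x; lia.
have bR : (72 * (L ^ 5 * (n.+1 * s)) <= 2 ^ b)%N.
  apply: leq_trans (ltnW (ltn_expl b (isT : 1 < 2)%N)).
  apply: leq_trans bb; apply: leq_trans (leq_addl _ _).
  rewrite leq_mul2l /= leq_mul ?leq_exp2r// leq_mul// /x; lia.
have TL : (5 * T <= L)%N.
  rewrite /L /spread -/T; apply: leq_mul; first exact: leq_addl.
  by rewrite expnS; apply: leq_trans (leq_pmulr _ _); [lia|rewrite expn_gt0 addn1].
have L1 : (1 <= L)%N by lia.
have TR : 0 < T%:R :> R by rewrite ltr0n.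
have LR : 0 < L%:R :> R by rewrite ltr0n.
have pL k : (k <= n)%N -> p.[k%:R, T%:R] ^+ 2 <= L%:R :> R.
  move=> kn; pose z := (n + T + 1)%N.
  have h := Hp k%:R T%:R z%:R.
  have {}h : `|p.[k%:R, T%:R]| <= M0%:R * z%:R ^+ d0.
    by apply: h; rewrite ?normr_nat ?ler_nat ?ler1n /z; lia.
  rewrite -real_normK ?num_real//.
  apply: (@le_trans _ _ ((M0%:R * z%:R ^+ d0) ^+ 2)).
    by rewrite lerXn2r// nnegrE mulr_ge0// exprn_ge0.
  rewrite exprMn -exprM -!natrX -natrM ler_nat /L /spread -/T -/z.
  apply: leq_mul; first exact: leq_addr.
  by apply: leq_pexp2l; rewrite /z /d; lia.
have lev k : (k < n)%N ->
    likely (10 * T%:R^-1) [set X : 'M[C]_n | level_good O s' T b L%:R k X].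
  move=> kn; apply: likely_level_good => //.
  - rewrite ler_pdivrMr// mulrC ler_pdivlMr//.
    by rewrite -natrM ler_nat.
  - exact: Ob (b2 _ kn).
  (* Anti-concentration is used at failure probability [1 / T], so that [p] is evaluated at [T],
     where [L] bounds its square. *)
  have ti : 0 < T%:R^-1 :> R by rewrite invr_gt0.
  apply: likely_mono (per_lower_likely p0 pacc k.+1 ti) _ _.
    by apply: mevent_le => //; exact: measurable_sqn_per.
  move=> X /=; rewrite invrK; apply: le_trans.
  rewrite ler_wpM2l// lef_pV2 ?posrE//; first exact: pL.
  by rewrite exprn_gt0//; have := p0 k.+1 _ ti; rewrite invrK.
have e0 : 0 <= 10 * T%:R^-1 :> R by rewrite mulr_ge0// invr_ge0.
have all := likely_forall e0 lev.
have {}all : likely t%:R^-1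
    [set X : 'M[C]_n | forall k, (k < n)%N -> level_good O s' T b L%:R k X].
  apply: likely_weaken all; rewrite /T /inverse_delta !natrM.
  have tR : 0 < t%:R :> R by rewrite ltr0n.
  have nR : n%:R <= n.+1%:R :> R by rewrite ler_nat.
  have n0 : 0 < n.+1%:R :> R by rewrite ltr0n.
  rewrite [leLHS](_ : _ = (n%:R / n.+1%:R) * t%:R^-1); last by field; rewrite !gt_eqF.
  by rewrite ler_piMl ?invr_ge0// ler_pdivrMr// mul1r.
apply: likely_mono all _ _.
  (* Extension of an integer matrix by 0 to natural indices. It presents the output as a function of
     the rounded matrix, so that [mevent_round] applies. *)
  pose G (g : 'M[int * int]_n) (i j : nat) : int * int :=
    if insub i is Some i' then if insub j is Some j' then g i' j' else 0 else 0.
  have GE (X : 'M[C]_n) : out O n s' T b (G (\matrix_(i, j) round_entry b (X i j))) =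
      out O n s' T b (rounding b X).
    by apply: out_ext => i j ni nj; rewrite /G /rounding /ent !insubT /= mxE.
  rewrite [X in mevent X](_ : _ = [set X : 'M[C]_n |
      GPE_mul X s (out O n s' T b (G (\matrix_(i, j) round_entry b (X i j))))]).
    apply: (@mevent_round R n b
      (fun g => [set X | GPE_mul X s (out O n s' T b (G g))])) => g.
    exact: mevent_GPE_mul.
  by apply/seteqP; split => X /=; rewrite GE.
move=> X good; apply: permanent_estimate good => //.
- by rewrite ler1n.
- by rewrite -!natrX -!natrM ler_nat /s' /inverse_epsilon -/L -!mulnA.
- clearbody L; rewrite -!natrX -!natrM ler_nat.
  by rewrite -(mulnA 72) -(mulnA 72) -(mulnA (L ^ 5)%N).
Qed.

End FinalReduction.

Theorem theorem7 (R : realType) :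
  PACC R -> poly_equivalent (@GPE2_add R) (@GPE_mul R).
Proof.
by move=> pacc; split; [exact: GPE2_add_reducible|exact: GPE_mul_reducible].
Qed.
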